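(* Let $R,\varepsilon>0$ and let $f\in\mathbb{R}[x_1]\setminus\{0\}$ have degree $D$ and at most $3$ monomial terms. Then one can $\varepsilon$-approximate all the roots of $f$ in the closed interval $[0,R]$ using just $O\!\left(\log(D)\log\left(D\log\frac{R}{\varepsilon}\right)\right)$ arithmetic operations. In particular, one can count exactly the number of roots of $f$ in any bounded interval using just $O(\log^2 D)$ arithmetic operations.
   Context: For $I\subseteq\mathbb{R}$ and $f\in\mathbb{R}[x_1]$ whose distinct roots in $I$ are $\zeta_1,\ldots,\zeta_m$, ''$\varepsilon$-approximating the roots of $f$ in $I$'' means finding real numbers $z_1,\ldots,z_m\in I$ such that for every $i\in\{1,\ldots,m\}$ there is some $j\in\{1,\ldots,m\}$ with $|\zeta_i-z_j|<\varepsilon$ (in particular this yields a correct count of the roots in $I$). The model of computation is the BSS machine over $\mathbb{R}$ (real arithmetic and comparisons allowed); arithmetic operations are counted as field operations in the field generated over $\mathbb{Q}$ by the coefficients of $f$. All $O$-constants are absolute and effectively computable. *)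

(* Defs.v *)
From mathcomp Require Import all_boot all_order all_algebra.
From mathcomp Require Import reals exp.
Set Implicit Arguments. Unset Strict Implicit. Unset Printing Implicit Defensive.
Import Order.TTheory GRing.Theory Num.Theory.
Local Open Scope ring_scope.

(* A BSS-style register machine over a real field.                        *)
(* Registers are indexed by nat; the program is a finite list of          *)
(* instructions with rational machine constants.  Every executed          *)
(* instruction (arithmetic, constant load, comparison/branch, halt)       *)
(* costs one step.  Division by zero makes the machine fail (no result).  *)
Inductive instr :=
| IConst of nat & rat
| IAdd of nat & nat & nat
| ISub of nat & nat & nat
| IMul of nat & nat & nat
| IDiv of nat & nat & nat
| IBranch of nat & nat
| IHalt.

Definition program := seq instr.

Section Machine.
Variable R : realType.

Definition mstate := nat -> R.

Definition upd (st : mstate) (k : nat) (v : R) : mstate :=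
  fun n => if n == k then v else st n.

Fixpoint exec (p : program) (fuel pc : nat) (st : mstate) : option mstate :=
  match fuel with
  | 0 => None
  | fuel'.+1 =>
    match nth IHalt p pc with
    | IHalt => Some st
    | IConst k q => exec p fuel' pc.+1 (upd st k (ratr q))
    | IAdd i j k => exec p fuel' pc.+1 (upd st k (st i + st j))
    | ISub i j k => exec p fuel' pc.+1 (upd st k (st i - st j))
    | IMul i j k => exec p fuel' pc.+1 (upd st k (st i * st j))
    | IDiv i j k =>
        if st j == 0 then None else exec p fuel' pc.+1 (upd st k (st i / st j))
    | IBranch i l => if 0 <= st i then exec p fuel' l st
                     else exec p fuel' pc.+1 st
    end
  end.

Definition init_state (xs : seq R) : mstate := fun n => nth 0 xs n.

Definition runs_within (p : program) (xs : seq R) (n : nat) (st : mstate) :=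
  exec p n 0 (init_state xs) = Some st.

Definition trinom (c0 c1 c2 : R) (a0 a1 a2 : nat) : {poly R} :=
  c0 *: 'X^a0 + c1 *: 'X^a1 + c2 *: 'X^a2.

Definition eps_approx_roots (f : {poly R}) (I : pred R) (eps : R) (zs : seq R) :=
  [/\ (forall z, z \in zs -> I z),
      (forall s : seq R, uniq s -> (forall x, (x \in s) = I x && root f x) ->
         size zs = size s)
    & (forall x, I x -> root f x -> exists2 z, z \in zs & `|x - z| < eps)].

Definition outputs (st : mstate) (zs : seq R) :=
  st 8%N = (size zs)%:R /\ zs = [seq st (9 + i)%N | i <- iota 0 (size zs)].

Definition in_interval (bl br : bool) (a b x : R) : bool :=
  (if bl then a <= x else a < x) && (if br then x <= b else x < b).

(* log(D) log(D log(R/eps)), made >= 1-ish so that O() is meaningful for  *)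
(* small parameters                                                       *)
Definition cost_approx (D : nat) (Rb eps : R) : R :=
  ln (D.+3)%:R * ln ((D.+3)%:R * (3 + Num.max 0 (ln (Rb / eps)))).

Definition cost_count (D : nat) : R := ln (D.+3)%:R ^+ 2.

End Machine.

(* Main.v *)
Require Import Defs.
From mathcomp Require Import all_boot all_order all_algebra.
From mathcomp Require Import reals exp.
From mathcomp Require Import ring lra zify.
Import Order.TTheory GRing.Theory Num.Theory.
Set Implicit Arguments. Unset Strict Implicit. Unset Printing Implicit Defensive.
Local Open Scope ring_scope.

(* Dividing the trinomial by a power of [x], and possibly substituting [1 / x] for [x], one
   writes every positive root as a root [z] of some [h x = A x^m + B x^l + C] with [A > 0],
   [B >= 0], [m > 0] and [l] of any sign, at a point where [h' z >= 0].  Such an [h] is convex,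
   so [h] increases from [z] on and the position of [z] relative to a given point is decided
   by the signs of [h] and [h'] there; whether a (+,-,+) trinomial has zero, one or two
   positive roots is decided by a discriminant.  This gives the exact counts.

   To approximate [z] in [1, H], first move the origin of the scale to a point [w >= 1] where
   [h' w >= 0], equal to [1] or to an approximation from above of the critical point of [h]
   (itself the root of a binomial): either [h w >= 0] and [w] is good enough, or after
   rescaling by [w] one has [h' 1 >= 0 > h 1].  Then [(x - 1) h'' x <= M h' x] for [x > 1]
   with [M = m + |l|], so that Newton's method converges quadratically from any starting
   point [x >= z] with [x - 1 <= (1 + 1 / 2M) (z - 1)].  Such a point is found on the grid
   [1 + (1 + 1 / 2M)^k / H].  The machine has no square root to bisect the exponents [k], but
   a Fibonacci search works: from [b^F_i] and [b^F_(i+1)] one gets [b^F_(i-1)] by a division.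
   It takes O(log (D log H)) evaluations of [h], each of cost O(log D), and the Newton phase
   O(log log H) more. *)

(** * Structured programs and their compilation *)

(** Convexity needs no calculus: Bernoulli's inequality holds for every integer exponent, so each
    [x ^ k] lies above its tangents, and so does a non-negative combination of two such powers. This
    dictates the shape of [h]: up to an overall sign, the constant term is the only coefficient
    allowed to be negative, which is what division by a power of [x] and inversion arrange. The
    obstacle is a root arbitrarily close to the critical point, where Newton's method degenerates.
    The distance to the origin of the scale is therefore searched geometrically, from [1 / H] to
    [H]; a root closer than [1 / H] is already approximated by [1 + 1 / H]. With ratio [1 + 1 / 2M]
    there are O(M log H) grid points, and a search logarithmic in their number costs log D + log log
    H tests. All accuracies are relative, hence stable under rescaling. The absolute error comes
    from working on [[low, U]] with [low < eps] and [H = U / low]. The programs know neither the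
    degree nor an iteration count: [L] and [kap] live only in the proofs, and every loop stops by a
    test on its registers. *)

Inductive expr :=
| V of nat | N of nat
| Add of expr & expr | Sub of expr & expr | Mul of expr & expr | Div of expr & expr.
Coercion V : nat >-> expr.
Declare Scope expr_scope.
Bind Scope expr_scope with expr.
Delimit Scope expr_scope with E.
Infix "+" := Add : expr_scope.
Infix "-" := Sub : expr_scope.
Infix "*" := Mul : expr_scope.
Infix "/" := Div : expr_scope.

(** Guards are sign tests, as on the machine: [If e c1 c2] runs [c1] when [e >= 0], and [While e c]
    repeats [c] as long as [e < 0]. *)
Inductive cmd :=
| Skip
| Asg of nat & expr
| Seq of cmd & cmd
| If of expr & cmd & cmd
| While of expr & cmd.
Declare Scope cmd_scope.
Bind Scope cmd_scope with cmd.
Delimit Scope cmd_scope with C.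
Notation "x ::= e" := (Asg x e) (at level 65) : cmd_scope.
Notation "c1 ;; c2" := (Seq c1 c2) (at level 67, right associativity) : cmd_scope.

(* Registers from [tmp] on are scratch space for the evaluation of expressions. *)
Definition tmp := 100%N.

(** The registers from [k] on serve as an evaluation stack whose result ends up in [k]. For lack of
    a copy instruction, a variable is read by adding it to zero. *)
Fixpoint ecode (e : expr) (k : nat) : seq instr :=
  match e with
  | V n => [:: IConst k 0; IAdd n k k]
  | N c => [:: IConst k c%:R]
  | Add e1 e2 => ecode e1 k ++ ecode e2 k.+1 ++ [:: IAdd k k.+1 k]
  | Sub e1 e2 => ecode e1 k ++ ecode e2 k.+1 ++ [:: ISub k k.+1 k]
  | Mul e1 e2 => ecode e1 k ++ ecode e2 k.+1 ++ [:: IMul k k.+1 k]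
  | Div e1 e2 => ecode e1 k ++ ecode e2 k.+1 ++ [:: IDiv k k.+1 k]
  end.

Fixpoint ecost (e : expr) : nat :=
  match e with
  | V _ => 2
  | N _ => 1
  | Add e1 e2 | Sub e1 e2 | Mul e1 e2 | Div e1 e2 => ecost e1 + (ecost e2 + 1)
  end.

Fixpoint ewf (e : expr) : bool :=
  match e with
  | V n => (n < tmp)%N
  | N _ => true
  | Add e1 e2 | Sub e1 e2 | Mul e1 e2 | Div e1 e2 => ewf e1 && ewf e2
  end.

Fixpoint csize (c : cmd) : nat :=
  match c with
  | Skip => 0
  | Asg _ e => ecost e + 2
  | Seq c1 c2 => csize c1 + csize c2
  | If e c1 c2 => ecost e + (1 + (csize c2 + (2 + csize c1)))
  | While e c => ecost e + (1 + (csize c + 2))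
  end.

(** Branch targets are absolute, hence the argument [pc]. An unconditional jump is encoded by
    loading 0 and branching on it; the else branch is laid out first. *)
Fixpoint ccode (c : cmd) (pc : nat) : seq instr :=
  match c with
  | Skip => [::]
  | Asg x e => ecode e tmp ++ [:: IConst tmp.+1 0; IAdd tmp tmp.+1 x]
  | Seq c1 c2 => ccode c1 pc ++ ccode c2 (pc + csize c1)
  | If e c1 c2 =>
      let p2 := (pc + ecost e + 1)%N in
      let p1 := (p2 + csize c2 + 2)%N in
      ecode e tmp ++ [:: IBranch tmp p1] ++ ccode c2 p2 ++
        [:: IConst tmp 0; IBranch tmp (p1 + csize c1)] ++ ccode c1 p1
  | While e c =>
      let p1 := (pc + ecost e + 1)%N in
      ecode e tmp ++ [:: IBranch tmp (p1 + csize c + 2)] ++ ccode c p1 ++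
        [:: IConst tmp 0; IBranch tmp pc]
  end.

Fixpoint cwf (c : cmd) : bool :=
  match c with
  | Skip => true
  | Asg x e => (x < tmp)%N && ewf e
  | Seq c1 c2 => cwf c1 && cwf c2
  | If e c1 c2 => [&& ewf e, cwf c1 & cwf c2]
  | While e c => ewf e && cwf c
  end.

Fixpoint mods (c : cmd) : seq nat :=
  match c with
  | Skip => [::]
  | Asg x _ => [:: x]
  | Seq c1 c2 | If _ c1 c2 => mods c1 ++ mods c2
  | While _ c => mods c
  end.

Lemma size_ecode e k : size (ecode e k) = ecost e.
Proof. by elim: e k => //= e1 IH1 e2 IH2 k; rewrite !size_cat IH1 IH2. Qed.

Lemma size_ccode c pc : size (ccode c pc) = csize c.
Proof.
elim: c pc => //= [x e|c1 IH1 c2 IH2|e c1 IH1 c2 IH2|e c IH] pc;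
  by rewrite ?size_cat /= ?size_cat /= ?size_cat ?size_ecode ?IH1 ?IH2 ?IH /= ?addn1 ?addn2.
Qed.

(** * Cost semantics and correctness of the compilation *)

Section Semantics.
Variable R : realType.
Implicit Types (s st : mstate R) (p : program) (c : cmd) (e : expr).

Fixpoint eval s e : R :=
  match e with
  | V n => s n
  | N c => c%:R
  | Add e1 e2 => eval s e1 + eval s e2
  | Sub e1 e2 => eval s e1 - eval s e2
  | Mul e1 e2 => eval s e1 * eval s e2
  | Div e1 e2 => eval s e1 / eval s e2
  end.

Fixpoint edef s e : Prop :=
  match e with
  | V _ | N _ => True
  | Add e1 e2 | Sub e1 e2 | Mul e1 e2 => edef s e1 /\ edef s e2
  | Div e1 e2 => [/\ edef s e1, edef s e2 & eval s e2 != 0]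
  end.

(** A derivation exists only for a terminating run without division by zero, and its number is the
    exact count of machine instructions. The summand 2 pays for an encoded jump, after an else
    branch or at the end of a loop body. *)
Inductive bs : cmd -> mstate R -> nat -> mstate R -> Prop :=
| bs_skip s : bs Skip s 0 s
| bs_asg x e s : edef s e -> bs (Asg x e) s (ecost e + 2) (upd s x (eval s e))
| bs_seq c1 c2 s n1 s1 n2 s2 :
    bs c1 s n1 s1 -> bs c2 s1 n2 s2 -> bs (Seq c1 c2) s (n1 + n2) s2
| bs_ifT e c1 c2 s n s' : edef s e -> 0 <= eval s e ->
    bs c1 s n s' -> bs (If e c1 c2) s (ecost e + 1 + n) s'
| bs_ifF e c1 c2 s n s' : edef s e -> eval s e < 0 ->
    bs c2 s n s' -> bs (If e c1 c2) s (ecost e + 1 + n + 2) s'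
| bs_stop e c s : edef s e -> 0 <= eval s e -> bs (While e c) s (ecost e + 1) s
| bs_iter e c s n1 s1 n2 s2 : edef s e -> eval s e < 0 ->
    bs c s n1 s1 -> bs (While e c) s1 n2 s2 ->
    bs (While e c) s (ecost e + 1 + n1 + 2 + n2) s2.

Lemma bs_frame c s n s' k : bs c s n s' -> k \notin mods c -> s' k = s k.
Proof.
move=> H; elim: H => {c s n s'} //=.
- by move=> x e s _; rewrite inE /upd => /negbTE ->.
- move=> c1 c2 s n1 s1 n2 s2 _ IH1 _ IH2; rewrite mem_cat negb_or => /andP[k1 k2].
  by rewrite IH2 // IH1.
- by move=> e c1 c2 s n s' _ _ _ IH; rewrite mem_cat negb_or => /andP[/IH].
- by move=> e c1 c2 s n s' _ _ _ IH; rewrite mem_cat negb_or => /andP[_ /IH].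
- by move=> e c s n1 s1 n2 s2 _ _ _ IH1 _ IH2 kc; rewrite IH2 // IH1.
Qed.

Definition code_at p pc (q : seq instr) :=
  forall i, (i < size q)%N -> nth IHalt p (pc + i) = nth IHalt q i.

Lemma code_at_cat p pc q1 q2 : code_at p pc (q1 ++ q2) ->
  code_at p pc q1 /\ code_at p (pc + size q1) q2.
Proof.
move=> H; split=> i ilt.
  by rewrite H ?nth_cat ?ilt // size_cat ltn_addr.
by rewrite -addnA H ?nth_cat ?size_cat ?ltn_add2l // ltnNge leq_addr /= addKn.
Qed.

Lemma code_at_cons p pc i q : code_at p pc (i :: q) ->
  nth IHalt p pc = i /\ code_at p pc.+1 q.
Proof.
move=> H; split; first by have := H 0%N isT; rewrite addn0.
by move=> j jlt; have := H j.+1 jlt; rewrite addnS.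
Qed.

(** Quantifying over the leftover fuel is what makes runs compose. *)
Definition steps p n pc s pc' s' :=
  forall fuel, exec p (n + fuel) pc s = exec p fuel pc' s'.

Lemma steps_trans p n1 n2 pc s pc1 s1 pc2 s2 :
  steps p n1 pc s pc1 s1 -> steps p n2 pc1 s1 pc2 s2 ->
  steps p (n1 + n2) pc s pc2 s2.
Proof. by move=> H1 H2 fuel; rewrite -addnA H1 H2. Qed.

Definition agree s st := forall k, (k < tmp)%N -> s k = st k.

Lemma updE s k v j : upd s k v j = if j == k then v else s j.
Proof. by []. Qed.

(** Preservation of the registers below [k] is what protects the left operand while the right one is
    evaluated one register higher. *)
Lemma ecode_correct p e pc k s st : code_at p pc (ecode e k) -> (tmp <= k)%N ->
  ewf e -> edef st e -> agree s st ->
  exists s', [/\ steps p (ecost e) pc s (pc + ecost e) s', s' k = eval st e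
    & forall j, (j < k)%N -> s' j = s j].
Proof.
elim: e pc k s => [n|c|e1 IH1 e2 IH2|e1 IH1 e2 IH2|e1 IH1 e2 IH2|e1 IH1 e2 IH2] pc k s /=.
- move=> /code_at_cons[i1 /code_at_cons[i2 _]] tk nlt _ ag.
  exists (upd (upd s k (ratr 0)) k (upd s k (ratr 0) n + upd s k (ratr 0) k)); split.
  + by move=> fuel; rewrite /= i1 /= i2 /= addn2.
  + rewrite !updE !eqxx rmorph0 addr0 -ag // ifN //.
    by rewrite neq_ltn (leq_trans nlt tk).
  + by move=> j jk; rewrite !updE !ltn_eqF.
- move=> /code_at_cons[i1 _] tk _ _ ag.
  exists (upd s k (ratr c%:R)); split.
  + by move=> fuel; rewrite /= i1 /= addn1.
  + by rewrite updE eqxx ratr_nat.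
  + by move=> j jk; rewrite !updE !ltn_eqF.
all: move=> /code_at_cat[H1 /code_at_cat[H2 /code_at_cons[H3 _]]] tk /andP[w1 w2];
  rewrite size_ecode in H2 H3; rewrite size_ecode in H3.
1-3: move=> [d1 d2] ag.
4: move=> [d1 d2 d3] ag.
all: have [s1 [S1 v1 f1]] := IH1 _ _ _ H1 tk w1 d1 ag;
  (have ag1 : agree s1 st by move=> j jt; rewrite f1 ?ag // (leq_trans jt tk));
  have [s2 [S2 v2 f2]] := IH2 _ _ _ H2 (leqW tk) w2 d2 ag1;
  have v1' : s2 k = eval st e1 by rewrite f2.
- exists (upd s2 k (s2 k + s2 k.+1)); split.
  + apply: steps_trans S1 _; apply: steps_trans S2 _ => fuel.
    by rewrite /= H3 /= !addnA addn1.
  + by rewrite updE eqxx v1' v2.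
  + by move=> j jk; rewrite updE ltn_eqF // f2 ?f1 // ltnW.
- exists (upd s2 k (s2 k - s2 k.+1)); split.
  + apply: steps_trans S1 _; apply: steps_trans S2 _ => fuel.
    by rewrite /= H3 /= !addnA addn1.
  + by rewrite updE eqxx v1' v2.
  + by move=> j jk; rewrite updE ltn_eqF // f2 ?f1 // ltnW.
- exists (upd s2 k (s2 k * s2 k.+1)); split.
  + apply: steps_trans S1 _; apply: steps_trans S2 _ => fuel.
    by rewrite /= H3 /= !addnA addn1.
  + by rewrite updE eqxx v1' v2.
  + by move=> j jk; rewrite updE ltn_eqF // f2 ?f1 // ltnW.
- exists (upd s2 k (s2 k / s2 k.+1)); split.
  + apply: steps_trans S1 _; apply: steps_trans S2 _ => fuel.
    by rewrite /= H3 /= v2 (negbTE d3) !addnA addn1.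
  + by rewrite updE eqxx v1' v2.
  + by move=> j jk; rewrite updE ltn_eqF // f2 ?f1 // ltnW.
Qed.

Lemma ecode_correct_tmp p e pc s st : code_at p pc (ecode e tmp) ->
  ewf e -> edef st e -> agree s st ->
  exists s', [/\ steps p (ecost e) pc s (pc + ecost e) s', s' tmp = eval st e
    & agree s' st].
Proof.
move=> H w d ag; have [s' [S v f]] := ecode_correct H (leqnn _) w d ag.
by exists s'; split=> // j jt; rewrite f // ag.
Qed.

Lemma agree_updT s st k v : (tmp <= k)%N -> agree s st -> agree (upd s k v) st.
Proof. by move=> tk ag j jt; rewrite updE ltn_eqF ?ag // (leq_trans jt tk). Qed.

Lemma ccode_correct p c st n st' : bs c st n st' -> forall pc s,
  code_at p pc (ccode c pc) -> cwf c -> agree s st ->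
  exists2 s', steps p n pc s (pc + csize c) s' & agree s' st'.
Proof.
elim=> {c st n st'} /=.
- by move=> s pc s0 _ _ ag; exists s0; rewrite ?addn0.
- move=> x e st d pc s /code_at_cat[H1 /code_at_cons[H2 /code_at_cons[H3 _]]].
  rewrite size_ecode in H2 H3 => /andP[xt w] ag.
  have [s1 [S1 v1 ag1]] := ecode_correct_tmp H1 w d ag.
  exists (upd (upd s1 tmp.+1 (ratr 0)) x (s1 tmp + ratr 0)).
    apply: steps_trans S1 _ => fuel.
    by rewrite addnA addn2 /= H2 /= H3 /= !updE.
  move=> j jt; rewrite !updE; case: eqP => // _.
    by rewrite rmorph0 addr0.
  by rewrite ltn_eqF ?ag1 // ltnW.
- move=> c1 c2 s n1 s1 n2 s2 _ IH1 _ IH2 pc s0 /code_at_cat[H1 H2] /andP[w1 w2] ag.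
  rewrite size_ccode in H2.
  have [s1' S1 ag1] := IH1 _ _ H1 w1 ag.
  have [s2' S2 ag2] := IH2 _ _ H2 w2 ag1.
  by exists s2' => //; rewrite addnA; apply: steps_trans S1 S2.
- move=> e c1 c2 st n st' d ge0 _ IH pc s.
  move=> /code_at_cat[H1 /code_at_cons[H2 /code_at_cat[_ /code_at_cons[_ /code_at_cons[_ H3]]]]].
  rewrite !size_ecode ?size_ccode in H2 H3 => /and3P[w w1 w2] ag.
  have [s1 [S1 v1 ag1]] := ecode_correct_tmp H1 w d ag.
  have {}H3 : code_at p (pc + ecost e + 1 + csize c2 + 2) (ccode c1 (pc + ecost e + 1 + csize c2 + 2)).
    by move: H3; congr (code_at p _); lia.
  have [s2 S2 ag2] := IH _ _ H3 w1 ag1.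
  exists s2 => //.
  apply: steps_trans; first apply: steps_trans S1 (_ : steps p 1 _ _ (pc + ecost e + 1 + csize c2 + 2) s1).
    by move=> fuel; rewrite /= H2 v1 ge0.
  by have -> : (pc + (ecost e + (1 + (csize c2 + (2 + csize c1)))) = pc + ecost e + 1 + csize c2 + 2 + csize c1)%N by lia.
- move=> e c1 c2 st n st' d lt0 _ IH pc s.
  move=> /code_at_cat[H1 /code_at_cons[H2 /code_at_cat[H3 /code_at_cons[H4 /code_at_cons[H5 _]]]]].
  rewrite !size_ecode ?size_ccode in H2 H3 H4 H5 => /and3P[w w1 w2] ag.
  have [s1 [S1 v1 ag1]] := ecode_correct_tmp H1 w d ag.
  rewrite -addn1 in H3.
  have [s2 S2 ag2] := IH _ _ H3 w2 ag1.
  exists (upd s2 tmp (ratr 0)); last exact: agree_updT.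
  apply: (@steps_trans _ _ _ _ _ (pc + ecost e + 1 + csize c2) s2).
    apply: (@steps_trans _ _ _ _ _ (pc + ecost e + 1) s1) S2.
    apply: steps_trans S1 _ => fuel.
    by rewrite /= H2 v1 leNgt lt0 /= addn1.
  move=> fuel; rewrite -[(_ + 1 + _)%N]/(pc + ecost e + 1 + csize c2)%N addn1 /= H4 /= H5 !updE eqxx rmorph0 lexx.
  congr (exec _ _ _ _); lia.
- move=> e c st d ge0 pc s /code_at_cat[H1 /code_at_cons[H2 _]].
  rewrite !size_ecode in H2 => /andP[w _] ag.
  have [s1 [S1 v1 ag1]] := ecode_correct_tmp H1 w d ag.
  exists s1 => //; apply: steps_trans S1 _ => fuel.
  rewrite /= H2 v1 ge0; congr (exec _ _ _ _); lia.
- move=> e c st n1 st1 n2 st2 d lt0 _ IH1 _ IH2 pc s H /andP[w w1] ag.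
  move: (H) => /code_at_cat[H1 /code_at_cons[H2 /code_at_cat[H3 /code_at_cons[H4 /code_at_cons[H5 _]]]]].
  rewrite !size_ecode ?size_ccode in H2 H3 H4 H5.
  have [s1 [S1 v1 ag1]] := ecode_correct_tmp H1 w d ag.
  rewrite -addn1 in H3.
  have [s2 S2 ag2] := IH1 _ _ H3 w1 ag1.
  have ag2' : agree (upd s2 tmp (ratr 0)) st1 by exact: agree_updT.
  have [|s3 S3 ag3] := IH2 pc _ H _ ag2'; first by rewrite w.
  exists s3 => //; apply: steps_trans S3.
  apply: (@steps_trans _ _ _ _ _ (pc + ecost e + 1 + csize c) s2).
    apply: (@steps_trans _ _ _ _ _ (pc + ecost e + 1) s1) S2.
    apply: steps_trans S1 _ => fuel.
    by rewrite /= H2 v1 leNgt lt0 /= addn1.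
  by move=> fuel; rewrite addn1 /= H4 /= H5 !updE eqxx rmorph0 lexx.
Qed.

Lemma runs_compiled c xs n st : cwf c -> bs c (init_state xs) n st ->
  exists2 s, runs_within (ccode c 0) xs n.+1 s & agree s st.
Proof.
move=> w H.
have ca : code_at (ccode c 0) 0 (ccode c 0) by move=> i _; rewrite add0n.
have [s S ag] := ccode_correct H ca w (fun k _ => erefl).
exists s => //; rewrite /runs_within -addn1 S /= add0n.
(* Past its end the code reads as [IHalt], the default value of [nth]; executing it is the extra
   step in [n.+1]. *)
by rewrite nth_default ?size_ccode.
Qed.

(** * Total correctness with running time *)

Definition wp c s (Q : nat -> mstate R -> Prop) := exists n s', bs c s n s' /\ Q n s'.

(** The frame property is built into the consequence rule, so that specifications mention only the
    registers of interest. *)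
Lemma wp_conseq c s (Q Q' : nat -> mstate R -> Prop) :
  wp c s Q -> (forall n s', (forall k, k \notin mods c -> s' k = s k) -> Q n s' -> Q' n s') ->
  wp c s Q'.
Proof.
move=> [n [s' [b q]]] H; exists n, s'; split=> //; apply: H q => k.
exact: bs_frame b.
Qed.

Lemma wp_skip s (Q : nat -> mstate R -> Prop) : Q 0%N s -> wp Skip s Q.
Proof. by move=> q; exists 0%N, s; split=> //; constructor. Qed.

Lemma wp_asg x e s (Q : nat -> mstate R -> Prop) :
  edef s e -> Q (ecost e + 2)%N (upd s x (eval s e)) -> wp (Asg x e) s Q.
Proof. by move=> d q; do 2 eexists; split; [constructor|]. Qed.

Lemma wp_asg_eq x e v s (Q : nat -> mstate R -> Prop) :
  edef s e -> eval s e = v -> Q (ecost e + 2)%N (upd s x v) -> wp (Asg x e) s Q.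
Proof. by move=> d <-; exact: wp_asg. Qed.

Lemma wp_seq c1 c2 s (Q : nat -> mstate R -> Prop) :
  wp c1 s (fun n1 s1 => wp c2 s1 (fun n2 s2 => Q (n1 + n2)%N s2)) ->
  wp (Seq c1 c2) s Q.
Proof.
move=> [n1 [s1 [b1 [n2 [s2 [b2 q]]]]]]; exists (n1 + n2)%N, s2; split=> //.
exact: bs_seq b1 b2.
Qed.

Lemma wp_if e c1 c2 s (Q : nat -> mstate R -> Prop) : edef s e ->
  (0 <= eval s e -> wp c1 s (fun n s' => Q (ecost e + 1 + n)%N s')) ->
  (eval s e < 0 -> wp c2 s (fun n s' => Q (ecost e + 1 + n + 2)%N s')) ->
  wp (If e c1 c2) s Q.
Proof.
move=> d H1 H2; case: (leP 0 (eval s e)) => he.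
  by have [n [s' [b q]]] := H1 he; do 2 eexists; split; [apply: bs_ifT b|].
by have [n [s' [b q]]] := H2 he; do 2 eexists; split; [apply: bs_ifF b|].
Qed.

(* [Inv k s]: the loop is at state [s] with at most [k] iterations to go. *)
Lemma wp_while (Inv : nat -> mstate R -> Prop) (N : nat) e c s k : Inv k s ->
  (forall j s', Inv j s' -> (forall i, i \notin mods c -> s' i = s i) -> edef s' e) ->
  (forall j s', Inv j s' -> (forall i, i \notin mods c -> s' i = s i) -> eval s' e < 0 ->
     exists2 j', j = j'.+1 & wp c s' (fun n s2 => (n <= N)%N /\ Inv j' s2)) ->
  wp (While e c) s (fun n s' => (n <= k.+1 * (N + ecost e + 3))%N /\
     (0 <= eval s' e /\ exists j, Inv j s')).
Proof.
move=> Ik Hd Hs.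
suff H s1 : (forall i, i \notin mods c -> s1 i = s i) -> Inv k s1 ->
    wp (While e c) s1 (fun n s' => (n <= k.+1 * (N + ecost e + 3))%N /\
      (0 <= eval s' e /\ exists j, Inv j s')) by exact: H.
move=> fr0 {}Ik; move: s1 fr0 Ik.
elim: k => [|k IH] s1 fr1 I1.
  case: (leP 0 (eval s1 e)) => he; last by have [? //] := Hs _ _ I1 fr1 he.
  do 2 eexists; split; first by apply: bs_stop; [exact: Hd I1 fr1|].
  by split; [lia|split=> //; exists 0%N].
case: (leP 0 (eval s1 e)) => he.
  do 2 eexists; split; first by apply: bs_stop; [exact: Hd I1 fr1|].
  by split; [lia|split=> //; exists k.+1].
have [j' [<-] [n [s2 [b [nN I2]]]]] := Hs _ _ I1 fr1 he.
have [|n3 [s3 [b3 [n3N q]]]] := IH s2 _ I2.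
  by move=> i im; rewrite (bs_frame b) // fr1.
do 2 eexists; split; first by apply: bs_iter b b3 => //; exact: Hd I1 fr1.
split=> //; nia.
Qed.

End Semantics.

(** * Sums of two integer powers *)

Section IntPowers.
Variable F : realFieldType.
Implicit Types (x y z t : F) (k m l : int).

Lemma bernoulli_nat t n : 0 <= t -> 1 + n%:R * (t - 1) <= t ^+ n.
Proof.
move=> t0; elim: n => [|n IH]; first by rewrite expr0; lra.
have := ler_wpM2l t0 IH; rewrite -exprS; apply: le_trans.
have : 0 <= n%:R * (t - 1) ^+ 2 by rewrite mulr_ge0 ?sqr_ge0.
rewrite -natr1; nra.
Qed.

(** The tangent of [t ^ k] at 1. A negative exponent reduces to a natural power of [t^-1], because
    [t^-1 - 1] exceeds [1 - t] by [(t - 1)^2 / t]. *)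
Lemma bernoulli t k : 0 < t -> 1 + k%:~R * (t - 1) <= t ^ k.
Proof.
move=> t0; case: k => n; first exact/bernoulli_nat/ltW.
rewrite NegzE -exprz_inv; have ti0 : 0 < t^-1 by rewrite invr_gt0.
apply: le_trans (bernoulli_nat n.+1 (ltW ti0)).
rewrite mulrNz lerD2l.
have -> : - n.+1%:R * (t - 1) = n.+1%:R * (1 - t) by ring.
apply: ler_wpM2l => //.
have : 0 <= (t - 1) ^+ 2 / t by rewrite divr_ge0 ?sqr_ge0 ?ltW.
have -> : (t - 1) ^+ 2 / t = (t^-1 - 1) - (1 - t) by field; rewrite gt_eqF.
by rewrite subr_ge0.
Qed.

Lemma expz_ratio x z k : 0 < z -> (x / z) ^ k * z ^ k = x ^ k.
Proof. by move=> z0; rewrite -expfzMl divfK // gt_eqF. Qed.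

Lemma tangent x z k : 0 < x -> 0 < z ->
  k%:~R * z ^ k * (x / z - 1) <= x ^ k - z ^ k.
Proof.
move=> x0 z0; rewrite -(expz_ratio x k z0).
have := bernoulli k (divr_gt0 x0 z0); have := exprz_gt0 k z0.
move: (z ^ k) ((x / z) ^ k) => a b a0 H.
have := ler_wpM2r (ltW a0) H; lra.
Qed.

Lemma expz_ltr k x y : 0 < k -> 0 < x -> x < y -> x ^ k < y ^ k.
Proof.
move=> k0 x0 xy; case: k k0 => // -[|n] // _.
by rewrite -!exprnP ltrXn2r // ltW.
Qed.

Lemma expz_gtr k x y : k < 0 -> 0 < x -> x < y -> y ^ k < x ^ k.
Proof.
move=> k0 x0 xy; have e (u : F) : u ^ k = u^-1 ^ (- k) by rewrite exprz_inv opprK.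
rewrite (e x) (e y).
apply: expz_ltr; rewrite ?oppr_gt0 ?invr_gt0 ?(lt_trans x0) //.
by rewrite ltf_pV2 // posrE (lt_trans x0).
Qed.

Definition hfun (A B C : F) m l x := A * x ^ m + B * x ^ l + C.
(* [dfun A B m l x] is [x h'(x)] for [h = hfun A B C m l]. *)
Definition dfun (A B : F) m l x := m%:~R * A * x ^ m + l%:~R * B * x ^ l.

Variables (A B C : F) (m l : int).
Hypotheses (A0 : 0 < A) (B0 : 0 <= B) (m0 : 0 < m).
Notation h := (hfun A B C m l).
Notation D := (dfun A B m l).

Let mR0 : (0 : F) < m%:~R. Proof. by rewrite ltr0z. Qed.

(** Convexity of [h]: the left side is [h'(z) (x - z)]. *)
Lemma hfun_tangent x z : 0 < x -> 0 < z -> D z * (x / z - 1) <= h x - h z.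
Proof.
move=> x0 z0; have := ler_wpM2l (ltW A0) (tangent m x0 z0).
have := ler_wpM2l B0 (tangent l x0 z0); rewrite /hfun /dfun; lra.
Qed.

(** For [l >= 0] both terms are non-negative and the first is positive. For [l < 0] both terms grow
    with [x], the second because its coefficient is non-positive and its power decreases. *)
Lemma dfun_gt0_mono c x : 0 < c -> c < x -> 0 <= D c -> 0 < D x.
Proof.
move=> c0 cx; rewrite /dfun.
have x0 := lt_trans c0 cx.
have xm := exprz_gt0 m x0; have cm := exprz_gt0 m c0.
have xl := exprz_gt0 l x0; have cl := exprz_gt0 l c0.
case: (leP 0 l) => [l0|l0] Dc.
  apply: ltr_wpDr; last by rewrite !mulr_gt0.
  by rewrite !mulr_ge0 ?ler0z // ltW.
have lt1 := expz_ltr m0 c0 cx; have lt2 := expz_gtr l0 c0 cx.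
have : m%:~R * A * c ^ m < m%:~R * A * x ^ m by rewrite ltr_pM2l ?mulr_gt0.
have : l%:~R * B * c ^ l <= l%:~R * B * x ^ l.
  apply: ler_wnM2l; last exact: ltW.
  by rewrite mulr_le0_ge0 ?lerz0 // ltW.
lra.
Qed.

Lemma dfun_ge0_mono c x : 0 < c -> c <= x -> 0 <= D c -> 0 <= D x.
Proof.
move=> c0; rewrite le_eqVlt => /orP[/eqP<- //|cx] Dc.
exact/ltW/(dfun_gt0_mono c0 cx).
Qed.

Lemma hfun_lt c x : 0 < c -> c < x -> 0 <= D c -> h c < h x.
Proof.
(* The derivative may vanish at [c], where the tangent gives only a weak inequality; strictness
   comes from the tangent at the midpoint. *)
move=> c0 cx Dc; pose y := (c + x) / 2.
have cy : c < y by rewrite /y; lra.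
have yx : y < x by rewrite /y; lra.
have y0 := lt_trans c0 cy; have x0 := lt_trans y0 yx.
have Dy := dfun_gt0_mono c0 cy Dc.
have r1 : 1 < y / c by rewrite ltr_pdivlMr // mul1r.
have r2 : 1 < x / y by rewrite ltr_pdivlMr // mul1r.
have := hfun_tangent y0 c0; have := hfun_tangent x0 y0.
have : 0 <= D c * (y / c - 1) by rewrite mulr_ge0 // subr_ge0 ltW.
have : 0 < D y * (x / y - 1) by rewrite mulr_gt0 // subr_gt0.
lra.
Qed.

Lemma hfun_le c x : 0 < c -> c <= x -> 0 <= D c -> h c <= h x.
Proof.
move=> c0; rewrite le_eqVlt => /orP[/eqP<- //|cx] Dc.
exact/ltW/(hfun_lt c0 cx).
Qed.

(* The relative variation of [h'(x) = D x / x], which bounds the error of a Newton step. *)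
Lemma dfun_variation (M : F) z x : m%:~R + `|l|%:~R <= M -> 0 <= D 1 ->
  1 < z -> z <= x -> D x / x * (1 - M * (x - z) / (z - 1)) <= D z / z.
Proof.
move=> MlM D1 z1 zx.
have x1 := lt_le_trans z1 zx.
have z0 : 0 < z by lra. have x0 : 0 < x by lra.
have zN0 : z != 0 by rewrite gt_eqF. have xN0 : x != 0 by rewrite gt_eqF.
have m1R : (1 : F) <= m%:~R by rewrite ler1z.
have nl0 : 0 <= `|l|%:~R :> F by rewrite ler0z.
set w := (x - z) / (z - 1).
have w0 : 0 <= w by rewrite divr_ge0 // subr_ge0 // ltW.
have -> : M * (x - z) / (z - 1) = M * w by rewrite /w; ring.
have xzw : (x - z) / x <= w.
  rewrite /w; apply: ler_wpM2l; first by rewrite subr_ge0.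
  by rewrite lef_pV2 ?posrE ?subr_gt0 //; lra.
(* Each power separately: Bernoulli at [z / x] loses a factor [1 - (k - 1) (x - z) / x], and
   [(x - z) / x <= w]. *)
have mono k : k%:~R <= M -> x ^ (k - 1) * (1 - M * w) <= z ^ (k - 1).
  move=> kM; rewrite -(expz_ratio z (k-1) x0) mulrC.
  apply: ler_wpM2r; first by rewrite ltW ?exprz_gt0.
  apply: le_trans (bernoulli (k-1) (divr_gt0 z0 x0)).
  have -> : z / x - 1 = - ((x - z) / x) by field.
  have u0 : 0 <= (x - z) / x by rewrite divr_ge0 ?subr_ge0 // ltW.
  have : (k - 1)%:~R * ((x - z) / x) <= M * w.
    have kM' : (k - 1)%:~R <= M by rewrite intrB; lra.
    have M0 : 0 <= M by lra.
    apply: le_trans (_ : M * ((x - z) / x) <= _).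
      exact: ler_wpM2r.
    exact: ler_wpM2l.
  lra.
have pw k y : y != 0 -> y ^ k / y = y ^ (k - 1).
  by move=> yN; rewrite expfzDr // exprN1.
have De y : y != 0 -> D y / y = m%:~R * A * y ^ (m - 1) + l%:~R * B * y ^ (l - 1).
  by move=> yN; rewrite -!pw // /dfun; ring.
rewrite !De //.
have mA0 : 0 <= m%:~R * A by rewrite mulr_ge0 ?ltW.
have mM : m%:~R <= M by lra.
case: (leP 0 l) => [l0|l0].
  have lM : l%:~R <= M by move: MlM; rewrite ger0_norm //; lra.
  have lB0 : 0 <= l%:~R * B by rewrite mulr_ge0 ?ler0z.
  have := ler_wpM2l mA0 (mono m mM); have := ler_wpM2l lB0 (mono l lM); lra.
(* For [l < 0] the second term [- K x ^ (l - 1)] has the wrong sign for [mono]. Since [D1] gives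
   [K <= m A], the derivative splits into [(m A - K) x ^ (m - 1)] and
   [K (x ^ (m - 1) - x ^ (l - 1))], so that only the difference of powers is left to estimate. *)
pose K := - (l%:~R * B).
have K0 : 0 <= K by rewrite /K oppr_ge0 mulr_le0_ge0 ?lerz0 // ltW.
have KA : K <= m%:~R * A.
  by move: D1; rewrite /dfun !exp1rz !mulr1 /K; lra.
have mlz y : y != 0 -> y ^ (m - 1) - y ^ (l - 1) = y ^ (l - 1) * (y ^ (m - l) - 1).
  move=> yN; have -> : m - 1 = (l - 1) + (m - l) by ring.
  by rewrite expfzDr // mulrBr mulr1.
suff dif : (x ^ (m - 1) - x ^ (l - 1)) * (1 - M * w) <= z ^ (m - 1) - z ^ (l - 1).
  have := ler_wpM2l K0 dif.
  have := ler_wpM2l (_ : 0 <= m%:~R * A - K) (mono m mM).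
  rewrite subr_ge0 => /(_ KA); rewrite /K; lra.
rewrite !mlz // -mulrA.
have NM : (m - l)%:~R <= M.
  by move: MlM; rewrite ltr0_norm // intrB mulrNz.
have N0 : 0 < m - l by rewrite subr_gt0 (lt_trans l0).
set N := m - l in N0 NM *.
have zN1 : 1 <= z ^ N by rewrite -(exp1rz _ N) ltW ?expz_ltr.
have xN1 : 1 < x ^ N by rewrite -(exp1rz _ N) expz_ltr.
have zx1 : x ^ (l - 1) <= z ^ (l - 1).
  move: zx; rewrite le_eqVlt => /orP[/eqP-> //|zx].
  by apply/ltW/expz_gtr; rewrite ?subr_lt0 ?(lt_trans l0).
have tang := tangent N z0 x0.
have xN : x ^ (N - 1) * (x - 1) <= x ^ N - 1.
  rewrite mulrBr mulr1 -pw // divfK // lerD2l lerN2.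
  have : x ^ 0 <= x ^ (N - 1).
    have : 0 <= N - 1 by rewrite subr_ge0 -gtz0_ge1.
    rewrite expr0z le_eqVlt => /orP[/eqP<-|q]; first by rewrite expr0z.
    by rewrite -(exp1rz _ (N - 1)) ltW ?expz_ltr.
  by rewrite expr0z -pw.
(* The denominator [z - 1] is needed here: [x - z <= w (x - 1)], and
   [x ^ (N - 1) (x - 1) <= x ^ N - 1]. The exponent [N = m - l] is [m + |l|], which is why [M]
   bounds that sum. *)
have key : x ^ N - z ^ N <= (x ^ N - 1) * (M * w).
  apply: le_trans (_ : N%:~R * x ^ (N - 1) * (x - z) <= _).
    have e : N%:~R * x ^ N * (z / x - 1) = - (N%:~R * x ^ (N - 1) * (x - z)).
      by rewrite -pw //; field.
    rewrite e in tang; lra.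
  apply: le_trans (_ : N%:~R * w * (x ^ (N - 1) * (x - 1)) <= _).
    have -> : N%:~R * w * (x ^ (N - 1) * (x - 1)) = N%:~R * x ^ (N - 1) * (w * (x - 1)) by ring.
    apply: ler_wpM2l.
      by rewrite mulr_ge0 ?ler0z ?ltW ?exprz_gt0.
    rewrite /w mulrAC ler_pdivlMr ?subr_gt0 //.
    by apply: ler_wpM2l; lra.
  have -> : (x ^ N - 1) * (M * w) = M * w * (x ^ N - 1) by ring.
  apply: ler_pM => //.
  - by rewrite mulr_ge0 ?ler0z // ltW.
  - by rewrite mulr_ge0 ?ltW ?exprz_gt0 // subr_gt0.
  - exact: ler_wpM2r.
apply: le_trans (_ : x ^ (l - 1) * (z ^ N - 1) <= _).
  apply: ler_wpM2l; first by rewrite ltW ?exprz_gt0.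
  lra.
apply: ler_wpM2r => //; lra.
Qed.

(** The tangent at [x] passes below [h] at [z], so a step never overshoots the root. The tangent at
    [z] gives [h x >= h'(z) (x - z)], so the new error is at most [(x - z) (1 - h'(z) / h'(x))], and
    [dfun_variation] bounds the last factor by [M (x - z) / (z - 1)]. *)
Lemma newton_step (M : F) z x : m%:~R + `|l|%:~R <= M -> 0 <= D 1 ->
  1 < z -> z <= x -> h z = 0 ->
  z <= x - x * h x / D x /\
  x - x * h x / D x - z <= M / (z - 1) * (x - z) ^+ 2.
Proof.
move=> MlM D1 z1 zx hz.
have x1 := lt_le_trans z1 zx.
have z0 : 0 < z by lra. have x0 : 0 < x by lra.
have Dx0 := dfun_gt0_mono ltr01 x1 D1.
have t1 := hfun_tangent z0 x0; have t2 := hfun_tangent x0 z0.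
rewrite hz sub0r in t1; rewrite hz subr0 in t2.
have var := dfun_variation MlM D1 z1 zx.
have xN0 : x != 0 by rewrite gt_eqF. have zN0 : z != 0 by rewrite gt_eqF.
have DN0 : D x != 0 by rewrite gt_eqF.
have z1N : z - 1 != 0 by rewrite gt_eqF ?subr_gt0.
split.
  have -> : x - x * h x / D x = z + (D x * (x - z) - x * h x) / D x by field.
  rewrite lerDl divr_ge0 ?(ltW Dx0) // subr_ge0.
  have := ler_wpM2l (ltW x0) t1.
  have -> : x * (D x * (z / x - 1)) = - (D x * (x - z)) by field.
  lra.
have -> : x - x * h x / D x - z = (D x * (x - z) - x * h x) / D x by field.
rewrite ler_pdivrMr //.
have h1 : x * (D z * (x / z - 1)) <= x * h x by exact: ler_wpM2l (ltW x0) _ _ t2.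
have e1 : x * (D z * (x / z - 1)) = x * (x - z) * (D z / z) by field.
have h2 := ler_wpM2l (_ : 0 <= x * (x - z)) var.
have {}h2 := h2 (mulr_ge0 (ltW x0) (_ : 0 <= x - z)).
rewrite subr_ge0 in h2; have {}h2 := h2 zx.
have e2 : x * (x - z) * (D x / x * (1 - M * (x - z) / (z - 1))) =
  D x * (x - z) - M / (z - 1) * (x - z) ^+ 2 * D x by field; apply/andP.
rewrite e2 in h2; rewrite e1 in h1; lra.
Qed.

End IntPowers.

(** * Roots on the increasing branch *)

Section Branches.
Variable R : realType.
Implicit Types (x y z c A B C p q : R) (m l : int) (a b n : nat).

(* The root [z] lies where [hfun A B C m l] increases. *)
Definition branch_root A B C m l z :=
  [/\ 0 < A, 0 <= B & 0 < m] /\ [/\ 0 < z, hfun A B C m l z = 0 & 0 <= dfun A B m l z].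

Lemma branch_cmp A B C m l z c : branch_root A B C m l z -> 0 < c ->
  [/\ dfun A B m l c < 0 -> c < z,
      0 <= dfun A B m l c -> hfun A B C m l c < 0 -> c < z,
      0 <= dfun A B m l c -> hfun A B C m l c = 0 -> z = c &
      0 <= dfun A B m l c -> 0 < hfun A B C m l c -> z < c].
Proof.
move=> [[A0 B0 m0] [z0 hz Dz]] c0.
have up x y := @hfun_lt _ A B C m l A0 B0 m0 x y.
have upe x y := @hfun_le _ A B C m l A0 B0 m0 x y.
split=> [Dc|Dc hc|Dc hc|Dc hc].
- rewrite ltNge; apply/negP => zc.
  by move: Dc; rewrite ltNge (dfun_ge0_mono A0 B0 m0 z0 zc Dz).
- by rewrite ltNge; apply/negP => zc; have := upe _ _ z0 zc Dz; rewrite hz leNgt hc.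
- case: (ltgtP z c) => // zc.
    by have := up _ _ z0 zc Dz; rewrite hz hc ltxx.
  by have := up _ _ c0 zc Dc; rewrite hz hc ltxx.
- by rewrite ltNge; apply/negP => cz; have := upe _ _ c0 cz Dc; rewrite hz leNgt hc.
Qed.

Lemma branch_unique A B C m l z c : branch_root A B C m l z -> 0 < c ->
  0 <= dfun A B m l c -> hfun A B C m l c = 0 -> c = z.
Proof. by move=> bz c0 Dc hc; have [_ _ /(_ Dc hc) ->] := branch_cmp bz c0. Qed.

(** Multiplication by [x ^ |l|] clears negative exponents, so the intermediate value theorem for
    polynomials applies between [c] and a point [T] with [A T^m >= A T >= |C|]. *)
Lemma branch_exists A B C m l c : 0 < A -> 0 <= B -> 0 < m -> 0 < c ->
  0 <= dfun A B m l c -> hfun A B C m l c <= 0 ->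
  exists2 z, c <= z & branch_root A B C m l z.
Proof.
move=> A0 B0 m0 c0 Dc hc.
pose k := absz l; pose mn := absz m; pose ln := absz (l + k).
have mE : (mn : int) = m by rewrite /mn gtz0_abs.
have lE : (ln : int) = l + k by rewrite /ln gez0_abs // /k; clear; lia.
pose p : {poly R} := A *: 'X^(mn + k) + B *: 'X^ln + C *: 'X^k.
have pE x : 0 < x -> p.[x] = x ^ k * hfun A B C m l x.
  move=> x0; have xN : x != 0 by rewrite gt_eqF.
  rewrite /p !hornerE exprD !exprnP mE lE expfzDr // /hfun; ring.
pose T := c + 1 + `|C| / A.
have C0 : 0 <= `|C| / A by rewrite divr_ge0 // ltW.
have T1 : 1 <= T by rewrite /T; lra.
have hT : 0 <= hfun A B C m l T.
  have T0 : 0 < T by lra.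
  have AT : `|C| <= A * T ^ m.
    apply: le_trans (_ : A * T <= _).
      have -> : A * T = A * (c + 1) + `|C| by rewrite /T; field; rewrite gt_eqF.
      by rewrite lerDr mulr_ge0 ?(ltW A0) //; lra.
    apply: ler_wpM2l; first exact: ltW.
    by rewrite -mE -exprnP; apply: ler_eXnr; rewrite // lt0n absz_eq0 gt_eqF.
  have : 0 <= B * T ^ l by rewrite mulr_ge0 // ltW // exprz_gt0.
  have := ler_norm (- C); rewrite normrN /hfun; lra.
have cT : c <= T by rewrite /T; lra.
have T0 : 0 < T by lra.
have [|z /andP[cz zT] /rootP] := @poly_ivt _ p c T cT.
  by rewrite !pE // pmulr_rle0 ?pmulr_rge0 ?exprz_gt0 // hc hT.
have z0 : 0 < z by exact: lt_le_trans cz.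
rewrite pE // => /eqP; rewrite mulf_eq0 gt_eqF ?exprz_gt0 //= => /eqP hz.
exists z => //; split=> //; split=> //.
exact: dfun_ge0_mono cz Dc.
Qed.

(** With natural exponents [h] increases on all positive reals, so every positive root lies on the
    branch. The condition on [ln] excludes a second constant term, except a zero one. *)
Lemma branch_exists_incr A B C (mn ln : nat) : 0 < A -> 0 <= B -> (0 < mn)%N ->
  (ln == 0%N -> B = 0) -> C < 0 ->
  exists z, branch_root A B C mn ln z /\
    forall x, 0 < x -> (hfun A B C mn ln x = 0 <-> x = z).
Proof.
move=> A0 B0 m0 lB C0.
have D0 x : 0 < x -> 0 <= dfun A B mn ln x.
  move=> x0; rewrite /dfun addr_ge0 // !mulr_ge0 ?ler0z ?(ltW A0) //; exact/ltW/exprz_gt0.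
(* On [(0, 1]] positive powers are at most [c], hence [A c^m + B c^l <= (A + B) c <= - C]. *)
pose c := Num.min 1 (- C / (A + B)).
have AB : 0 < A + B by lra.
have c0 : 0 < c by rewrite lt_min ltr01 divr_gt0 //; lra.
have c1 : c <= 1 by rewrite ge_min lexx.
have hc : hfun A B C mn ln c <= 0.
  have h1 : A * c ^+ mn <= A * c.
    apply: ler_wpM2l; first exact: ltW.
    by apply: ler_iXnr => //; exact: ltW.
  have h2 : B * c ^+ ln <= B * c.
    case: (eqVneq ln 0%N) => [/eqP/lB ->|ln0]; first by rewrite !mul0r.
    by apply: ler_wpM2l => //; apply: ler_iXnr => //; [rewrite lt0n|exact: ltW].
  have h3 : (A + B) * c <= - C.
    by rewrite mulrC -ler_pdivlMr // ge_min lexx orbT.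
  by rewrite /hfun -!exprnP; lra.
have [|z _ bz] := branch_exists A0 B0 _ c0 (D0 _ c0) hc; first by rewrite ltz_nat.
exists z; split=> // x x0; split=> [hx|->]; last by case: bz => _ [].
exact: branch_unique bz x0 (D0 _ x0) hx.
Qed.

(** What remains of the trinomial once its lowest power of [x] is divided out. *)
Definition g3 c0 c1 c2 a b x := c0 + c1 * x ^+ a + c2 * x ^+ b.

(** * Positive roots of a normalized trinomial, by sign pattern *)

Section Normalized.
Variables (c0 c1 c2 : R) (a b : nat).
Hypotheses (c2N : c2 != 0) (b0 : (0 < b)%N) (hab : (a <= b)%N)
  (hc1 : c1 != 0 -> (0 < a < b)%N).
Notation p := (c1 / c2).
Notation q := (c0 / c2).
Notation n := (b - a)%N.

Lemma one_root_direct : q < 0 -> 0 <= p ->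
  exists z, branch_root 1 p q b a z /\
    forall x, 0 < x -> (g3 c0 c1 c2 a b x = 0 <-> x = z).
Proof.
move=> q0 p0.
have ap : a == 0%N -> p = 0.
  move=> /eqP a0; apply/eqP; rewrite mulf_eq0; apply/orP; left.
  by apply/negPn/negP => /hc1; rewrite a0.
have [z [bz zu]] := branch_exists_incr ltr01 p0 b0 ap q0.
exists z; split=> // x x0; rewrite -zu //.
have -> : g3 c0 c1 c2 a b x = c2 * hfun 1 p q b a x.
  by rewrite /g3 /hfun -!exprnP; field.
split=> [/eqP|->]; last by rewrite mulr0.
by rewrite mulf_eq0 (negbTE c2N) => /eqP.
Qed.

(** Signs (+,-,-) in decreasing order of exponents: two coefficients are negative, but reversing the
    polynomial, that is dividing by [c0 x^b] and writing [y = 1 / x], gives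
    [y^b + (p / q) y^n + 1 / q], where only the constant term is negative. *)
Lemma one_root_inverted : q < 0 -> p < 0 ->
  exists z, branch_root 1 (p / q) (1 / q) b n z /\
    forall x, 0 < x -> (g3 c0 c1 c2 a b x = 0 <-> x = z^-1).
Proof.
move=> q0 p0.
have c1N : c1 != 0 by apply: contraTneq p0 => ->; rewrite mul0r ltxx.
have c0N : c0 != 0 by apply: contraTneq q0 => ->; rewrite mul0r ltxx.
have /andP[a0 ab] := hc1 c1N.
have pq : 0 <= p / q by rewrite mulr_le0 ?invr_le0 // ltW.
have np : n == 0%N -> p / q = 0 by rewrite subn_eq0 leqNgt ab.
have q1 : 1 / q < 0 by rewrite div1r invr_lt0.
have [z [bz zu]] := branch_exists_incr ltr01 pq b0 np q1.
exists z; split=> // x x0; have xN : x != 0 by rewrite gt_eqF.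
have x0i : 0 < x^-1 by rewrite invr_gt0.
have -> : (x = z^-1) <-> (x^-1 = z).
  by split=> [->|<-]; rewrite invrK.
rewrite -zu //.
have -> : hfun 1 (p / q) (1 / q) b n x^-1 = g3 c0 c1 c2 a b x / (c0 * x ^+ b).
  rewrite /g3 /hfun -!exprnP !exprVn.
  have -> : x ^+ b = x ^+ a * x ^+ n by rewrite -exprD subnKC.
  by field; rewrite ?expf_neq0 ?c0N ?c2N.
split=> [->|/eqP]; first by rewrite mul0r.
by rewrite mulf_eq0 invr_eq0 mulf_eq0 (negbTE c0N) expf_eq0 (negbTE xN) andbF !orbF => /eqP.
Qed.

(* [disc] has the sign of [- h1] at the critical point of [h1], whose [b]-th power is
   [a q / n]. *)
Definition disc := (a%:R * q / n%:R) ^+ a - (b%:R * q / - (n%:R * p)) ^+ b.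

Hypotheses (q0 : 0 < q) (p0 : p < 0).

Let c1N : c1 != 0. Proof. by apply: contraTneq p0 => ->; rewrite mul0r ltxx. Qed.
Let a0 : (0 < a)%N. Proof. by have /andP[] := hc1 c1N. Qed.
Let n0 : (0 < n)%N. Proof. by have /andP[_] := hc1 c1N; rewrite subn_gt0. Qed.
(** Signs (+,-,+): division by [x^a] turns the negative coefficient into the constant term, at the
    price of a negative exponent. [h2] is the same function of [1 / x]; its increasing branch
    carries the smaller root. *)
Notation h1 := (hfun 1 q p n (- (a : int))).
Notation D1 := (dfun 1 q n (- (a : int))).
Notation h2 := (hfun q 1 p a (- (n : int))).
Notation D2 := (dfun q 1 a (- (n : int))).

Lemma g3_hfun x : 0 < x -> (g3 c0 c1 c2 a b x = 0 <-> h1 x = 0).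
Proof.
move=> x0; have xN : x != 0 by rewrite gt_eqF.
have -> : h1 x = g3 c0 c1 c2 a b x / (c2 * x ^+ a).
  rewrite /g3 /hfun -exprnN -exprnP.
  have -> : x ^+ b = x ^+ a * x ^+ n by rewrite -exprD subnKC.
  by field; rewrite ?expf_neq0 ?c2N.
split=> [->|/eqP]; first by rewrite mul0r.
by rewrite mulf_eq0 invr_eq0 mulf_eq0 (negbTE c2N) expf_eq0 (negbTE xN) andbF !orbF => /eqP.
Qed.

Lemma h2V x : h2 x^-1 = h1 x.
Proof. by rewrite /hfun !exprz_inv opprK; ring. Qed.

Lemma D2V x : D2 x^-1 = - D1 x.
Proof. by rewrite /dfun !exprz_inv opprK !mulrNz; ring. Qed.

(** The critical point [xc] is a [b]-th root of [Q], which the machine cannot extract. But [h1 xc]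
    is a positive multiple of [T - xc^a], and comparing [b]-th powers replaces this by the rational
    comparison of [T^b] with [xc^(a b) = Q^a]. *)
Lemma critical_disc : exists xc, [/\ 0 < xc, D1 xc = 0, (h1 xc <= 0) = (0 <= disc)
  & (h1 xc < 0) = (0 < disc)].
Proof.
have nR : (0 : R) < n%:R by rewrite ltr0n.
have aR : (0 : R) < a%:R by rewrite ltr0n.
have bR : (0 : R) < b%:R by rewrite ltr0n.
pose Q := a%:R * q / n%:R.
have Q0 : 0 < Q by rewrite divr_gt0 // mulr_gt0.
have [||xc /andP[xc0 _] /rootP] := @poly_ivt _ ('X^b - Q%:P) 0 (1 + Q); first lra.
  rewrite !hornerE expr0n gtn_eqF // sub0r oppr_le0 (ltW Q0) /= subr_ge0.
  apply: le_trans (_ : 1 + Q <= _); first lra.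
  by apply: ler_eXnr => //; lra.
rewrite !hornerE => /eqP; rewrite subr_eq0 => /eqP xcb.
have {}xc0 : 0 < xc.
  rewrite lt_neqAle xc0 andbT; apply: contraTneq Q0 => xE.
  by rewrite -xcb -xE expr0n gtn_eqF // ltxx.
have xN : xc != 0 by rewrite gt_eqF.
have xa0 : 0 < xc ^+ a by rewrite exprn_gt0.
have xbE : xc ^+ b = xc ^+ a * xc ^+ n by rewrite -exprD subnKC.
pose T := b%:R * q / - (n%:R * p).
have np0 : n%:R * p < 0 by rewrite pmulr_rlt0.
have T0 : 0 < T by rewrite divr_gt0 ?oppr_gt0 // mulr_gt0.
have hxc : h1 xc = - p / xc ^+ a * (T - xc ^+ a).
  have -> : h1 xc = (xc ^+ b + q + p * xc ^+ a) / xc ^+ a.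
    rewrite /hfun -exprnN -exprnP xbE; field; rewrite ?expf_neq0 ?c2N //.
  rewrite xcb /Q /T.
  have -> : b%:R = a%:R + n%:R :> R by rewrite -natrD subnKC.
  have pN : c1 != 0 := c1N.
  field; rewrite ?expf_neq0 ?c2N ?pN ?gt_eqF //.
have sc : 0 < - p / xc ^+ a by rewrite divr_gt0 // oppr_gt0.
have dE : disc = (xc ^+ a) ^+ b - T ^+ b by rewrite /disc -/Q -/T -xcb -!exprM mulnC.
exists xc; split=> //.
- rewrite /dfun -exprnN -exprnP.
  have -> : xc ^+ n = Q / xc ^+ a by rewrite -xcb xbE; field; rewrite expf_neq0.
  rewrite mulrNz /Q; field; rewrite ?expf_neq0 ?c2N ?gt_eqF //.
- rewrite hxc pmulr_rle0 // subr_le0 dE subr_ge0.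
  by rewrite ler_pXn2r // nnegrE ltW.
- rewrite hxc pmulr_rlt0 // subr_lt0 dE subr_gt0.
  by rewrite ltr_pXn2r // nnegrE ltW.
Qed.

Lemma no_root_disc : disc < 0 -> forall x, 0 < x -> g3 c0 c1 c2 a b x != 0.
Proof.
move=> d0 x x0; apply/eqP => /(g3_hfun x0) hx.
have [xc [xc0 Dxc hle _]] := critical_disc.
have := hfun_tangent p n (- (a : int)) ltr01 (ltW q0) x0 xc0.
by rewrite Dxc mul0r subr_ge0 hx hle leNgt d0.
Qed.

(** One root lies on each side of [xc]: the larger on the increasing branch of [h1], the smaller,
    after inversion, on that of [h2]. They coincide exactly when [xc] itself is a root. *)
Lemma two_roots_disc : 0 <= disc -> exists z1 z2,
  [/\ branch_root 1 q p n (- (a : int)) z1, branch_root q 1 p a (- (n : int)) z2,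
   forall x, 0 < x -> (g3 c0 c1 c2 a b x = 0 <-> x = z1 \/ x = z2^-1)
   & (z1 == z2^-1) = (disc == 0)].
Proof.
move=> d0; have [xc [xc0 Dxc hle hlt]] := critical_disc.
have hxc : h1 xc <= 0 by rewrite hle.
have xci : 0 < xc^-1 by rewrite invr_gt0.
have D10 : 0 <= D1 xc by rewrite Dxc.
have D20 : 0 <= D2 xc^-1 by rewrite D2V Dxc oppr0.
have h20 : h2 xc^-1 <= 0 by rewrite h2V.
have [z1 z1c b1] := branch_exists ltr01 (ltW q0) (n0 : 0 < (n : int)) xc0 D10 hxc.
have [z2 z2c b2] := branch_exists q0 ler01 (a0 : 0 < (a : int)) xci D20 h20.
have [_ [z10 hz1 Dz1]] := b1; have [_ [z20 hz2 Dz2]] := b2.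
have z2i0 : 0 < z2^-1 by rewrite invr_gt0.
have z2i : z2^-1 <= xc by rewrite -[xc]invrK lef_pV2.
exists z1, z2; split=> //.
- move=> x x0; rewrite g3_hfun //; split=> [hx|[->|->]] //.
    case: (leP 0 (D1 x)) => Dx.
      by left; exact: branch_unique b1 x0 Dx hx.
    right; rewrite -[x]invrK; congr _^-1.
    apply: branch_unique b2 _ _ _; first by rewrite invr_gt0.
      by rewrite D2V oppr_ge0 ltW.
    by rewrite h2V.
  by rewrite -h2V invrK.
- apply/eqP/eqP => [zz|dz].
    have xz : xc = z1 by apply/eqP; rewrite eq_le z1c zz z2i.
    by apply/eqP; rewrite eq_le d0 andbT leNgt -hlt xz hz1 ltxx.
  have hxc0 : h1 xc = 0.
    by apply/eqP; rewrite eq_le hxc leNgt hlt dz ltxx.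
  rewrite -(branch_unique b1 xc0 D10 hxc0) -(branch_unique b2 xci D20) ?invrK //.
  by rewrite h2V.
Qed.

End Normalized.
End Branches.

(** * Powers *)

Notation rPx := 80%N (only parsing).
Notation rPn := 81%N (only parsing).
Notation rPo := 82%N (only parsing).
Notation rPp := 83%N (only parsing).

(** The exponent is a real number in a register and its binary digits are not directly accessible.
    The first loop doubles up to a power of two above it; the second halves that power again and
    reads off the digits by comparison, leading digit first. *)
Definition pow_loop1 : cmd := (While (rPp - rPn - N 1) (rPp ::= rPp + rPp))%C.
Definition pow_loop2 : cmd :=
  (While (N 1 - rPp)
    (rPp ::= rPp / N 2;; rPo ::= rPo * rPo;;
     If (rPn - rPp) (rPo ::= rPo * rPx;; rPn ::= rPn - rPp) Skip))%C.
Definition pow_cmd : cmd :=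
  (If rPn Skip (rPx ::= N 1 / rPx;; rPn ::= N 0 - rPn);;
   rPp ::= N 1;; pow_loop1;; rPo ::= N 1;; pow_loop2)%C.

Section Pow.
Variable R : realType.
Implicit Types (s : mstate R).

Lemma ltr_natP2 (n i : nat) : (2%:R ^+ i < n%:R + 1 :> R) = (2 ^ i <= n)%N.
Proof. by rewrite -natrX natr1 ltr_nat ltnS. Qed.

Lemma wp_pow_loop1 s n l : s rPn = n%:R -> s rPp = 1 -> (n < 2 ^ l)%N ->
  wp pow_loop1 s (fun t s' => (t <= l.+1 * 18)%N /\
    exists2 i, (i <= l)%N & s' rPp = 2%:R ^+ i /\ (n < 2 ^ i)%N).
Proof.
move=> hn hp nl.
pose Inv k s' := exists2 i, (i + k = l)%N & s' rPp = 2%:R ^+ i :> R.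
apply: wp_conseq; first apply: (@wp_while _ Inv 7 _ _ s l).
- by exists 0%N => //; rewrite hp expr0.
- by [].
- move=> j s' [i il si] fr /=; rewrite (fr rPn isT) hn si => lt0.
  have ni : (2 ^ i <= n)%N by rewrite -ltr_natP2; lra.
  have {}ni : (i < l)%N by rewrite -(ltn_exp2l i l (isT : 1 < 2)%N); exact: leq_ltn_trans nl.
  exists (l - i.+1)%N; first lia.
  apply: wp_asg => //=; split=> //; exists i.+1; first lia.
  by rewrite /upd /= si exprS; ring.
- move=> t s' fr [tl [/= ge0 [j [i il si]]]]; split; first by move: tl => /=; lia.
  exists i; first lia.
  split=> //; rewrite ltnNge -ltr_natP2 -leNgt.
  by move: ge0; rewrite (fr rPn isT) hn si; lra.
Qed.

Lemma wp_pow_loop2 s n i l x : s rPn = n%:R -> s rPp = 2%:R ^+ i -> s rPx = x -> s rPo = 1 ->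
  (n < 2 ^ i)%N -> (i <= l)%N ->
  wp pow_loop2 s (fun t s' => (t <= l.+1 * 64)%N /\ s' rPo = x ^+ n).
Proof.
move=> hn hp hx ho ni il.
(* [e] is the number formed by the digits already read, and [n1] is the rest. *)
pose Inv k s' := s' rPp = 2%:R ^+ k :> R /\
  exists n1 e, [/\ s' rPn = n1%:R :> R, (n1 < 2 ^ k)%N, s' rPo = x ^+ e & (e * 2 ^ k + n1 = n)%N].
apply: wp_conseq; first apply: (@wp_while _ Inv 45 _ _ s i).
- by split=> //; exists n, 0%N; split=> //; rewrite ho expr0.
- by [].
- move=> [|j] s' [hp' [n1 [e [hn1 n1k ho' en]]]] fr /=.
    by rewrite hp' expr0 subrr ltxx.
  move=> _; exists j => //.
  have hx' : s' rPx = x by rewrite fr.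
  have p2 : 2%:R ^+ j.+1 / 2%:R = 2%:R ^+ j :> R by rewrite exprS; field.
  apply/wp_seq/wp_asg => /=; first by split=> //; rewrite pnatr_eq0.
  apply/wp_seq/wp_asg => //=; rewrite /upd /= hp' p2.
  apply: wp_if => //=; rewrite /upd /= hn1 -natrX.
    rewrite subr_ge0 ler_nat => jn.
    apply/wp_seq/wp_asg => //=; apply/wp_asg => //=; split=> //.
    rewrite /Inv /upd /= hn1 hx' ho' -natrX -natrB //; split=> //.
    exists (n1 - 2 ^ j)%N, (e + e + 1)%N; split=> //.
    - by move: n1k; rewrite expnS; lia.
    - by rewrite !exprD expr1.
    - by move: en; rewrite expnS; nia.
  rewrite subr_lt0 ltr_nat => jn.
  apply/wp_skip; split=> //.
  rewrite /Inv /upd /= hn1 ho' -natrX; split=> //.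
  exists n1, (e + e)%N; split=> //; first by rewrite exprD.
  by move: en; rewrite expnS; nia.
- move=> t s' fr [tl [/= ge0 [j [hp' [n1 [e [hn1 n1k ho' en]]]]]]].
  split; first by move: tl => /=; nia.
  have j0 : j = 0%N.
    move: ge0; rewrite hp' subr_ge0 -natrX ler_nat => h; apply/eqP.
    by rewrite -leqn0 -(leq_exp2l j 0 (isT : 1 < 2)%N).
  move: en n1k; rewrite ho' j0 expn0 muln1 ltnS leqn0 => en /eqP n10.
  by rewrite -en n10 addn0.
Qed.

Lemma wp_pow s x (k : int) l : s rPx = x -> s rPn = k%:~R -> (absz k < 2 ^ l)%N ->
  (k < 0 -> x != 0) ->
  wp pow_cmd s (fun t s' => (t <= l.+1 * 120)%N /\ s' rPo = x ^ k).
Proof.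
move=> hx hn kl kx; apply/wp_seq.
pose y := if 0 <= k then x else x^-1.
have yk : x ^ k = y ^+ absz k.
  by rewrite /y; case: (k) => // n; rewrite NegzE /= exprVn.
apply: (@wp_conseq _ _ _ (fun t s' => (t <= 20)%N /\ s' rPx = y /\ s' rPn = (absz k)%:R)).
  apply: wp_if => //=; rewrite hn => k0.
    apply: wp_skip; split=> //; rewrite hx hn /y.
    move: k0; rewrite ler0z => k0; rewrite k0; split=> //.
    by case: k k0 {y yk hn kl kx}.
  move: k0; rewrite ltrz0 => k0.
  apply/wp_seq/wp_asg => /=; first by split=> //; rewrite hx kx.
  apply/wp_asg => //=; rewrite /upd /= hx hn; split=> //.
  rewrite /y leNgt k0 /= mul1r; split=> //.
  by case: (k) k0 => // n _; rewrite NegzE mulrNz sub0r opprK.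
move=> t1 s1 fr1 [t1l [hx1 hn1]].
apply/wp_seq/wp_asg => //=; apply/wp_seq.
apply: (wp_conseq (wp_pow_loop1 (n := absz k) (l := l) _ _ kl)) => //.
move=> t2 s2 fr2 [t2l [i il [hp2 ki]]].
apply/wp_seq/wp_asg => //=.
apply: (wp_conseq (wp_pow_loop2 (n := absz k) (i := i) (l := l) (x := y) _ _ _ _ ki il)).
- by rewrite /upd /= fr2 // /upd /= hn1.
- by rewrite /upd /=.
- by rewrite /upd /= fr2 // /upd /= hx1.
- by rewrite /upd /=.
move=> t3 s3 fr3 [t3l ho3]; split; last by rewrite ho3 yk.
move: t1l t2l t3l; lia.
Qed.

End Pow.

(** * Search followed by Newton iteration *)

Notation rP := 70%N (only parsing).
Notation rQ := 71%N (only parsing).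
Notation rh := 72%N (only parsing).
Notation rD := 73%N (only parsing).
Notation rX := 75%N (only parsing).
Notation rA := 60%N (only parsing).
Notation rB := 61%N (only parsing).
Notation rC := 62%N (only parsing).
Notation rm := 63%N (only parsing).
Notation rl := 64%N (only parsing).
Notation rH := 16%N (only parsing).
Notation rM := 17%N (only parsing).
Notation rb := 66%N (only parsing).
Notation rp := 67%N (only parsing).
Notation rq := 68%N (only parsing).
Notation ry := 69%N (only parsing).
Notation rT := 74%N (only parsing).

Definition eval_cmd : cmd :=
  (rPx ::= rX;; rPn ::= rm;; pow_cmd;; rP ::= rPo;;
   rPx ::= rX;; rPn ::= rl;; pow_cmd;; rQ ::= rPo;;
   rh ::= rA * rP + rB * rQ + rC;;
   rD ::= rm * rA * rP + rl * rB * rQ)%C.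

(** The grid starts at offset [1 / H]; a ratio of at least [H^2] therefore carries it past [H]. *)
Definition fib_up : cmd :=
  (While (rq - rH * rH) (rT ::= rp * rq;; rp ::= rq;; rq ::= rT))%C.
(** Invariant: [h] is negative at [1 + y] and non-negative at [1 + y q], with [p = b^F_i] and
    [q = b^F_(i+1)]. If the value at [1 + y p] is non-negative, the ratio shrinks to [p]; otherwise
    [y] moves to [y p] and the remaining ratio is [q / p = b^F_(i-1)]. Either way it is again a
    Fibonacci power. *)
Definition fib_down : cmd :=
  (While (rb - rq)
    (rX ::= N 1 + ry * rp;; eval_cmd;;
     If rh (rT ::= rq / rp;; rq ::= rp;; rp ::= rT)
           (ry ::= ry * rp;; rT ::= rq / rp;; rp ::= rp / rT;; rq ::= rT)))%C.
(** [rT] certifies the error without knowledge of the root: at every stage the error is at most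
    [(z - 1) / (M T)]. *)
Definition newton : cmd :=
  (While (rT - rH) (eval_cmd;; rX ::= rX - rX * rh / rD;; rT ::= rT * rT))%C.

Definition core_cmd : cmd :=
  (rb ::= N 1 + N 1 / (N 2 * rM);; ry ::= N 1 / rH;; rX ::= N 1 + ry;; eval_cmd;;
   If rh Skip
    (rp ::= N 1;; rq ::= rb;; fib_up;; fib_down;;
     rX ::= N 1 + ry * rb;; rT ::= N 2;; newton))%C.

Fixpoint fib (n : nat) : nat :=
  if n is n1.+1 then (if n1 is n2.+1 then fib n1 + fib n2 else 1)%N else 0%N.
Arguments fib : simpl never.

Lemma fibSS n : fib n.+2 = (fib n.+1 + fib n)%N.
Proof. by []. Qed.

Lemma fib_gt0 n : (0 < fib n.+1)%N.
Proof. by elim: n => // n IH; rewrite fibSS addn_gt0 IH. Qed.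

Lemma fib_exp k : (2 ^ k <= fib (2 * k).+1)%N.
Proof.
elim: k => // k IH; have -> : (2 * k.+1 = (2 * k).+2)%N by lia.
rewrite expnS fibSS; have := fibSS (2 * k); lia.
Qed.

Section Core.
Variable R : realType.
Implicit Types (s : mstate R).

Lemma wp_pow_seq s (c : cmd) (Q : nat -> mstate R -> Prop) x (k : int) l :
  s rPx = x -> s rPn = k%:~R -> (absz k < 2 ^ l)%N -> (k < 0 -> x != 0) ->
  (forall t s', (forall i, i \notin mods pow_cmd -> s' i = s i) ->
     (t <= l.+1 * 120)%N -> s' rPo = x ^ k ->
     wp c s' (fun t2 s2 => Q (t + t2)%N s2)) ->
  wp (Seq pow_cmd c) s Q.
Proof.
move=> h1 h2 h3 h4 H; apply: wp_seq.
apply: wp_conseq (wp_pow h1 h2 h3 h4) _ => t s' fr [tl ho].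
exact: H fr tl ho.
Qed.

Variables (A B C : R) (m l : int) (L : nat).
Hypotheses (mL : (absz m < 2 ^ L)%N) (lL : (absz l < 2 ^ L)%N).
Notation h := (hfun A B C m l).
Notation D := (dfun A B m l).

Definition has_fun s :=
  [/\ s rA = A, s rB = B, s rC = C, s rm = m%:~R & s rl = l%:~R].

Lemma wp_eval s x : has_fun s -> s rX = x -> x != 0 ->
  wp eval_cmd s (fun t s' => [/\ (t <= L.+1 * 300)%N, s' rh = h x & s' rD = D x]).
Proof.
move=> [hA hB hC hm hl] hx x0.
apply/wp_seq/wp_asg => //=; apply/wp_seq/wp_asg => //=.
apply: (@wp_pow_seq _ _ _ x m L) => // t1 s1 fr1 t1l ho1.
have f1 k : k \notin mods pow_cmd -> (k != rPx) && (k != rPn) -> s1 k = s k.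
  by move=> k1 /andP[k2 k3]; rewrite fr1 // /upd (negbTE k2) (negbTE k3).
apply/wp_seq/wp_asg => //=; apply/wp_seq/wp_asg => //=; apply/wp_seq/wp_asg => //=.
apply: (@wp_pow_seq _ _ _ x l L) => // [||t2 s2 fr2 t2l ho2].
- by rewrite /upd /= f1.
- by rewrite /upd /= f1.
have f2 k : k \notin mods pow_cmd -> [&& k != rPx, k != rPn & k != rP] -> s2 k = s k.
  move=> k1 /and3P[k2 k3 k4].
  by rewrite fr2 // /upd (negbTE k2) (negbTE k3) (negbTE k4) f1 // k2.
apply/wp_seq/wp_asg => //=; apply/wp_seq/wp_asg => //=; apply/wp_asg => //=.
have hP : s2 rP = x ^ m by rewrite fr2 // /upd /= ho1.
rewrite /upd /= hP ho2 !f2 // hA hB hC hm hl; split=> //.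
by move: t1l t2l; lia.
Qed.

Lemma wp_eval_seq s x c Q : has_fun s -> s rX = x -> x != 0 ->
  (forall t s', (forall i, i \notin mods eval_cmd -> s' i = s i) ->
     (t <= L.+1 * 300)%N -> s' rh = h x -> s' rD = D x ->
     wp c s' (fun t2 s2 => Q (t + t2)%N s2)) ->
  wp (Seq eval_cmd c) s Q.
Proof.
move=> hf hx x0 H; apply: wp_seq.
apply: wp_conseq (wp_eval hf hx x0) _ => t s' fr [tl hh hD].
exact: H fr tl hh hD.
Qed.

Lemma has_fun_frame s s' : s' rA = s rA -> s' rB = s rB -> s' rC = s rC ->
  s' rm = s rm -> s' rl = s rl -> has_fun s -> has_fun s'.
Proof. by rewrite /has_fun => -> -> -> -> ->. Qed.

Lemma wp_fib_up s b H J : 1 < b -> s rb = b -> s rp = 1 -> s rq = b -> s rH = H ->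
  H * H <= b ^+ fib J.+1 ->
  wp fib_up s (fun t s' => (t <= J.+1 * 30)%N /\ H * H <= s' rq /\
    exists2 i, (i <= J)%N & s' rp = b ^+ fib i /\ s' rq = b ^+ fib i.+1).
Proof.
move=> b1 hb hp hq hH HJ.
pose Inv k s' := exists2 i, (i + k = J)%N &
  s' rp = b ^+ fib i /\ s' rq = b ^+ fib i.+1.
apply: wp_conseq; first apply: (@wp_while _ Inv 15 _ _ s J).
- by exists 0%N => //; rewrite hp hq.
- by [].
- move=> k s' [i ik [hp' hq']] fr /=; rewrite (fr rH isT) hH hq' subr_lt0 => lt0.
  case: k ik => [|k] ik.
    by move: lt0; rewrite -[i]addn0 ik ltNge HJ.
  exists k => //; apply/wp_seq/wp_asg => //=; apply/wp_seq/wp_asg => //=; apply/wp_asg => //=.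
  rewrite /upd /=; split=> //; exists i.+1; first by rewrite -ik addnS.
  by split=> //; rewrite /= hp' hq' -exprD addnC.
- move=> t s' fr [tl [/= ge0 [k [i ik [hp' hq']]]]]; split; first by move: tl; clear; rewrite /=; lia.
  split; first by move: ge0; rewrite (fr rH isT) hH subr_ge0.
  by exists i => //; rewrite -ik leq_addr.
Qed.

Hypotheses (A0 : 0 < A) (B0 : 0 <= B) (m0 : 0 < m) (D1 : 0 <= D 1).

Lemma wp_fib_down s b y J i : has_fun s -> 1 < b -> s rb = b -> s ry = y -> 0 < y ->
  (i <= J)%N -> s rp = b ^+ fib i -> s rq = b ^+ fib i.+1 ->
  h (1 + y) < 0 -> 0 <= h (1 + y * b ^+ fib i.+1) ->
  wp fib_down s (fun t s' => (t <= J.+1 * (L.+1 * 400))%N /\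
    [/\ 0 < s' ry, h (1 + s' ry) < 0 & 0 <= h (1 + s' ry * b)]).
Proof.
move=> hf b1 hb hy y0 iJ hp hq hy1 hyq.
have bn n : 1 <= b ^+ n by rewrite exprn_ege1 // ltW.
have b0 n : 0 < b ^+ n by exact: lt_le_trans (bn n).
pose Inv k s' := [/\ 0 < s' ry, h (1 + s' ry) < 0 &
  exists i, [/\ (i <= k)%N, s' rp = b ^+ fib i, s' rq = b ^+ fib i.+1
    & 0 <= h (1 + s' ry * b ^+ fib i.+1)]].
apply: wp_conseq; first apply: (@wp_while _ Inv (L.+1 * 300 + 60) _ _ s J).
- by rewrite /Inv hy; split=> //; exists i.
- by [].
- move=> k s' [y0' hy' [j [jk hp' hq' hyq']]] fr /=.
  rewrite (fr rb isT) hb hq' subr_lt0 => lt0.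
  (* Since [fib 1 = fib 2 = 1], these two indices give [q = b], where the loop has already stopped.
     An index of at least 2 leaves room for a drop by two. *)
  case: j jk hp' hq' hyq' lt0 => [|[|j]] jk hp' hq' hyq' lt0.
  + by move: lt0; rewrite (_ : b ^+ _ = b) ?ltxx.
  + by move: lt0; rewrite (_ : b ^+ _ = b) ?ltxx.
  case: k jk => // k jk; exists k => //.
  have e1 : b ^+ fib j.+3 / b ^+ fib j.+2 = b ^+ fib j.+1.
    by rewrite fibSS exprD mulrC mulKf // gt_eqF.
  have e2 : b ^+ fib j.+2 / b ^+ fib j.+1 = b ^+ fib j.
    by rewrite fibSS exprD mulrC mulKf // gt_eqF.
  apply/wp_seq/wp_asg => //=; rewrite hp'.
  apply: (@wp_eval_seq _ (1 + s' ry * b ^+ fib j.+2)) => //.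
  + by apply: has_fun_frame hf; rewrite /upd /= fr.
  + by rewrite gt_eqF // ltr_wpDr // mulr_ge0 ?ltW.
  move=> t1 s1 fr1 t1l hh1 hD1.
  have hy1' : s1 ry = s' ry by rewrite fr1.
  have hp1 : s1 rp = b ^+ fib j.+2 by rewrite fr1 // /upd /= hp'.
  have hq1 : s1 rq = b ^+ fib j.+3 by rewrite fr1 // /upd /= hq'.
  apply: wp_if => //=; rewrite hh1 => sgn.
    apply/wp_seq/wp_asg => /=; first by split=> //; rewrite hp1 gt_eqF.
    apply/wp_seq/wp_asg => //=; apply: wp_asg; [by []|split]; first by move: t1l; clear; rewrite /=; lia.
    rewrite /Inv /upd /= hy1' hp1 hq1 e1; split=> //.
    by exists j.+1; split=> //; rewrite ltnS in jk.
  apply/wp_seq/wp_asg => //=.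
  apply/wp_seq/wp_asg => /=; first by split=> //; rewrite /upd /= hp1 gt_eqF.
  apply/wp_seq/wp_asg => /=.
    by split=> //; rewrite /upd /= hp1 hq1 e1 gt_eqF.
  apply: wp_asg; [by []|split]; first by move: t1l; clear; rewrite /=; lia.
  rewrite /Inv /upd /= hy1' hp1 hq1 e1 e2; split; [by rewrite mulr_gt0|exact: sgn|].
  exists j; split; [by rewrite ltnS in jk; exact: ltnW|by []|by []|].
  by rewrite -mulrA -exprD -fibSS.
- move=> t s' fr [tl [/= ge0 [k [y0' hy' [j [jk hp' hq' hyq']]]]]].
  split; first by apply: (leq_trans tl); apply: leq_mul; rewrite /=; clear; lia.
  move: ge0; rewrite (fr rb isT) hb subr_ge0 hq' => ge0.
  split=> //; suff -> : b = b ^+ fib j.+1 by [].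
  apply/eqP; rewrite eq_le ge0 andbT -[X in X <= _]expr1.
  by rewrite ler_eXn2l // fib_gt0.
Qed.

Variables (M H z : R) (kap : nat).
Hypotheses (MlM : m%:~R + `|l|%:~R <= M) (z1 : 1 < z) (zH : z <= H) (hz : h z = 0).
Hypothesis Hk : H <= 2%:R ^+ (2 ^ kap).

Lemma M_ge1 : 1 <= M.
Proof.
have h1 : (1 : R) <= m%:~R by rewrite ler1z.
have h2 : 0 <= `|l|%:~R :> R by rewrite ler0z.
by apply: le_trans MlM; rewrite -[X in X <= _]addr0 lerD.
Qed.

(** Measured in units of [(z - 1) / M], the error is squared by each step, so [T] is squared. *)
Lemma newton_error T x : 0 < T -> z <= x -> x - z <= (z - 1) / (M * T) ->
  z <= x - x * h x / D x /\ x - x * h x / D x - z <= (z - 1) / (M * (T * T)).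
Proof.
move=> T0 zx xe; have M0 : 0 < M by exact: lt_le_trans M_ge1.
have [n1 n2] := newton_step A0 B0 m0 MlM D1 z1 zx hz.
split=> //; apply: le_trans n2 _.
have -> : (z - 1) / (M * (T * T)) = M / (z - 1) * ((z - 1) / (M * T)) ^+ 2.
  by field; rewrite !gt_eqF // subr_gt0.
apply: ler_wpM2l; first by rewrite divr_ge0 ?subr_ge0 // ltW.
by rewrite ler_pXn2r // ?nnegrE ?subr_ge0 // (le_trans _ xe) // subr_ge0.
Qed.

Lemma wp_newton s x : has_fun s -> s rX = x -> s rT = 2 -> s rH = H -> z <= x ->
  x - z <= (z - 1) / (M * 2) ->
  wp newton s (fun t s' => (t <= kap.+1 * (L.+1 * 400))%N /\
    z <= s' rX <= z * (1 + H^-1)).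
Proof.
move=> hf hx hT hH zx xe; have z1' := z1; have zH' := zH.
have H0 : 0 < H by lra.
have z0 : 0 < z by lra.
have M0 : 0 < M by exact: lt_le_trans M_ge1.
have p0 n : 0 < 2%:R ^+ n :> R by rewrite exprn_gt0.
pose Inv k s' := exists j, [/\ (j + k = kap)%N, s' rT = 2%:R ^+ (2 ^ j), z <= s' rX &
  s' rX - z <= (z - 1) / (M * 2%:R ^+ (2 ^ j))].
apply: wp_conseq; first apply: (@wp_while _ Inv (L.+1 * 300 + 60) _ _ s kap).
- by exists 0%N; rewrite hx.
- by [].
- move=> k s' [j [jk hT' zx' xe']] fr /=.
  rewrite (fr rH isT) hH hT' subr_lt0 => lt0.
  case: k jk => [|k] jk.
    by move: lt0; rewrite -[j]addn0 jk ltNge Hk.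
  exists k => //.
  have x0 : 0 < s' rX by lra.
  apply: (@wp_eval_seq _ (s' rX)) => //.
  + by apply: has_fun_frame hf; rewrite fr.
  + by rewrite gt_eqF.
  move=> t1 s1 fr1 t1l hh1 hD1.
  have hx1 : s1 rX = s' rX by rewrite fr1.
  have hT1 : s1 rT = 2%:R ^+ (2 ^ j) by rewrite fr1 // hT'.
  have x1 : 1 < s' rX by lra.
  have Dx0 := dfun_gt0_mono A0 B0 m0 ltr01 x1 D1.
  apply/wp_seq/wp_asg => /=; first by split=> //; rewrite hD1 gt_eqF.
  apply: wp_asg; [by []|split]; first by move: t1l; clear; rewrite /=; lia.
  have [n1 n2] := newton_error (p0 _) zx' xe'.
  exists j.+1; rewrite /upd /= hx1 hh1 hD1 hT1 expnS mul2n -addnn exprD; split=> //.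
  by rewrite -jk addnS.
- move=> t s' fr [tl [/= ge0 [k [j [jk hT' zx' xe']]]]].
  split; first by apply: (leq_trans tl); apply: leq_mul; rewrite /=; clear; lia.
  move: ge0; rewrite (fr rH isT) hH hT' subr_ge0 => HT.
  rewrite zx' /=; rewrite mulrDr mulr1 -lerBlDl; apply: le_trans xe' _.
  apply: ler_pM => //; first by lra.
  + by rewrite invr_ge0 mulr_ge0 // ltW.
  + lra.
  rewrite lef_pV2 ?posrE ?mulr_gt0 //.
  apply: le_trans HT _; rewrite -[X in X <= _]mul1r.
  by apply: ler_wpM2r; [exact/ltW/p0|exact: M_ge1].
Qed.

Hypothesis ML : M <= 2%:R ^+ L.+1.
Let b := 1 + 1 / (2 * M).

(** Bernoulli gives [b ^ (2 ^ (L + 2)) >= 2], as [2 ^ (L + 2) >= 2 M]; raising this to the power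
    [2 ^ (kap + 1)] exceeds [H^2]. Fibonacci numbers grow exponentially, so an index linear in
    [L + kap] suffices: this is the source of the factor log(D log H). *)
Lemma fib_bound : 1 <= H -> H * H <= b ^+ fib (2 * (L + kap + 3)).+1.
Proof.
move=> H1; have M1 := M_ge1; have M0 : 0 < M by lra.
have b1 : 1 < b by rewrite /b ltrDl divr_gt0 // mulr_gt0.
apply: le_trans (_ : b ^+ (2 ^ (L + kap + 3)) <= _); last first.
  by rewrite ler_eXn2l // fib_exp.
have -> : (2 ^ (L + kap + 3) = 2 ^ L.+2 * 2 ^ kap.+1)%N by rewrite -expnD; congr expn; clear; lia.
have b2 : 2 <= b ^+ (2 ^ L.+2).
  apply: le_trans (bernoulli_nat (2 ^ L.+2) (_ : 0 <= b)); last lra.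
  have -> : b - 1 = (2 * M)^-1 by rewrite /b; ring.
  rewrite -[2 in X in X <= _]/(1 + 1) lerD2l ler_pdivlMr ?mulr_gt0 // mul1r.
  by rewrite natrX exprS; apply: ler_wpM2l.
rewrite exprM; apply: le_trans (_ : 2 ^+ (2 ^ kap.+1) <= _).
  rewrite expnS mul2n -addnn exprD; apply: ler_pM => //; lra.
by apply: lerXn2r; rewrite ?nnegrE ?exprn_ge0 //; lra.
Qed.

Lemma wp_core s : has_fun s -> s rH = H -> s rM = M ->
  wp core_cmd s (fun t s' => (t <= L.+1 * (L + kap).+1 * 4900)%N /\
    z <= s' rX <= z * (1 + H^-1)).
Proof.
move=> hf hH hM; have z1' := z1; have zH' := zH.
have M1 := M_ge1; have M0 : 0 < M by lra.
have z0 : 0 < z by lra. have H0 : 0 < H by lra. have H1 : 1 < H by lra.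
set W := (L.+1 * (L + kap).+1)%N.
have W1 : (L.+1 <= W)%N by rewrite leq_pmulr.
have W2 : ((L + kap).+1 <= W)%N by rewrite leq_pmull.
have WE : ((L + kap).+1 * L.+1 = W)%N by rewrite mulnC.
clearbody W.
have Hi0 : 0 < H^-1 by rewrite invr_gt0.
have b1 : 1 < b by rewrite /b ltrDl divr_gt0 // mulr_gt0.
have Dz : 0 <= D z by apply: (dfun_ge0_mono A0 B0 m0 ltr01 _ D1); lra.
have zle y : 0 <= y -> 0 <= h (1 + y) -> z <= 1 + y.
  move=> y0 hy; rewrite leNgt; apply/negP => yz.
  have Dy : 0 <= D (1 + y) by apply: (dfun_ge0_mono A0 B0 m0 ltr01 _ D1); lra.
  have := hfun_lt C A0 B0 m0 (_ : 0 < 1 + y) yz Dy; rewrite hz => hlt; have := hlt (_ : 0 < 1 + y); lra.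
have ylt y : 0 <= y -> h (1 + y) < 0 -> 1 + y < z.
  move=> y0 hy; rewrite ltNge; apply/negP => zy.
  have := hfun_le C A0 B0 m0 z0 zy Dz; rewrite hz; lra.
apply/wp_seq/wp_asg => /=.
  by split=> //; rewrite hM mulf_neq0 // gt_eqF.
apply/wp_seq/wp_asg => /=.
  by split=> //; rewrite /upd /= hH gt_eqF.
apply/wp_seq/wp_asg => //=.
apply: (@wp_eval_seq _ (1 + H^-1)).
- by apply: has_fun_frame hf.
- by rewrite /upd /= hH; congr (_ + _); rewrite mul1r.
- by rewrite gt_eqF // addr_gt0.
move=> t1 s1 fr1 t1l hh1 hD1.
have hf1 : has_fun s1 by apply: has_fun_frame hf; rewrite fr1.
have hb1 : s1 rb = b by rewrite fr1 // /upd /= hM.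
have hy1 : s1 ry = H^-1 by rewrite fr1 // /upd /= hH mul1r.
have hX1 : s1 rX = 1 + H^-1 by rewrite fr1 // /upd /= hH mul1r.
have hH1 : s1 rH = H by rewrite fr1.
apply: wp_if => //=; rewrite hh1 => sgn.
  apply: wp_skip; rewrite hX1; split; first by move: t1l W1; clear; rewrite /=; lia.
  rewrite zle ?(ltW Hi0) //= -[X in X <= _]mul1r.
  by apply: ler_wpM2r; lra.
apply/wp_seq/wp_asg => //=; apply/wp_seq/wp_asg => //=; apply/wp_seq.
apply: wp_conseq.
  apply: (@wp_fib_up _ b H (2 * (L + kap + 3)) b1); rewrite /upd /= ?hb1 ?hH1 //.
  exact/fib_bound/ltW.
move=> t2 s2 fr2 [t2l [Hq [i iJ [hp2 hq2]]]].
have f2 k : k \notin mods fib_up -> s2 k = s1 k.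
  by move=> km; rewrite fr2 // /upd; case: eqP => [k68|_];
    [rewrite k68 in km|case: eqP => // k67; rewrite k67 in km].
apply/wp_seq; apply: wp_conseq.
  apply: (@wp_fib_down _ b H^-1 (2 * (L + kap + 3)) i) => //.
  - by apply: has_fun_frame hf1; rewrite f2.
  - by rewrite f2.
  - by rewrite f2.
  rewrite -hq2 -hz; apply: (hfun_le C A0 B0 m0 z0 _ Dz).
  (* The last grid point is at least [1 + H], beyond [z]. *)
  apply: le_trans (_ : 1 + H^-1 * (H * H) <= _); last first.
    by rewrite lerD2l; apply: ler_wpM2l => //; exact: ltW.
  by rewrite mulKf ?gt_eqF //; lra.
move=> t3 s3 fr3 [t3l [y0 hy hyb]].
have f3 k : k \notin mods fib_down -> k \notin mods fib_up -> s3 k = s1 k.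
  by move=> km1 km2; rewrite fr3 // f2.
set y := s3 ry in y0 hy hyb.
apply/wp_seq/wp_asg => //=; apply/wp_seq/wp_asg => //=.
apply: wp_conseq.
  have hb3 : s3 rb = b by rewrite f3.
  apply: (@wp_newton _ (1 + y * b)) => //.
  - by apply: has_fun_frame hf1; rewrite /upd /= f3.
  - by rewrite /upd /= hb3.
  - by rewrite /upd /= f3.
  - by apply: zle => //; rewrite mulr_ge0 //; lra.
  have yz := ylt _ (ltW y0) hy.
  have : y / (M * 2) <= (z - 1) / (M * 2).
    by apply: ler_wpM2r; [rewrite invr_ge0 mulr_ge0 // ltW|lra].
  (* The reason for the choice of [b]: the final grid interval has length [y / 2M], at most
     [(z - 1) / 2M], which is the Newton invariant for [T = 2]. *)
  have -> : y / (M * 2) = y * b - y by rewrite /b; field; rewrite gt_eqF.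
  lra.
move=> t4 s4 fr4 [t4l zz]; split=> //.
have {}t3l : (t3 <= W * 2800)%N.
  apply: leq_trans t3l _; rewrite mulnA -WE -[2800%N]/(7 * 400)%N mulnA leq_mul2r /=.
  by rewrite [(_ * 7)%N]mulnC mulnA leq_mul2r /=; clear; lia.
have {}t4l : (t4 <= W * 400)%N.
  apply: leq_trans t4l _; rewrite mulnA -WE leq_mul2r /= leq_mul2r /=; clear; lia.
by move: t1l t2l t3l t4l W1 W2; clear; rewrite /=; lia.
Qed.

End Core.

(** * Roots near a critical point *)

Notation gA := 20%N (only parsing).
Notation gB := 21%N (only parsing).
Notation gC := 22%N (only parsing).
Notation gm := 23%N (only parsing).
Notation gl := 24%N (only parsing).
Notation rw := 50%N (only parsing).
Notation rz := 51%N (only parsing).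

Definition scale_cmd : cmd :=
  (rPx ::= rw;; rPn ::= gm;; pow_cmd;; gA ::= gA * rPo;;
   rPx ::= rw;; rPn ::= gl;; pow_cmd;; gB ::= gB * rPo)%C.
Definition search_cmd : cmd :=
  (If (gm * gA + gl * gB) (rw ::= N 1)
     (rA ::= gm * gA;; rB ::= N 0;; rC ::= gl * gB;; rm ::= gm - gl;; rl ::= N 0;;
      core_cmd;; rw ::= rX);;
   scale_cmd;;
   If (gA + gB + gC) (rz ::= rw)
     (rA ::= gA;; rB ::= gB;; rC ::= gC;; rm ::= gm;; rl ::= gl;;
      core_cmd;; rz ::= rw * rX))%C.

Section Search.
Variable R : realType.
Implicit Types (s : mstate R).

Lemma hfun_scale (A B C : R) m l w y :
  hfun (A * w ^ m) (B * w ^ l) C m l y = hfun A B C m l (w * y).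
Proof. by rewrite /hfun !expfzMl; ring. Qed.

Lemma dfun_scale (A B : R) m l w y :
  dfun (A * w ^ m) (B * w ^ l) m l y = dfun A B m l (w * y).
Proof. by rewrite /dfun !expfzMl; ring. Qed.

Lemma hfun1 (A B C : R) m l : hfun A B C m l 1 = A + B + C.
Proof. by rewrite /hfun !exp1rz !mulr1. Qed.

Lemma dfun1 (A B : R) m l : dfun A B m l 1 = m%:~R * A + l%:~R * B.
Proof. by rewrite /dfun !exp1rz !mulr1. Qed.

(** A negative derivative at 1 forces [l < 0]. Then [x ^ (- l)] times [dfun A B m l x] is the
    binomial [m A x^(m-l) + l B], which changes sign between 1 and [z]. It has the form of an [h]
    with zero middle term, increasing from 1 on, so the core search applies to it. *)
Lemma critical_point (A B : R) (m l : int) z : 0 < A -> 0 <= B -> 0 < m -> 1 <= z ->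
  dfun A B m l 1 < 0 -> 0 <= dfun A B m l z ->
  exists zc, [/\ 1 < zc, zc <= z, dfun A B m l zc = 0, l < 0
    & hfun (m%:~R * A) 0 (l%:~R * B) (m - l) 0 zc = 0].
Proof.
move=> A0 B0 m0 z1 D1 Dz.
have l0 : l < 0.
  rewrite ltNge; apply/negP => l0; move: D1; rewrite dfun1 ltNge.
  by rewrite addr_ge0 // mulr_ge0 ?ler0z // ltW.
pose n := absz (m - l).
have nE : (n : int) = m - l by rewrite /n gez0_abs //; apply/ltW; rewrite subr_gt0 (lt_trans l0).
have E x : 0 < x -> m%:~R * A * x ^+ n + l%:~R * B = dfun A B m l x * x ^ (- l).
  move=> x0; have xN : x != 0 by rewrite gt_eqF.
  rewrite /dfun mulrDl -!mulrA -!expfzDr // subrr mulr1.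
  by rewrite exprnP nE.
pose p : {poly R} := (m%:~R * A) *: 'X^n + (l%:~R * B)%:P.
have pE x : p.[x] = m%:~R * A * x ^+ n + l%:~R * B by rewrite /p !hornerE.
have z0 : 0 < z by lra.
have [|zc /andP[zc1 zcz] /rootP] := @poly_ivt _ p 1 z z1.
  by rewrite !pE !E // exp1rz mulr1 (ltW D1) mulr_ge0 // ltW // exprz_gt0.
have zc0 : 0 < zc by lra.
rewrite pE => r0; have := r0; rewrite E // => /eqP; rewrite mulf_eq0 => /orP[/eqP Dzc|]; last first.
  by rewrite gt_eqF // exprz_gt0.
exists zc; split=> //.
  rewrite lt_neqAle zc1 andbT; apply/eqP => zcE; move: D1; rewrite zcE Dzc ltxx //.
by rewrite /hfun -nE -exprnP mul0r addr0.
Qed.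

Variables (A B C : R) (m l : int) (L : nat) (M H z : R) (kap : nat).
Hypotheses (mL : (absz m < 2 ^ L)%N) (lL : (absz l < 2 ^ L)%N)
  (mlL : (absz (m - l) < 2 ^ L)%N).
Hypotheses (A0 : 0 < A) (B0 : 0 <= B) (m0 : 0 < m).
Hypotheses (MlM : m%:~R + `|l|%:~R <= M) (H1 : 1 < H) (Hk : H <= 2%:R ^+ (2 ^ kap))
  (ML : M <= 2%:R ^+ L.+1).
Notation h := (hfun A B C m l).
Notation D := (dfun A B m l).

Definition has_rec (A B C : R) m l s :=
  [/\ s gA = A, s gB = B, s gC = C, s gm = m%:~R & s gl = l%:~R].

Lemma wp_scale s w : has_rec A B C m l s -> s rw = w -> w != 0 ->
  wp scale_cmd s (fun t s' => (t <= L.+1 * 300)%N /\ has_rec (A * w ^ m) (B * w ^ l) C m l s').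
Proof.
move=> [hA hB hC hm hl] hw w0.
apply/wp_seq/wp_asg => //; apply/wp_seq/wp_asg => //.
apply: (@wp_pow_seq _ _ _ _ w m L) => // t1 s1 fr1 t1l ho1.
have f1 k : k \notin mods pow_cmd -> (k != rPx) && (k != rPn) -> s1 k = s k.
  by move=> k1 /andP[k2 k3]; rewrite fr1 // /upd (negbTE k2) (negbTE k3).
apply/wp_seq/wp_asg => //; apply/wp_seq/wp_asg => //; apply/wp_seq/wp_asg => //.
apply: (@wp_pow_seq _ _ _ _ w l L) => // [||t2 s2 fr2 t2l ho2].
- by rewrite /upd /= f1.
- by rewrite /upd /= f1.
have f2 k : k \notin mods pow_cmd -> [&& k != rPx, k != rPn & k != gA] -> s2 k = s k.
  move=> k1 /and3P[k2 k3 k4].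
  by rewrite fr2 // /upd (negbTE k2) (negbTE k3) (negbTE k4) f1 // k2.
apply: wp_asg => //; split; first by move: t1l t2l; clear; rewrite /=; lia.
have hA2 : s2 gA = A * w ^ m by rewrite fr2 // /upd /= ho1 f1 // hA.
rewrite /has_rec /upd /= ho2 hA2 (f2 gB) // (f2 gC) // (f2 gm) // (f2 gl) //.
by rewrite hB hC hm hl; split.
Qed.

Hypotheses (hz : h z = 0) (Dz : 0 <= D z) (z1 : 1 <= z) (zH : z <= H).

(** The critical point lies left of [z], so its approximation from above stays below
    [z (1 + 1 / H)]. This makes [w] itself an acceptable answer if it has already passed [z]. *)
Lemma wp_search_base s : has_rec A B C m l s -> s rH = H -> s rM = M ->
  wp (If (gm * gA + gl * gB)%E (rw ::= N 1)
     (rA ::= gm * gA;; rB ::= N 0;; rC ::= gl * gB;; rm ::= gm - gl;; rl ::= N 0;;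
      core_cmd;; rw ::= rX))%C s
   (fun t s' => (t <= L.+1 * (L + kap).+1 * 4950)%N /\
     [/\ 1 <= s' rw, 0 <= D (s' rw) & s' rw <= z * (1 + H^-1)]).
Proof.
move=> [hA hB hC hm hl] hH hM; have z1' := z1; have H1' := H1.
have W1 : (L.+1 <= L.+1 * (L + kap).+1)%N by rewrite leq_pmulr.
have Hi0 : 0 < H^-1 by rewrite invr_gt0; lra.
have zs w : w <= z -> w * (1 + H^-1) <= z * (1 + H^-1).
  by move=> wz; apply: ler_wpM2r => //; lra.
apply: wp_if => //=; rewrite hm hA hl hB -dfun1 => D1.
  apply: wp_asg => //; rewrite /upd /=; split; first by move: W1; clear; lia.
  split=> //; apply: le_trans (zs 1 z1); lra.
have [zc [zc1 zcz Dzc l0 hzc]] := critical_point A0 B0 m0 z1 D1 Dz.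
apply/wp_seq/wp_asg => //; apply/wp_seq/wp_asg => //; apply/wp_seq/wp_asg => //.
apply/wp_seq/wp_asg => //; apply/wp_seq/wp_asg => //.
have MM : (m - l)%:~R + `|0%Z|%:~R <= M.
  by apply: le_trans MlM; rewrite normr0 addr0 intrB ltr0_norm // mulrNz.
apply/wp_seq/wp_conseq.
  apply: (@wp_core _ (m%:~R * A) 0 (l%:~R * B) (m - l) 0 L _ _ _ _ _ _ M H zc kap) => //.
  - by rewrite absz0 expn_gt0.
  - by rewrite mulr_gt0 // ltr0z.
  - by rewrite subr_gt0 (lt_trans l0).
  - rewrite dfun1 mulr0 addr0 !mulr_ge0 // ?ler0z ?ltW // subr_gt0.
    exact: lt_trans m0.
  - exact: le_trans zH.
  rewrite /has_fun /upd /= hA hB hm hl intrB; split=> //.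
move=> t s1 fr [tl /andP[x1 x2]].
apply: wp_asg => //; rewrite /upd /=; split.
  by move: tl W1; clear; lia.
have w1 : 1 <= s1 rX by lra.
split=> //; last exact: le_trans x2 (zs _ zcz).
by apply: (dfun_ge0_mono A0 B0 m0 _ x1); [lra|rewrite Dzc].
Qed.

Lemma wp_search s : has_rec A B C m l s -> s rH = H -> s rM = M ->
  wp search_cmd s (fun t s' => (t <= L.+1 * (L + kap).+1 * (3 * 4000))%N /\
    z <= s' rz <= z * (1 + H^-1)).
Proof.
move=> hf hH hM; have z1' := z1; have H1' := H1.
have W1 : (L.+1 <= L.+1 * (L + kap).+1)%N by rewrite leq_pmulr.
have z0 : 0 < z by lra.
apply/wp_seq; apply: wp_conseq (wp_search_base hf hH hM) _ => t1 s1 fr1 [t1l [w1 Dw wz]].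
set w := s1 rw in w1 Dw wz.
have w0 : 0 < w by lra.
have hf1 : has_rec A B C m l s1.
  by case: hf; rewrite /has_rec !fr1.
apply/wp_seq; apply: wp_conseq (wp_scale (w := w) hf1 _ _) _ => //.
  by rewrite gt_eqF.
move=> t2 s2 fr2 [t2l hf2].
have [hA hB hC hm hl] := hf2.
have hw : s2 rw = w by rewrite fr2.
apply: wp_if => //=; rewrite hA hB hC -(hfun1 _ _ _ m l) hfun_scale mulr1 => hhw.
  apply: wp_asg => //; rewrite /upd /= hw; split.
    by move: t1l t2l W1; clear; lia.
  rewrite wz andbT leNgt; apply/negP => wz'.
  by have := hfun_lt C A0 B0 m0 w0 wz' Dw; rewrite hz ltNge hhw.
apply/wp_seq/wp_asg => //; apply/wp_seq/wp_asg => //; apply/wp_seq/wp_asg => //.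
apply/wp_seq/wp_asg => //; apply/wp_seq/wp_asg => //.
have zw : w < z.
  rewrite ltNge; apply/negP => zw.
  by have := hfun_le C A0 B0 m0 z0 zw Dz; rewrite hz leNgt hhw.
(* After rescaling the root is [z / w], in [(1, H]]; a relative error bound survives the
   multiplication by [w] at the end. *)
apply/wp_seq/wp_conseq.
  apply: (@wp_core _ (A * w ^ m) (B * w ^ l) C m l L _ _ _ _ _ _ M H (z / w) kap) => //.
  - by rewrite mulr_gt0 // exprz_gt0.
  - by rewrite mulr_ge0 // ltW // exprz_gt0.
  - by rewrite dfun_scale mulr1.
  - by rewrite ltr_pdivlMr // mul1r.
  - rewrite ler_pdivrMr //; apply: le_trans zH _; rewrite -[X in X <= _]mulr1.
    by apply: ler_wpM2l => //; lra.
  - by rewrite hfun_scale mulrC divfK // gt_eqF.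
  - by rewrite /upd /= fr2 // fr1.
  - by rewrite /upd /= fr2 // fr1.
move=> t3 s3 fr3 [t3l /andP[x1 x2]].
apply: wp_asg => //; rewrite /upd /= fr3 // /upd /= hw; split.
  by move: t1l t2l t3l W1; clear; lia.
apply/andP; split; first by move: x1; rewrite ler_pdivrMr // mulrC.
by have := ler_wpM2l (ltW w0) x2; rewrite mulrA [w * (z / w)]mulrC divfK // gt_eqF.
Qed.

End Search.

(** * Reduction of a trinomial to increasing branches *)

Notation c0r := 0%N (only parsing).
Notation c1r := 1%N (only parsing).
Notation c2r := 2%N (only parsing).
Notation r_a := 12%N (only parsing).
Notation r_b := 13%N (only parsing).
Notation ginv := 25%N (only parsing).
Notation gact := 26%N (only parsing).
Notation tp := 40%N (only parsing).
Notation tq := 41%N (only parsing).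
Notation tn := 42%N (only parsing).
Notation tu := 43%N (only parsing).

(** With a vanishing discriminant both branches describe the same root, which must be counted once:
    the second slot stays inactive. *)
Definition two_slots_cmd : cmd :=
  (gact ::= N 1;; gA ::= N 1;; gB ::= tq;; gC ::= tp;; gm ::= tn;; gl ::= N 0 - r_a;;
   ginv ::= N 0 - N 1;;
   If (N 0 - tu) Skip
     (36%N ::= N 1;; 30%N ::= tq;; 31%N ::= N 1;; 32%N ::= tp;; 33%N ::= r_a;;
      34%N ::= N 0 - tn;; 35%N ::= N 1))%C.
Definition setup_two_cmd : cmd :=
  (tn ::= r_b - r_a;;
   rPx ::= r_a * tq / tn;; rPn ::= r_a;; pow_cmd;; tu ::= rPo;;
   rPx ::= r_b * tq / (N 0 - tn * tp);; rPn ::= r_b;; pow_cmd;; tu ::= tu - rPo;;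
   If tu two_slots_cmd Skip)%C.
Definition setup_one_cmd : cmd :=
  (gact ::= N 1;; gA ::= N 1;; gm ::= r_b;;
   If tp (gB ::= tp;; gC ::= tq;; gl ::= r_a;; ginv ::= N 0 - N 1)
         (gB ::= tp / tq;; gC ::= N 1 / tq;; gl ::= r_b - r_a;; ginv ::= N 1))%C.
(** [2 b] bounds [m + |l|] in each reduction, the sums being [b + a], [b + (b - a)] and [n + a = b].
    The sign of [c0 c2] separates one positive root (negative) from zero or two, counted without
    multiplicity when double; it vanishes for a monomial. *)
Definition setup_cmd : cmd :=
  (gact ::= N 0 - N 1;; 36%N ::= N 0 - N 1;; rM ::= N 2 * r_b;;
   If (c0r * c2r)
     (If (N 0 - c0r * c2r) Skip
        (tp ::= c1r / c2r;; tq ::= c0r / c2r;; If tp Skip setup_two_cmd))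
     (tp ::= c1r / c2r;; tq ::= c0r / c2r;; setup_one_cmd))%C.

Section Setup.
Variable R : realType.
Implicit Types (s : mstate R).

(* The registers from [k] on describe a branch root of [hfun A B C m l], namely the root
   [x] or, if the register [k + 5] is non-negative, its inverse. *)
Definition slot (L : nat) (M : R) s k (o : option R) :=
  if o is Some x then
    s (k + 6)%N = 1 /\ exists A B C m l z,
     [/\ [/\ s k = A, s (k + 1)%N = B, s (k + 2)%N = C, s (k + 3)%N = m%:~R & s (k + 4)%N = l%:~R],
         branch_root A B C m l z,
         [/\ (absz m < 2 ^ L)%N, (absz l < 2 ^ L)%N & (absz (m - l) < 2 ^ L)%N],
         m%:~R + `|l|%:~R <= M
       & (s (k + 5)%N = -1 /\ x = z) \/ (s (k + 5)%N = 1 /\ x = z^-1)]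
  else s (k + 6)%N = -1.

(** A binomial is stored with [c1 = 0], a monomial with [c1 = c2 = 0]; [c0 != 0] removes the root
    0. *)
Definition normal_form (c0 c1 c2 : R) (a b L : nat) :=
  [/\ c0 != 0, (c2 != 0 -> (0 < b)%N), (a <= b)%N,
      (c1 != 0 -> c2 != 0 /\ (0 < a < b)%N) & (b < 2 ^ L)%N].

Definition has_normal (c0 c1 c2 : R) (a b : nat) s :=
  [/\ s c0r = c0, s c1r = c1, s c2r = c2, s r_a = a%:R & s r_b = b%:R].

Variables (c0 c1 c2 : R) (a b L : nat).
Hypothesis nf : normal_form c0 c1 c2 a b L.
Notation g := (g3 c0 c1 c2 a b).

Definition branches s (rs : seq R) := s rM = 2 * b%:R /\ exists o1 o2,
  [/\ slot L (2 * b%:R) s 20 o1, slot L (2 * b%:R) s 30 o2, rs = pmap id [:: o1; o2],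
      uniq rs & forall x, 0 < x -> (x \in rs) = (g x == 0)].

Let aL : (a < 2 ^ L)%N.
Proof. by case: nf => _ _ ab _; apply: leq_ltn_trans. Qed.
Let bL : (b < 2 ^ L)%N. Proof. by case: nf. Qed.
Let bals : (b - a < 2 ^ L)%N.
Proof. exact: leq_ltn_trans (leq_subr _ _) bL. Qed.
Let ab : (a <= b)%N. Proof. by case: nf. Qed.

Lemma wp_setup_one s : has_normal c0 c1 c2 a b s -> c2 != 0 -> s rM = 2 * b%:R ->
  s 36%N = -1 -> s tp = c1 / c2 -> s tq = c0 / c2 -> c0 / c2 < 0 ->
  wp setup_one_cmd s (fun t s' => (t <= 100)%N /\ exists rs, branches s' rs).
Proof.
move=> [h0 h1 h2 ha hb] c2N hM h36 hp hq q0.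
have [c0N /(_ c2N) b0 _ c1N _] := nf.
have {}c1N : c1 != 0 -> (0 < a < b)%N by move=> /c1N[].
apply/wp_seq/wp_asg => //; apply/wp_seq/wp_asg => //; apply/wp_seq/wp_asg => //.
apply: wp_if => //=; rewrite /upd /= hp => p0.
  have [z [bz zu]] := one_root_direct c2N b0 c1N q0 p0.
  have [_ [z0 _ _]] := bz.
  apply/wp_seq/wp_asg => //; apply/wp_seq/wp_asg => //; apply/wp_seq/wp_asg => //.
  apply: wp_asg => //; split; first by [].
  exists [:: z]; rewrite /branches /upd /=; split=> //.
  exists (Some z), None; split=> //; last first.
    by move=> x x0; rewrite inE; apply/eqP/eqP; rewrite zu.
  split; first by [].
  exists 1, (c1 / c2), (c0 / c2), (b : int), (a : int), z; split=> //.
  - by split=> //; rewrite subzn.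
  - by rewrite ger0_norm // -natrD -[2]/(2%:R) -natrM ler_nat; move: ab; clear; lia.
  - by left; split=> //=; rewrite sub0r.
have [z [bz zu]] := one_root_inverted c2N b0 ab c1N q0 p0.
have [_ [z0 _ _]] := bz.
apply/wp_seq/wp_asg => /=.
  by split=> //; rewrite /upd /= hq lt_eqF.
apply/wp_seq/wp_asg => /=.
  by split=> //; rewrite /upd /= hq lt_eqF.
apply/wp_seq/wp_asg => //.
apply: wp_asg => //; split; first by [].
exists [:: z^-1]; rewrite /branches /upd /=; split=> //.
exists (Some z^-1), None; split=> //; last first.
  by move=> x x0; rewrite inE; apply/eqP/eqP; rewrite zu.
split; first by [].
exists 1, (c1 / c2 / (c0 / c2)), (1 / (c0 / c2)), (b : int), ((b - a)%N : int), z; split=> //.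
- by rewrite /= hp hq ha hb; split=> //; rewrite -natrB.
- by split=> //; rewrite subzn ?leq_subr // subKn.
- by rewrite ger0_norm // -natrD -[2]/(2%:R) -natrM ler_nat; clear; lia.
- by right.
Qed.

Lemma wp_setup_two s : has_normal c0 c1 c2 a b s -> c2 != 0 -> s rM = 2 * b%:R ->
  s gact = -1 -> s 36%N = -1 -> s tp = c1 / c2 -> s tq = c0 / c2 -> 0 < c0 / c2 ->
  c1 / c2 < 0 ->
  wp setup_two_cmd s (fun t s' => (t <= L.+1 * 500)%N /\ exists rs, branches s' rs).
Proof.
move=> [h0 h1 h2 ha hb] c2N hM hact h36 hp hq q0 p0.
have [c0N /(_ c2N) b0 _ c1N _] := nf.
have {}c1N : c1 != 0 -> (0 < a < b)%N by move=> /c1N[].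
have c10 : c1 != 0 by apply: contraTneq p0 => ->; rewrite mul0r ltxx.
have /andP[a0 ab'] := c1N c10.
have n0 : (0 < b - a)%N by rewrite subn_gt0.
have nN : (b - a)%N%:R != 0 :> R by rewrite pnatr_eq0 -lt0n.
have nE : b%:R - a%:R = (b - a)%N%:R :> R by rewrite natrB.
apply/wp_seq/wp_asg => //.
apply/wp_seq/wp_asg => /=.
  by split=> //; rewrite /upd /= hb ha nE.
apply/wp_seq/wp_asg => //.
apply: (@wp_pow_seq _ _ _ _ (a%:R * (c0 / c2) / (b - a)%N%:R) a L) => //.
  by rewrite /upd /= ha hb hq nE.
move=> t1 s1 fr1 t1l ho1.
apply/wp_seq/wp_asg => //.
have f1 k : k \notin mods pow_cmd -> [&& k != rPx, k != rPn & k != tn] -> s1 k = s k.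
  by move=> k1 /and3P[k2 k3 k4]; rewrite fr1 // /upd (negbTE k2) (negbTE k3) (negbTE k4).
have hn1 : s1 tn = (b - a)%N%:R by rewrite fr1 // /upd /= ha hb nE.
have npN : 0 - (b - a)%N%:R * (c1 / c2) != 0.
  by rewrite sub0r oppr_eq0 mulf_neq0 // lt_eqF.
apply/wp_seq/wp_asg => /=.
  by rewrite /upd /= hn1 f1 // hp.
apply/wp_seq/wp_asg => //.
apply: (@wp_pow_seq _ _ _ _ (b%:R * (c0 / c2) / - ((b - a)%N%:R * (c1 / c2))) b L) => //.
- by rewrite /upd /= hn1 f1 // f1 // f1 // hb hp hq sub0r.
- by rewrite /upd /= f1.
move=> t2 s2 fr2 t2l ho2.
have f2 k : k \notin mods pow_cmd -> [&& k != rPx, k != rPn, k != tn & k != tu] -> s2 k = s k.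
  move=> k1 /and4P[k2 k3 k4 k5].
  by rewrite fr2 // /upd (negbTE k2) (negbTE k3) (negbTE k5) f1 // k2 k3.
have hn2 : s2 tn = (b - a)%N%:R by rewrite fr2.
have hu2 : s2 tu = (a%:R * (c0 / c2) / (b - a)%N%:R) ^+ a by rewrite fr2.
apply/wp_seq/(@wp_asg_eq _ _ _ (disc c0 c1 c2 a b)); [by []|by rewrite /= hu2 ho2|].
have hp2 : s2 tp = c1 / c2 by rewrite f2.
have hq2 : s2 tq = c0 / c2 by rewrite f2.
have ha2 : s2 r_a = a%:R by rewrite f2.
have hM2 : s2 rM = 2 * b%:R by rewrite f2.
have ht2 : s2 36%N = -1 by rewrite f2.
have hact2 : s2 gact = -1 by rewrite f2.
apply: wp_if => // d0; rewrite /= /upd /= in d0; last first.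
  apply: wp_skip; split; first by move: t1l t2l; clear; rewrite /=; lia.
  exists [::]; split; first by rewrite /upd.
  exists None, None; split=> // x x0; apply/esym/negbTE.
  exact: (no_root_disc c2N b0 ab c1N q0 p0 d0 x0).
have [z1 [z2 [b1 b2 zu zz]]] := two_roots_disc c2N b0 ab c1N q0 p0 d0.
apply/wp_seq/(@wp_asg_eq _ _ _ 1); [by []|by rewrite /= /upd /= ?hq2 ?hp2 ?hn2 ?ha2 ?sub0r|].
apply/wp_seq/(@wp_asg_eq _ _ _ 1); [by []|by rewrite /= /upd /= ?hq2 ?hp2 ?hn2 ?ha2 ?sub0r|].
apply/wp_seq/(@wp_asg_eq _ _ _ (c0 / c2)); [by []|by rewrite /= /upd /= ?hq2 ?hp2 ?hn2 ?ha2 ?sub0r|].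
apply/wp_seq/(@wp_asg_eq _ _ _ (c1 / c2)); [by []|by rewrite /= /upd /= ?hq2 ?hp2 ?hn2 ?ha2 ?sub0r|].
apply/wp_seq/(@wp_asg_eq _ _ _ (b - a)%N%:R); [by []|by rewrite /= /upd /= ?hq2 ?hp2 ?hn2 ?ha2 ?sub0r|].
apply/wp_seq/(@wp_asg_eq _ _ _ (- a%:R)); [by []|by rewrite /= /upd /= ?hq2 ?hp2 ?hn2 ?ha2 ?sub0r|].
apply/wp_seq/(@wp_asg_eq _ _ _ (-1)); [by []|by rewrite /= /upd /= ?hq2 ?hp2 ?hn2 ?ha2 ?sub0r|].
have dn : (b - a + a = b)%N by rewrite subnK.
have S1 s' : s' gact = 1 -> s' gA = 1 -> s' gB = c0 / c2 -> s' gC = c1 / c2 ->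
    s' gm = (b - a)%N%:R -> s' gl = - a%:R -> s' ginv = -1 ->
    slot L (2 * b%:R) s' 20 (Some z1).
  move=> ? ? ? ? ? hl ?; split=> //.
  exists 1, (c0 / c2), (c1 / c2), ((b - a)%N : int), (- (a : int)), z1; split=> //.
  - by split=> //; rewrite mulrNz.
  - by split=> //; rewrite ?abszN // opprK -PoszD dn.
  - by rewrite normrN ger0_norm // -natrD dn -[2]/(2%:R) -natrM ler_nat leq_pmull.
  - by left.
have S2 s' : s' 36%N = 1 -> s' 30%N = c0 / c2 -> s' 31%N = 1 -> s' 32%N = c1 / c2 ->
    s' 33%N = a%:R -> s' 34%N = - (b - a)%N%:R -> s' 35%N = 1 ->
    slot L (2 * b%:R) s' 30 (Some z2^-1).
  move=> ? ? ? ? ? hl ?; split=> //.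
  exists (c0 / c2), 1, (c1 / c2), (a : int), (- ((b - a)%N : int)), z2; split=> //.
  - by split=> //; rewrite mulrNz.
  - by split=> //; rewrite ?abszN // opprK -PoszD addnC dn.
  - by rewrite normrN ger0_norm // -natrD addnC dn -[2]/(2%:R) -natrM ler_nat leq_pmull.
  - by right.
apply: wp_if => // d1; rewrite /= /upd /= sub0r ?oppr_ge0 ?oppr_lt0 in d1.
  apply: wp_skip; split; first by move: t1l t2l; clear; rewrite /=; lia.
  have d2 : disc c0 c1 c2 a b == 0 by rewrite eq_le d1.
  rewrite d2 in zz; move/eqP: zz => zz.
  exists [:: z1]; split; first by rewrite /upd /=.
  exists (Some z1), None; split=> //.
    by apply: S1.
  move=> x x0; rewrite inE; apply/eqP/eqP; rewrite zu // -zz; first by left.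
  by case.
apply/wp_seq/(@wp_asg_eq _ _ _ 1); [by []|by rewrite /= /upd /= ?hq2 ?hp2 ?hn2 ?ha2 ?sub0r|].
apply/wp_seq/(@wp_asg_eq _ _ _ (c0 / c2)); [by []|by rewrite /= /upd /= ?hq2 ?hp2 ?hn2 ?ha2 ?sub0r|].
apply/wp_seq/(@wp_asg_eq _ _ _ 1); [by []|by rewrite /= /upd /= ?hq2 ?hp2 ?hn2 ?ha2 ?sub0r|].
apply/wp_seq/(@wp_asg_eq _ _ _ (c1 / c2)); [by []|by rewrite /= /upd /= ?hq2 ?hp2 ?hn2 ?ha2 ?sub0r|].
apply/wp_seq/(@wp_asg_eq _ _ _ a%:R); [by []|by rewrite /= /upd /= ?hq2 ?hp2 ?hn2 ?ha2 ?sub0r|].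
apply/wp_seq/(@wp_asg_eq _ _ _ (- (b - a)%N%:R)); [by []|by rewrite /= /upd /= ?hq2 ?hp2 ?hn2 ?ha2 ?sub0r|].
apply: (@wp_asg_eq _ _ _ 1); [by []|by []|].
split; first by move: t1l t2l; clear; rewrite /=; lia.
rewrite [disc _ _ _ _ _ == 0]gt_eqF // in zz.
exists [:: z1; z2^-1]; split; first by rewrite /upd /=.
exists (Some z1), (Some z2^-1); split=> //.
- by apply: S1.
- by apply: S2.
- by rewrite /= inE zz.
move=> x x0; rewrite !inE; apply/orP/eqP; rewrite zu //.
  by case=> /eqP; [left|right].
by case=> /eqP; [left|right].
Qed.

Lemma wp_setup s : has_normal c0 c1 c2 a b s ->
  wp setup_cmd s (fun t s' => (t <= L.+1 * 600)%N /\ exists rs, branches s' rs).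
Proof.
move=> [h0 h1 h2 ha hb].
have [c0N b0 _ c1N _] := nf.
apply/wp_seq/wp_asg => //; apply/wp_seq/wp_asg => //; apply/wp_seq/wp_asg => //.
have none s' : (forall x, 0 < x -> g x != 0) -> s' rM = 2 * b%:R -> s' gact = -1 ->
    s' 36%N = -1 -> exists rs, branches s' rs.
  move=> ng hM h26 h36; exists [::]; split=> //; exists None, None; split=> // x x0.
  by apply/esym/negbTE/ng.
apply: wp_if => //; rewrite [eval _ _]/= /upd /= h0 h2 => s02.
  apply: wp_if => //; rewrite [eval _ _]/= /upd /= h0 h2 sub0r ?oppr_ge0 ?oppr_lt0 => s02'.
    apply: wp_skip; split; first by clear; rewrite /=; lia.
    have /eqP : c0 * c2 == 0 by rewrite eq_le s02 s02'.
    move=> /eqP; rewrite mulf_eq0 (negbTE c0N) /= => /eqP c20.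
    have c10 : c1 = 0.
      by apply/eqP/negPn/negP => /c1N[]; rewrite c20 eqxx.
    apply: none; rewrite /upd /= ?hb ?sub0r // => x x0.
    by rewrite /g3 c10 c20 !mul0r !addr0.
  have c2N : c2 != 0 by apply: contraTneq s02' => ->; rewrite mulr0 ltxx.
  have q0 : 0 < c0 / c2.
    have -> : c0 / c2 = c0 * c2 / (c2 * c2) by field.
    by rewrite divr_gt0 // -expr2 exprn_even_gt0.
  apply/wp_seq/wp_asg => //; first by rewrite /= /upd /= h2.
  apply/wp_seq/wp_asg => //; first by rewrite /= /upd /= h2.
  apply: wp_if => //; rewrite [eval _ _]/= /upd /= h1 h2 => p0.
    apply: wp_skip; split; first by clear; rewrite /=; lia.
    apply: none; rewrite /upd /= ?hb ?sub0r // => x x0.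
    have : 0 < g3 c0 c1 c2 a b x / c2.
      have -> : g3 c0 c1 c2 a b x / c2 = c0 / c2 + c1 / c2 * x ^+ a + x ^+ b by rewrite /g3; field.
      apply: ltr_wpDr; first by rewrite exprn_ge0 // ltW.
      by apply: ltr_wpDr => //; rewrite mulr_ge0 // exprn_ge0 // ltW.
    by apply: contraTneq => ->; rewrite mul0r ltxx.
  apply: wp_conseq.
    by apply: wp_setup_two; rewrite /has_normal /upd /= ?h0 ?h1 ?h2 ?hb ?sub0r.
  move=> t s' _ [tl H]; split=> //; by move: tl; clear; rewrite /=; lia.
have c2N : c2 != 0 by apply: contraTneq s02 => ->; rewrite mulr0 ltxx.
have q0 : c0 / c2 < 0.
  have -> : c0 / c2 = c0 * c2 / (c2 * c2) by field.
  by rewrite pmulr_llt0 // invr_gt0 -expr2 exprn_even_gt0.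
apply/wp_seq/wp_asg => //; first by rewrite /= /upd /= h2.
apply/wp_seq/wp_asg => //; first by rewrite /= /upd /= h2.
apply: wp_conseq.
  by apply: wp_setup_one; rewrite /has_normal /upd /= ?h0 ?h1 ?h2 ?hb ?sub0r.
move=> t s' _ [tl H]; split=> //; by move: tl; clear; rewrite /=; lia.
Qed.

End Setup.

(** * Approximation of the roots in a range *)

Notation rL := 14%N (only parsing).
Notation rU := 15%N (only parsing).
Notation tD := 45%N (only parsing).
Notation th := 46%N (only parsing).
Notation tpos := 47%N (only parsing).
Notation tx := 48%N (only parsing).
Notation rcnt := 8%N (only parsing).

Definition load_cmd : cmd := (rA ::= gA;; rB ::= gB;; rC ::= gC;; rm ::= gm;; rl ::= gl)%C.
Definition locate_cmd : cmd :=
  (tD ::= gm * gA + gl * gB;; th ::= gA + gB + gC;;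
   load_cmd;; rX ::= rH;; eval_cmd;;
   tpos ::= N 0;;
   If tD (If (N 0 - th) Skip (tpos ::= N 0 - N 1)) Skip;;
   If tpos (If rD (If rh Skip (tpos ::= N 1)) (tpos ::= N 1)) Skip)%C.
(* The branch is rescaled so that the range [rL, rU] becomes [1, rH]; [tpos] is then -1, 0 or
   1 when the root lies below, in or above [1, rH], and [tx] is set to -1 when the root of the
   trinomial exceeds [rU]. *)
Definition approx_cmd : cmd :=
  (If ginv (rw ::= N 1 / rU) (rw ::= rL);; scale_cmd;; locate_cmd;;
   tx ::= N 0 - N 1;;
   If tpos
     (If (N 0 - tpos)
        (search_cmd;;
         If ginv (tx ::= rU / rz)
           (If (rU - rL * rz) (tx ::= rL * rz) (tx ::= rU)))
        (If ginv (tx ::= rL) Skip))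
     (If ginv Skip (tx ::= rL)))%C.
(** Without indirect addressing, the output register has to be selected by branching on the current
    count. *)
Definition append_cmd : cmd :=
  (If tx (If (N 0 - rcnt) (9%N ::= tx) (If (N 1 - rcnt) (10%N ::= tx) (11%N ::= tx));;
     rcnt ::= rcnt + N 1) Skip)%C.
Definition branch_approx_cmd : cmd := (If gact (approx_cmd;; append_cmd) Skip)%C.
Definition copy_cmd : cmd :=
  (gA ::= 30%N;; gB ::= 31%N;; gC ::= 32%N;; gm ::= 33%N;; gl ::= 34%N;;
   ginv ::= 35%N;; gact ::= 36%N)%C.

Section Approx.
Variable R : realType.
Implicit Types (s : mstate R) (x y z : R).

Lemma wp_load s (A B C : R) m l : has_rec A B C m l s ->
  wp load_cmd s (fun t s' => (t <= 20)%N /\ has_fun A B C m l s').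
Proof.
move=> [hA hB hC hm hl].
apply/wp_seq/(@wp_asg_eq _ _ _ A); [by []|by []|].
apply/wp_seq/(@wp_asg_eq _ _ _ B); [by []|by []|].
apply/wp_seq/(@wp_asg_eq _ _ _ C); [by []|by []|].
apply/wp_seq/(@wp_asg_eq _ _ _ m%:~R); [by []|by []|].
by apply/(@wp_asg_eq _ _ _ l%:~R).
Qed.

Section Rescaled.
Variables (A B C H z : R) (m l : int) (L : nat).
Hypotheses (mL : (absz m < 2 ^ L)%N) (lL : (absz l < 2 ^ L)%N).
Hypotheses (H1 : 1 < H) (bz : branch_root A B C m l z).

Lemma wp_locate s : has_rec A B C m l s -> s rH = H ->
  wp locate_cmd s (fun t s' => (t <= L.+1 * 400)%N /\
    [\/ s' tpos = -1 /\ z < 1, s' tpos = 1 /\ H < z | s' tpos = 0 /\ 1 <= z <= H]).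
Proof.
move=> hf hH; have [hA hB hC hm hl] := hf.
have H0 : 0 < H by apply: lt_trans H1.
have [d1 d2 d3 d4] := branch_cmp bz ltr01.
have [e1 e2 e3 e4] := branch_cmp bz H0.
apply/wp_seq/(@wp_asg_eq _ _ _ (dfun A B m l 1)) => //.
  by rewrite /= dfun1 hA hB hm hl.
apply/wp_seq/(@wp_asg_eq _ _ _ (hfun A B C m l 1)) => //.
  by rewrite /= /upd /= hfun1 hA hB hC.
apply/wp_seq; apply: wp_conseq.
  by apply: (@wp_load _ A B C m l).
move=> t1 s1 fr1 [t1l hf1].
apply/wp_seq/(@wp_asg_eq _ _ _ H) => //; first by rewrite /= fr1.
apply: (@wp_eval_seq _ A B C m l L _ _ _ H) => //; first by rewrite gt_eqF.
move=> t2 s2 fr2 t2l hh hD.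
apply/wp_seq/(@wp_asg_eq _ _ _ 0); [by []|by []|].
apply/wp_seq.
have htD : s2 tD = dfun A B m l 1 by rewrite fr2 // /upd /= fr1.
have hth : s2 th = hfun A B C m l 1 by rewrite fr2 // /upd /= fr1.
apply: (@wp_conseq _ _ _ (fun t s' => (t <= 30)%N /\
   ((s' tpos = -1 /\ z < 1) \/ (s' tpos = 0 /\ 1 <= z)))).
  apply: wp_if => // g0; rewrite /= /upd /= htD in g0.
    apply: wp_if => // g1; rewrite /= /upd /= hth sub0r ?oppr_ge0 ?oppr_lt0 in g1.
      apply: wp_skip; split=> //; right; split=> //.
      move: g1; rewrite le_eqVlt => /orP[/eqP/(d3 g0)->//|g1].
      exact/ltW/(d2 g0 g1).
    apply: (@wp_asg_eq _ _ _ (-1)); [by []|by rewrite /= sub0r|]; split=> //; left; split=> //.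
    exact: d4 g0 g1.
  apply: wp_skip; split=> //; right; split=> //.
  exact/ltW/d1.
move=> t3 s3 fr3 [t3l C3].
have hD3 : s3 rD = dfun A B m l H by rewrite fr3.
have hh3 : s3 rh = hfun A B C m l H by rewrite fr3.
case: C3 => [[p3 z1]|[p3 z1]].
  apply: wp_if => // g0; rewrite /= p3 ?oppr_ge0 ?ler10 // in g0.
  apply: wp_skip; split; last by constructor 1.
  by move: t1l t2l t3l; clear; rewrite /=; lia.
apply: wp_if => // g0; last by rewrite /= p3 ltxx in g0.
have c1 : z <= H -> 1 <= z <= H by rewrite z1.
apply: wp_if => // g1; rewrite /= hD3 in g1.
  apply: wp_if => // g2; rewrite /= hh3 in g2.
    apply: wp_skip; split; last constructor 3.
      by move: t1l t2l t3l; clear; rewrite /=; lia.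
    split=> //; apply: c1.
    move: g2; rewrite le_eqVlt => /orP[/eqP/esym/(e3 g1)->//|g2].
    exact/ltW/(e4 g1 g2).
  apply: (@wp_asg_eq _ _ _ 1) => //; split; last first.
    by constructor 2; split=> //; exact: e2 g1 g2.
  by move: t1l t2l t3l; clear; rewrite /=; lia.
apply: (@wp_asg_eq _ _ _ 1) => //; split; last first.
  by constructor 2; split=> //; exact: e1 g1.
by move: t1l t2l t3l; clear; rewrite /=; lia.
Qed.

End Rescaled.

Lemma branch_scale (A B C : R) m l z w : branch_root A B C m l z -> 0 < w ->
  branch_root (A * w ^ m) (B * w ^ l) C m l (z / w).
Proof.
move=> [[A0 B0 m0] [z0 hz Dz]] w0.
have e : w * (z / w) = z by rewrite mulrC divfK // gt_eqF.
split; split=> //.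
- by rewrite mulr_gt0 // exprz_gt0.
- by rewrite mulr_ge0 // ltW // exprz_gt0.
- by rewrite divr_gt0.
- by rewrite hfun_scale e.
- by rewrite dfun_scale e.
Qed.

Variables (L kap : nat) (M low U eps : R).
Hypotheses (low0 : 0 < low) (lowU : 2 * low <= U) (lowe : low < eps).
Hypotheses (Hk : U / low <= 2%:R ^+ (2 ^ kap)) (ML : M <= 2%:R ^+ L.+1).

Definition has_range s := [/\ s rL = low, s rU = U, s rH = U / low & s rM = M].

(** The value -1 signals a root beyond the range, which is not to be output. *)
Definition approximates x y := (U < x /\ y = -1) \/
  [/\ x <= U, 0 <= y, y <= U & `|x - y| < eps].

(** A relative error [low / U] on a quantity of at most [U] is an absolute error of at most [low],
    hence below [eps]. *)
Lemma approx_inrange x y : 0 < x -> x <= U -> 0 <= y -> y <= U ->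
  x <= y <= x * (1 + low / U) \/ (y <= x <= y * (1 + low / U)) -> approximates x y.
Proof.
move=> x0 xU y0 yU H; right; split=> //.
have U0 : 0 < U by move: (low0) (lowU); lra.
have b v : 0 <= v -> v <= U -> v * (low / U) <= low.
  move=> v0 vU; rewrite mulrA ler_pdivrMr // mulrC; apply: ler_wpM2l => //.
  exact: ltW.
have lowe' := lowe.
case: H => /andP[h1]; rewrite mulrDr mulr1 => h2.
  have := b x (ltW x0) xU; rewrite distrC ger0_norm ?subr_ge0 //; lra.
by have := b y y0 yU; rewrite ger0_norm ?subr_ge0 //; lra.
Qed.

(** Roots below [low] need no search, so the logarithmic scale never has to approach 0. *)
Lemma approx_low x : 0 < x -> x < low -> approximates x low.
Proof.
move=> x0 xl; right; have := low0; have := lowU; have := lowe => h1 h2 h3.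
split; [lra|lra|lra|]; rewrite distrC gtr0_norm; lra.
Qed.

Lemma wp_approx s x : has_range s -> slot L M s 20 (Some x) ->
  wp approx_cmd s (fun t s' => (t <= L.+1 * (L + kap).+1 * (4 * 4000))%N /\
    approximates x (s' tx)).
Proof.
move=> [hL hU hH hM] [_ [A [B [C [m [l [z [hf0 bz [mL lL mlL] MlM hinv]]]]]]]].
have low0' := low0; have lowU' := lowU; have lowe' := lowe.
have U0 : 0 < U by lra.
have UN : U != 0 by rewrite gt_eqF.
have lN : low != 0 by rewrite gt_eqF.
have W1 : (L.+1 <= L.+1 * (L + kap).+1)%N by rewrite leq_pmulr.
have hf : has_rec A B C m l s by [].
have z0 : 0 < z by case: bz => _ [].
pose inv := 0 <= s ginv.
(* The lower end of the range of [z], which for an inverted branch is [[1 / U, 1 / low]]; both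
   ranges have ratio [U / low]. *)
pose w := if inv then U^-1 else low.
have w0 : 0 < w by rewrite /w; case: ifP => // _; rewrite invr_gt0.
have H2 : 1 < U / low by rewrite ltr_pdivlMr //; lra.
have hx : x = if inv then z^-1 else z.
  by rewrite /inv; case: hinv => [] [-> ->]; rewrite ?oppr_ge0 ?ler10 ?ler01.
apply/wp_seq; apply: (@wp_conseq _ _ _ (fun t s' => (t <= 20)%N /\ s' rw = w)).
  apply: wp_if => //=; rewrite /w /inv => hi.
    apply: (@wp_asg_eq _ _ _ U^-1); [by rewrite /= hU|by rewrite /= hU div1r|].
    by rewrite hi.
  by apply: (@wp_asg_eq _ _ _ low) => //; rewrite leNgt hi.
move=> t1 s1 fr1 [t1l hw].
have hf1 : has_rec A B C m l s1 by case: hf; rewrite /has_rec !fr1.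
apply/wp_seq; apply: wp_conseq (wp_scale mL lL hf1 hw (lt0r_neq0 w0)) _.
move=> t2 s2 fr2 [t2l hf2].
have bz2 := branch_scale bz w0.
have [bA bB bm] := bz2.1; have [zw0 hzw Dzw] := bz2.2.
apply/wp_seq; apply: wp_conseq.
  by apply: (wp_locate mL lL H2 bz2 hf2); rewrite fr2 // fr1.
move=> t3 s3 fr3 [t3l pos].
have f3 k : k \notin mods locate_cmd -> k \notin mods scale_cmd ++ [:: rw] -> s3 k = s k.
  move=> k1; rewrite mem_cat negb_or => /andP[k2 k3]; rewrite fr3 // fr2 // fr1 //.
  by move: k3; rewrite !inE orbb.
have hi3 : s3 ginv = s ginv by rewrite f3.
have hL3 : s3 rL = low by rewrite f3.
have hU3 : s3 rU = U by rewrite f3.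
have hH3 : s3 rH = U / low by rewrite f3.
have hM3 : s3 rM = M by rewrite f3.
have hf3 : has_rec (A * w ^ m) (B * w ^ l) C m l s3.
  by case: hf2 => *; rewrite /has_rec !fr3.
apply/wp_seq/(@wp_asg_eq _ _ _ (-1)); [by []|by rewrite /= sub0r|].
have Uinv : low / U = (U / low)^-1 by rewrite invf_div.
apply: wp_if => // gpos; rewrite /= /upd /= in gpos; last first.
  have zw1 : z / w < 1.
    case: pos => [[_ //]|[e _]|[e _]]; move: gpos; rewrite e ?ltxx //.
    by rewrite ltr10.
  have {}zw1 : z < w by move: zw1; rewrite ltr_pdivrMr // mul1r.
  apply: wp_if => // ginv_; rewrite /= /upd /= hi3 in ginv_.
    apply: wp_skip; split; first by move: t1l t2l t3l W1; clear; rewrite /=; lia.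
    left; split=> //; rewrite hx; move: zw1; rewrite /w /inv ginv_ => zw1.
    by rewrite -[U]invrK ltf_pV2 // posrE invr_gt0.
  apply: (@wp_asg_eq _ _ _ low) => //.
  split; first by move: t1l t2l t3l W1; clear; rewrite /=; lia.
  rewrite /upd /=; move: zw1; rewrite hx /w /inv leNgt ginv_ /= => zw1.
  exact: approx_low.
apply: wp_if => // gpos2; rewrite /= /upd /= sub0r ?oppr_ge0 ?oppr_lt0 in gpos2; last first.
  have zw1 : U / low < z / w.
    case: pos => [[e _]|[e //]|[e _]]; move: gpos2; rewrite e ?ltxx //.
    by rewrite ltNge lerN10.
  have {}zw1 : U / low * w < z by move: zw1; rewrite ltr_pdivlMr.
  apply: wp_if => // ginv_; rewrite /= /upd /= hi3 in ginv_; last first.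
    apply: wp_skip; split; first by move: t1l t2l t3l W1; clear; rewrite /=; lia.
    left; split=> //; rewrite hx; move: zw1; rewrite /w /inv leNgt ginv_ /= => zw1.
    by move: zw1; rewrite divfK.
  apply: (@wp_asg_eq _ _ _ low) => //.
  split; first by move: t1l t2l t3l W1; clear; rewrite /=; lia.
  rewrite /upd /=; move: zw1; rewrite hx /w /inv ginv_ => zw1.
  have {}zw1 : z^-1 < low.
    rewrite -[low]invrK ltf_pV2 ?posrE ?invr_gt0 //.
    by apply: le_lt_trans zw1; rewrite mulrAC divff // mul1r.
  by apply: approx_low; rewrite ?invr_gt0.
have /andP[zw1 zw2] : 1 <= z / w <= U / low.
  case: pos => [[e _]|[e _]|[_ //]].
    by move: gpos; rewrite e lerN10 || rewrite e oppr_ge0 ler10.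
  by move: gpos2; rewrite e ler10.
apply/wp_seq; apply: wp_conseq.
  by apply: (wp_search mL lL mlL bA bB bm MlM H2 Hk ML hzw Dzw zw1 zw2).
move=> t4 s4 fr4 [t4l /andP[y1 y2]].
have hi4 : s4 ginv = s ginv by rewrite fr4.
have hL4 : s4 rL = low by rewrite fr4.
have hU4 : s4 rU = U by rewrite fr4.
set y := s4 rz in y1 y2 *.
have y1' : 1 <= y by exact: le_trans y1.
have y0 : 0 < y by exact: lt_le_trans y1'.
apply: wp_if => // ginv_; rewrite /= hi4 in ginv_.
  have wE : w = U^-1 by rewrite /w /inv ginv_.
  have xE : x = z^-1 by rewrite hx /inv ginv_.
  have yx : U / y <= x.
    rewrite xE ler_pdivrMr // mulrC ler_pdivlMr // mulrC.
    by move: y1; rewrite wE invrK mulrC.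
  have yx2 : x <= U / y * (1 + low / U).
    rewrite xE mulrAC ler_pdivlMr // ler_pdivrMl //.
    move: y2; rewrite wE invrK Uinv => y2.
    by apply: le_trans y2 _; rewrite mulrA.
  apply: (@wp_asg_eq _ _ _ (U / y)); [by rewrite /= gt_eqF|by rewrite /= hU4|].
  split; first by move: t1l t2l t3l t4l W1; clear; rewrite /=; lia.
  have x0 : 0 < x by rewrite xE invr_gt0.
  rewrite /upd /=; apply: approx_inrange => //.
  - rewrite xE -[U]invrK lef_pV2 ?posrE ?invr_gt0 // -wE.
    by move: zw1; rewrite ler_pdivlMr // mul1r.
  - by rewrite divr_ge0 // ltW.
  - by rewrite ler_pdivrMr // -[X in X <= _]mulr1; apply: ler_wpM2l => //; exact: ltW.
  - by right; rewrite yx yx2.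
have wE : w = low by rewrite /w /inv leNgt ginv_.
have xE : x = z by rewrite hx /inv leNgt ginv_.
rewrite wE in zw1 zw2 y1 y2.
have xU : x <= U.
  by move: zw2; rewrite xE ler_pdivlMr // mulrAC divff // mul1r || rewrite xE ler_pdivrMr // divfK.
have xy : x <= low * y by move: y1; rewrite xE ler_pdivrMr // mulrC.
have yx : low * y <= x * (1 + low / U).
  have := ler_wpM2l (ltW low0) y2.
  by rewrite mulrA [low * (z / low)]mulrC divfK // Uinv xE.
have x0 : 0 < x by rewrite xE.
(* Unlike [U / y], the value [low * y] approximates [x] from above and may leave the interval; then
   [U] lies between the two and is output instead. *)
apply: wp_if => // gU; rewrite /= hU4 hL4 -/y in gU.
  apply: (@wp_asg_eq _ _ _ (low * y)) => //; first by rewrite /= hL4.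
  split; first by move: t1l t2l t3l t4l W1; clear; rewrite /=; lia.
  rewrite /upd /=; apply: approx_inrange => //.
  - by rewrite mulr_ge0 // ltW.
  - by rewrite -subr_ge0.
  - by left; rewrite xy yx.
apply: (@wp_asg_eq _ _ _ U) => //.
split; first by move: t1l t2l t3l t4l W1; clear; rewrite /=; lia.
rewrite /upd /=; apply: approx_inrange => //; first exact: ltW.
by left; rewrite xU /=; apply: le_trans yx; rewrite -subr_le0 ltW.
Qed.

Lemma outputs_frame s s' zs : (size zs <= 3)%N ->
  (forall k, k \in [:: 8; 9; 10; 11]%N -> s' k = s k) -> outputs s zs -> outputs s' zs.
Proof.
move=> zs3 h [h1 h2]; split; first by rewrite h.
rewrite {1}h2; apply/eq_in_map => i; rewrite mem_iota add0n => /= ilt.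
by rewrite h //; move: ilt zs3; clear; rewrite !inE; lia.
Qed.

Definition outputs_for s (rs : seq R) := exists zs,
  [/\ outputs s zs, size zs = size rs, (forall y, y \in zs -> 0 <= y <= U)
    & forall x, x \in rs -> exists2 y, y \in zs & `|x - y| < eps].

Lemma wp_append s x rs : (size rs <= 2)%N -> outputs_for s rs -> approximates x (s tx) ->
  wp append_cmd s (fun t s' => (t <= 40)%N /\
    outputs_for s' (if x <= U then rcons rs x else rs)).
Proof.
move=> rs2 [zs [[hcnt hzs] szz zsU zsx]] ap.
case: ap => [[Ux y1]|[xU y0 yU xy]].
  apply: wp_if => // g0; first by rewrite /= y1 oppr_ge0 ler10 in g0.
  apply: wp_skip; split=> //; rewrite leNgt Ux /=.
  by exists zs; split.
apply: wp_if => // g0; last by move: g0; rewrite /= ltNge y0.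
rewrite xU; apply/wp_seq.
have hcnt' : s rcnt = (size rs)%:R by rewrite hcnt szz.
apply: (@wp_conseq _ _ _ (fun t s' => (t <= 30)%N /\
   s' = upd s (9 + size rs)%N (s tx))).
  apply: wp_if => // g1; rewrite /= hcnt' sub0r ?oppr_ge0 ?oppr_lt0 ?ltr0n ?lern0 in g1.
    by apply: wp_asg => //; move: g1 => /eqP->.
  apply: wp_if => // g2; rewrite /= hcnt' ?subr_ge0 ?subr_lt0 ?lern1 ?ltr1n in g2.
    apply: wp_asg => //; split=> //; congr upd.
    by move: g1 g2; clear; lia.
  apply: wp_asg => //; split=> //; congr upd.
  by move: g2 rs2; clear; lia.
move=> t1 s1 _ [t1l ->].
have ne k : (k < 9)%N -> (k == 9 + size rs)%N = false.
  by move=> k9; apply/negbTE; move: k9; clear; lia.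
apply: (@wp_asg_eq _ _ _ (size rs).+1%:R) => //.
  by rewrite /= /upd ne // hcnt' natr1.
split; first by move: t1l; clear; rewrite /=; lia.
exists (rcons zs (s tx)); split.
- split; first by rewrite size_rcons szz.
  rewrite size_rcons szz -[in X in iota 0 X]addn1 iotaD map_cat /= cats1; congr rcons.
    rewrite {1}hzs szz; apply/eq_in_map => i; rewrite mem_iota add0n => /= ilt.
    rewrite /upd gtn_eqF ?leq_addr // eqn_add2l ltn_eqF //.
  by rewrite add0n /upd gtn_eqF ?leq_addr // eqxx.
- by rewrite !size_rcons szz.
- by move=> y; rewrite mem_rcons inE => /orP[/eqP->|/zsU//]; rewrite y0 yU.
- move=> x'; rewrite mem_rcons inE => /orP[/eqP->|/zsx[y yz xy']].
    by exists (s tx) => //; rewrite mem_rcons inE eqxx.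
  by exists y => //; rewrite mem_rcons inE yz orbT.
Qed.

Definition opt_filter (P : pred R) (rs : seq R) (o : option R) :=
  if o is Some x then if P x then rcons rs x else rs else rs.

Lemma outputs_for_frame s s' rs : (forall k, k \in [:: 8; 9; 10; 11]%N -> s' k = s k) ->
  (size rs <= 3)%N -> outputs_for s rs -> outputs_for s' rs.
Proof.
move=> h rs3 [zs [h1 h2 h3 h4]]; exists zs; split=> //.
by apply: outputs_frame h h1; rewrite h2.
Qed.

Lemma wp_branch_approx s o rs : (size rs <= 2)%N -> outputs_for s rs ->
  has_range s -> slot L M s 20 o ->
  wp branch_approx_cmd s (fun t s' => (t <= L.+1 * (L + kap).+1 * (4 * 4100))%N /\
    outputs_for s' (opt_filter (fun x => x <= U) rs o)).
Proof.
move=> rs2 out hr; case: o => [x|] sl /=.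
  have W1 : (0 < L.+1 * (L + kap).+1)%N by [].
  apply: wp_if => // g0; last by move: g0; rewrite /= (sl.1) ltr10.
  apply/wp_seq; apply: wp_conseq (wp_approx hr sl) _ => t1 s1 fr1 [t1l ap].
  have out1 : outputs_for s1 rs.
    apply: outputs_for_frame out; last exact: leqW.
    by move=> k; rewrite !inE => /or4P[] /eqP->; rewrite fr1.
  apply: wp_conseq (wp_append rs2 out1 ap) _ => t2 s2 _ [t2l out2]; split=> //.
  by move: t1l t2l W1; clear; rewrite /=; lia.
apply: wp_if => // g0; first by move: g0; rewrite /= sl oppr_ge0 ler10.
by apply: wp_skip; split=> //; rewrite !mulnS; clear; lia.
Qed.

Lemma wp_copy s o : slot L M s 30 o ->
  wp copy_cmd s (fun t s' => (t <= 40)%N /\ slot L M s' 20 o).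
Proof.
move=> sl.
apply/wp_seq/(@wp_asg_eq _ _ _ (s 30%N)); [by []|by []|].
apply/wp_seq/(@wp_asg_eq _ _ _ (s 31%N)); [by []|by []|].
apply/wp_seq/(@wp_asg_eq _ _ _ (s 32%N)); [by []|by []|].
apply/wp_seq/(@wp_asg_eq _ _ _ (s 33%N)); [by []|by []|].
apply/wp_seq/(@wp_asg_eq _ _ _ (s 34%N)); [by []|by []|].
apply/wp_seq/(@wp_asg_eq _ _ _ (s 35%N)); [by []|by []|].
apply: (@wp_asg_eq _ _ _ (s 36%N)); [by []|by []|].
by split.
Qed.

End Approx.

(** * Normal form of a trinomial *)

Notation a0r := 3%N (only parsing).
Notation a1r := 4%N (only parsing).
Notation a2r := 5%N (only parsing).

(** The input exponents may coincide. Since only signs can be tested, an equality [u = v] is tested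
    as [- (u - v)^2 >= 0]. *)
Definition merge_cmd (i j : nat) : cmd :=
  (If (N 0 - (V (3 + i) - V (3 + j)) * (V (3 + i) - V (3 + j)))
     (i ::= V i + V j;; j ::= N 0) Skip)%C.
Definition swap_cmd (i j : nat) : cmd :=
  (tx ::= V i;; i ::= V j;; j ::= V tx;;
   tx ::= V (3 + i);; (3 + i)%N ::= V (3 + j);; (3 + j)%N ::= V tx)%C.
Definition sort_cmd (i j : nat) : cmd :=
  (If (N 0 - V j * V j) Skip
     (If (N 0 - V i * V i) (swap_cmd i j)
        (If (V (3 + j) - V (3 + i)) Skip (swap_cmd i j))))%C.
Definition norm_cmd : cmd :=
  (merge_cmd 0 1;; merge_cmd 0 2;; merge_cmd 1 2;;
   sort_cmd 0 1;; sort_cmd 1 2;; sort_cmd 0 1;;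
   If (N 0 - c2r * c2r)
     (r_a ::= N 0;; If (N 0 - c1r * c1r) (r_b ::= N 0) (r_b ::= a1r - a0r);;
      c2r ::= c1r;; c1r ::= N 0)
     (r_a ::= a1r - a0r;; r_b ::= a2r - a0r))%C.

Section Norm.
Variable R : realType.
Implicit Types (s : mstate R) (t u v : R * nat).

Definition merge_terms t u :=
  if t.2 == u.2 then ((t.1 + u.1, t.2), (0, u.2)) else (t, u).
Definition sort_terms t u :=
  if u.1 == 0 then (t, u) else if t.1 == 0 then (u, t) else
  if (t.2 <= u.2)%N then (t, u) else (u, t).

Definition term_poly t : {poly R} := t.1 *: 'X^(t.2).
Definition separated t u := [|| t.1 == 0, u.1 == 0 | t.2 != u.2].
(* Terms with a zero coefficient come last. *)
Definition precedes t u := (u.1 != 0) ==> ((t.1 != 0) && (t.2 < u.2)%N).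

Definition has_term s (i : nat) (t : R * nat) := s i = t.1 /\ s (3 + i)%N = t.2%:R.

Lemma wp_merge i j s t u (k : nat) v : (i < j < 3)%N -> (k < 3)%N -> k != i -> k != j ->
  has_term s i t -> has_term s j u -> has_term s k v ->
  wp (merge_cmd i j) s (fun n s' => (n <= 50)%N /\
    [/\ has_term s' i (merge_terms t u).1, has_term s' j (merge_terms t u).2 & has_term s' k v]).
Proof.
move=> ij3 k3 ki kj [ti1 ti2] [tj1 tj2] [tk1 tk2].
have E : s (3 + i)%N - s (3 + j)%N = 0 <-> t.2 == u.2.
  rewrite ti2 tj2; split=> [/eqP|/eqP->]; last by rewrite subrr.
  by rewrite subr_eq0 eqr_nat.
have sq (r : R) : (0 <= 0 - r * r) = (r == 0).
  by rewrite sub0r oppr_ge0 -expr2 real_exprn_even_le0 // num_real.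
apply: wp_if => //.
  rewrite [eval _ _]/= sq => /eqP/E e.
  apply/wp_seq/wp_asg => //; apply: wp_asg => //; split=> //.
  rewrite /merge_terms e /has_term.
  have ne : (i != j) && (3 + i != i)%N && (3 + i != j)%N && (3 + j != i)%N && (3 + j != j)%N
     && (3 + k != i)%N && (3 + k != j)%N by move: ij3 k3; clear; lia.
  move: ne; do 6! (case/andP); move=> n1 n2 n3 n4 n5 n6 n7.
  rewrite /upd eqxx (negbTE n1) (negbTE n2) (negbTE n3) (negbTE n4) (negbTE n5) (negbTE n6) (negbTE n7).
  by rewrite (negbTE ki) (negbTE kj) eqxx /= ti1 tj1.
rewrite [eval _ _]/= ltNge sq => ne.
apply: wp_skip; split=> //; rewrite /merge_terms ifN //; apply: contra ne => /E->//.
Qed.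

Lemma wp_swap i j s t u (k : nat) v : (i < j < 3)%N -> (k < 3)%N -> k != i -> k != j ->
  has_term s i t -> has_term s j u -> has_term s k v ->
  wp (swap_cmd i j) s (fun n s' => (n <= 50)%N /\
    [/\ has_term s' i u, has_term s' j t & has_term s' k v]).
Proof.
move=> ij3 k3 ki kj [ti1 ti2] [tj1 tj2] [tk1 tk2].
have [[e1 e2 e3]|[e1 e2 e3]|[e1 e2 e3]] : [\/ [/\ i = 0%N, j = 1%N & k = 2%N],
    [/\ i = 0%N, j = 2%N & k = 1%N] | [/\ i = 1%N, j = 2%N & k = 0%N]].
- move: ij3 k3 ki kj; clear; case: i j k => [|[|[|i]]] [|[|[|j]]] [|[|[|k]]] // *;
    first [by constructor 1|by constructor 2|by constructor 3|lia].
all: subst i j k; do 5! [apply/wp_seq/wp_asg => //]; apply/wp_asg => //; split=> //; split; by split.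
Qed.

Lemma wp_sort i j s t u (k : nat) v : (i < j < 3)%N -> (k < 3)%N -> k != i -> k != j ->
  has_term s i t -> has_term s j u -> has_term s k v ->
  wp (sort_cmd i j) s (fun n s' => (n <= 100)%N /\
    [/\ has_term s' i (sort_terms t u).1, has_term s' j (sort_terms t u).2 & has_term s' k v]).
Proof.
move=> ij3 k3 ki kj hi hj hk.
have [ti1 ti2] := hi; have [tj1 tj2] := hj.
have sq (r : R) : (0 <= 0 - r * r) = (r == 0).
  by rewrite sub0r oppr_ge0 -expr2 real_exprn_even_le0 // num_real.
rewrite /sort_terms.
apply: wp_if => //.
  by rewrite [eval _ _]/= tj1 sq => ->; apply: wp_skip.
rewrite [eval _ _]/= tj1 ltNge sq => /negbTE->.
have W := wp_swap ij3 k3 ki kj hi hj hk.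
apply: wp_if => //.
  rewrite [eval _ _]/= ti1 sq => ->.
  by apply: wp_conseq W _ => n s' _ [nl H]; split=> //; move: nl; clear; rewrite /=; lia.
rewrite [eval _ _]/= ti1 ltNge sq => /negbTE->.
apply: wp_if => //.
  by rewrite [eval _ _]/= ti2 tj2 subr_ge0 ler_nat => ->; apply: wp_skip.
rewrite [eval _ _]/= ti2 tj2 subr_lt0 ltr_nat ltnNge => /negbTE->.
by apply: wp_conseq W _ => n s' _ [nl H]; split=> //; move: nl; clear; rewrite /=; lia.
Qed.

Lemma merge_allP t0 t1 t2 (p := merge_terms t0 t1) (q := merge_terms p.1 t2)
    (r := merge_terms p.2 q.2) :
  term_poly q.1 + term_poly r.1 + term_poly r.2 = term_poly t0 + term_poly t1 + term_poly t2
  /\ [/\ separated q.1 r.1, separated q.1 r.2 & separated r.1 r.2].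
Proof.
rewrite /r /q /p; clear r q p; rewrite /merge_terms /separated /term_poly.
case: t0 t1 t2 => [c0 e0] [c1 e1] [c2 e2] /=.
case: (eqVneq e0 e1) => [<-|e01] /=; case: (eqVneq e0 e2) => [<-|e02] /=;
  rewrite ?eqxx /= ?e01 ?e02 ?(negbTE e01) ?(negbTE e02) ?scale0r ?scalerDl ?addr0 ?add0r ?eqxx ?orbT /= ?orbT;
  rewrite 1?[e1 == e0]eq_sym ?(negbTE e01) /= ?eqxx ?orbT.
- by rewrite !scale0r !addr0.
- by [].
- by rewrite scale0r addr0 addrAC.
- case: (eqVneq e1 e2) => [<-|e12] /=; rewrite ?e01 ?e02 ?e12 ?eqxx ?orbT //.
  by rewrite scale0r addr0 scalerDl !addrA.
Qed.

Lemma sort_termsP t u (p := sort_terms t u) : separated t u ->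
  precedes p.1 p.2 /\ (p = (t, u) \/ p = (u, t)).
Proof.
rewrite /p; clear p; rewrite /sort_terms /separated /precedes.
case: (eqVneq u.1 0) => [e|un] /=; first by rewrite e eqxx /=; split=> //; left.
case: (eqVneq t.1 0) => [e|tn] /=; first by rewrite e eqxx; split=> //; right.
case: (leqP t.2 u.2) => [le|lt] /= ne; split; rewrite ?un ?tn /=.
- by rewrite ltn_neqAle ne.
- by left.
- by [].
- by right.
Qed.

Lemma precedes_trans t u v : precedes t u -> precedes u v -> precedes t v.
Proof.
rewrite /precedes => /implyP h1 /implyP h2; apply/implyP => /h2 /andP[/h1 /andP[-> tu] uv].
exact: ltn_trans uv.
Qed.

Lemma precedes_separated t u : precedes t u -> separated t u.
Proof.
rewrite /precedes /separated; case: (eqVneq u.1 0) => [_|_ /= /andP[_ lt]].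
  by rewrite orbT.
by rewrite ltn_eqF // !orbT.
Qed.

Lemma sort_allP t0 t1 t2 (p := sort_terms t0 t1) (q := sort_terms p.2 t2)
    (r := sort_terms p.1 q.1) :
  [/\ separated t0 t1, separated t0 t2 & separated t1 t2] ->
  term_poly r.1 + term_poly r.2 + term_poly q.2 = term_poly t0 + term_poly t1 + term_poly t2
  /\ (precedes r.1 r.2 /\ precedes r.2 q.2).
Proof.
move=> [s01 s02 s12]; rewrite /r /q; clear r q; have := sort_termsP s01; rewrite -/p.
clearbody p; move: p => [u0 u1] /= [p01 pE].
have u12 : separated u1 t2 by case: pE => [[_ ->]|[_ ->]].
have u02 : separated u0 t2 by case: pE => [[-> _]|[-> _]].
have := sort_termsP u12; case: (sort_terms u1 t2) => v1 v2 /= [p12 vE].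
have p02 : precedes u0 v2.
  case: vE p12 => [[-> ->]|[-> ->]] p12; [exact: precedes_trans p01 p12|exact: p01].
have s01' : separated u0 v1.
  by case: vE => [[-> _]|[-> _]] //; exact: precedes_separated.
have := sort_termsP s01'; case: (sort_terms u0 v1) => w0 w1 /= [pw wE].
split; last first.
  by split=> //; case: wE => [[_ ->]|[_ ->]].
case: pE wE vE => [[-> ->]|[-> ->]] [[-> ->]|[-> ->]] [[-> ->]|[-> ->]] //;
  ring.
Qed.

Definition has_terms s t0 t1 t2 := [/\ has_term s 0 t0, has_term s 1 t1 & has_term s 2 t2].

Lemma wp_norm_terms s t0 t1 t2 (c : cmd) Q : has_terms s t0 t1 t2 ->
  (forall n s' u0 u1 u2, (n <= 450)%N -> has_terms s' u0 u1 u2 ->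
     term_poly u0 + term_poly u1 + term_poly u2 = term_poly t0 + term_poly t1 + term_poly t2 ->
     precedes u0 u1 -> precedes u1 u2 ->
     wp c s' (fun m s2 => Q (n + m)%N s2)) ->
  wp (merge_cmd 0 1;; merge_cmd 0 2;; merge_cmd 1 2;;
   sort_cmd 0 1;; sort_cmd 1 2;; sort_cmd 0 1;; c)%C s Q.
Proof.
move=> [h0 h1 h2] H.
have [sum1 sep] := merge_allP t0 t1 t2.
apply: wp_seq; apply: wp_conseq (wp_merge (i := 0) (j := 1) (k := 2) _ _ _ _ h0 h1 h2) _ => //.
move=> n1 s1 _ [n1l [h10 h11 h12]]; move: h10 h11 sum1 sep.
case: (merge_terms t0 t1) => u0 u1 /= h10 h11 sum1 sep.
apply: wp_seq; apply: wp_conseq (wp_merge (i := 0) (j := 2) (k := 1) _ _ _ _ h10 h12 h11) _ => //.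
move=> n2 s2 _ [n2l [h20 h22 h21]]; move: h20 h22 sum1 sep.
case: (merge_terms u0 t2) => v0 v2 /= h20 h22 sum1 sep.
apply: wp_seq; apply: wp_conseq (wp_merge (i := 1) (j := 2) (k := 0) _ _ _ _ h21 h22 h20) _ => //.
move=> n3 s3 _ [n3l [h31 h32 h30]]; move: h31 h32 sum1 sep.
case: (merge_terms u1 v2) => w1 w2 /= h31 h32 sum1 sep.
have S := sort_allP sep; rewrite sum1 in S.
apply: wp_seq; apply: wp_conseq (wp_sort (i := 0) (j := 1) (k := 2) _ _ _ _ h30 h31 h32) _ => //.
move=> n4 s4 _ [n4l [h40 h41 h42]]; move: h40 h41 S.
case: (sort_terms v0 w1) => x0 x1 /= h40 h41 S.
apply: wp_seq; apply: wp_conseq (wp_sort (i := 1) (j := 2) (k := 0) _ _ _ _ h41 h42 h40) _ => //.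
move=> n5 s5 _ [n5l [h51 h52 h50]]; move: h51 h52 S.
case: (sort_terms x1 w2) => y1 y2 /= h51 h52 S.
apply: wp_seq; apply: wp_conseq (wp_sort (i := 0) (j := 1) (k := 2) _ _ _ _ h50 h51 h52) _ => //.
move=> n6 s6 _ [n6l [h60 h61 h62]]; move: h60 h61 S.
case: (sort_terms x0 y1) => z0 z1 /= h60 h61 [sum2 [p1 p2]].
have nl : (n1 + n2 + n3 + n4 + n5 + n6 <= 450)%N.
  by move: n1l n2l n3l n4l n5l n6l; clear; lia.
apply: wp_conseq (H _ s6 z0 z1 y2 nl _ sum2 p1 p2) _ => // m s' _.
by rewrite !addnA.
Qed.

Lemma term_poly_horner t x : (term_poly t).[x] = t.1 * x ^+ t.2.
Proof. by rewrite /term_poly hornerZ hornerXn. Qed.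

Lemma term_poly_coef t n : (term_poly t)`_n = t.1 * (n == t.2)%:R.
Proof. by rewrite /term_poly coefZ coefXn. Qed.

Lemma term_poly0 t : t.1 = 0 -> term_poly t = 0.
Proof. by rewrite /term_poly => ->; rewrite scale0r. Qed.

Definition normalized (f : {poly R}) (L : nat) s := exists k d0 d1 d2 a b,
  [/\ s a0r = k%:R, has_normal d0 d1 d2 a b s, normal_form d0 d1 d2 a b L
    & forall x, f.[x] = x ^+ k * g3 d0 d1 d2 a b x].

Lemma wp_norm s (c0 c1 c2 : R) (a0 a1 a2 : nat) (f := trinom c0 c1 c2 a0 a1 a2) L :
  f != 0 -> ((size f).-1 < 2 ^ L)%N ->
  s 0%N = c0 -> s 1%N = c1 -> s 2%N = c2 -> s 3%N = a0%:R -> s 4%N = a1%:R -> s 5%N = a2%:R ->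
  wp norm_cmd s (fun n s' => (n <= 600)%N /\ normalized f L s').
Proof.
move=> f0 fL h0 h1 h2 h3 h4 h5.
(* The exponents of vanishing or cancelling input terms may exceed the degree; only those with a
   nonzero coefficient in [f] are bounded by it. *)
have bnd n : f`_n != 0 -> (n < 2 ^ L)%N.
  move=> fn; apply: leq_ltn_trans fL; rewrite -ltnS prednK ?size_poly_gt0 //.
  by rewrite ltnNge; apply: contra fn => /leq_sizeP ->.
apply: (@wp_norm_terms _ (c0, a0) (c1, a1) (c2, a2)) => //.
move=> n s1 [d0 e0] [d1 e1] [d2 e2] nl [[t00 t01] [t10 t11] [t20 t21]] /= sumE p01 p12.
have {}sumE : f = term_poly (d0, e0) + term_poly (d1, e1) + term_poly (d2, e2) by rewrite sumE.
rewrite /precedes /= in p01 p12; rewrite /= in t00 t01 t10 t11 t20 t21.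
have d0N : d0 != 0.
  apply/eqP => d00; rewrite d00 eqxx implybF negbK in p01.
  rewrite p01 implybF negbK in p12; move: f0.
  by rewrite sumE !term_poly0 ?addr0 ?eqxx //= ?(eqP p01) ?(eqP p12).
have fc m : f`_m = d0 * (m == e0)%:R + d1 * (m == e1)%:R + d2 * (m == e2)%:R.
  by rewrite sumE !coefD !term_poly_coef.
have fx x : f.[x] = d0 * x ^+ e0 + d1 * x ^+ e1 + d2 * x ^+ e2.
  by rewrite sumE !hornerD !term_poly_horner.
clearbody f.
have sq (r : R) : (0 <= 0 - r * r) = (r == 0).
  by rewrite sub0r oppr_ge0 -expr2 real_exprn_even_le0 // num_real.
have L0 : (0 < 2 ^ L)%N by rewrite expn_gt0.
have xp x i j : (i <= j)%N -> x ^+ j = x ^+ i * x ^+ (j - i) :> R.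
  by move=> ij; rewrite -exprD subnKC.
apply: wp_if => // hc2; rewrite /= t20 ?ltNge sq in hc2.
  rewrite (eqP hc2) in fc fx.
  apply/wp_seq/(@wp_asg_eq _ _ _ 0) => //; apply: wp_seq.
  apply: wp_if => // hc1; rewrite /= /upd /= t10 ?ltNge sq in hc1.
    apply: (@wp_asg_eq _ _ _ 0) => //.
    apply/wp_seq/(@wp_asg_eq _ _ _ 0) => //; first by rewrite /= /upd /= t10 (eqP hc1).
    apply: (@wp_asg_eq _ _ _ 0) => //; split; first by move: nl; clear; rewrite /=; lia.
    exists e0, d0, 0, 0, 0%N, 0%N; split=> //.
      by rewrite /normal_form eqxx.
    by move=> x; rewrite fx (eqP hc1) /g3; ring.
  have /andP[_ e01] := implyP p01 hc1.
  apply: (@wp_asg_eq _ _ _ (e1 - e0)%N%:R) => //.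
    by rewrite /= /upd /= t01 t11 natrB // ltnW.
  apply/wp_seq/(@wp_asg_eq _ _ _ d1) => //.
  apply: (@wp_asg_eq _ _ _ 0) => //; split; first by move: nl; clear; rewrite /=; lia.
  exists e0, d0, 0, d1, 0%N, (e1 - e0)%N; split=> //.
    split=> //; first by rewrite subn_gt0.
      by rewrite eqxx.
    apply: leq_ltn_trans (leq_subr _ _) _; apply: bnd.
    by rewrite fc (gtn_eqF e01) eqxx mulr0 mul0r add0r addr0 mulr1.
  by move=> x; rewrite fx (xp x e0 e1 (ltnW e01)) /g3; ring.
have /andP[d1N e12] := implyP p12 hc2.
have /andP[_ e01] := implyP p01 d1N.
have e02 := ltn_trans e01 e12.
apply/wp_seq/(@wp_asg_eq _ _ _ (e1 - e0)%N%:R) => //.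
  by rewrite /= t01 t11 natrB // ltnW.
apply: (@wp_asg_eq _ _ _ (e2 - e0)%N%:R) => //.
  by rewrite /= /upd /= t01 t21 natrB // ltnW.
split; first by move: nl; clear; rewrite /=; lia.
exists e0, d0, d1, d2, (e1 - e0)%N, (e2 - e0)%N; split=> //.
  split=> //; first by rewrite subn_gt0.
  - by rewrite leq_sub2r // ltnW.
  - by split=> //; rewrite subn_gt0 e01 ltn_sub2r.
  apply: leq_ltn_trans (leq_subr _ _) _; apply: bnd.
  by rewrite fc (gtn_eqF e02) (gtn_eqF e12) eqxx !mulr0 !add0r mulr1.
by move=> x; rewrite fx (xp x e0 e1 (ltnW e01)) (xp x e0 e2 (ltnW e02)) /g3; ring.
Qed.

End Norm.

(** * Counting the roots in an interval *)

Notation r_lo := 6%N (only parsing).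
Notation r_hi := 7%N (only parsing).
Notation r_fl := 8%N (only parsing).
Notation r_fr := 9%N (only parsing).
Notation r_cnt := 10%N (only parsing).
Notation tc := 45%N (only parsing).
Notation sg := 46%N (only parsing).
Notation sg1 := 47%N (only parsing).

Definition sign_cmd (e : expr) (k : nat) : cmd :=
  (If e (If (N 0 - e) (k ::= N 0) (k ::= N 1)) (k ::= N 0 - N 1))%C.
Definition compare_cmd : cmd :=
  (If (N 0 - tc) (sg ::= N 1)
    (If ginv (tx ::= N 1 / tc) (tx ::= V tc);;
     load_cmd;; rX ::= V tx;; eval_cmd;;
     If rD (sign_cmd (N 0 - rh) sg) (sg ::= N 1);;
     If ginv (sg ::= N 0 - sg) Skip))%C.
(** A sign takes the values -1, 0 and 1, so the single test that sign plus flag is at least 1 covers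
    closed and open endpoints alike. *)
Definition tally_cmd : cmd :=
  (If (sg1 + r_fl - N 1) (If (r_fr - sg - N 1) (r_cnt ::= r_cnt + N 1) Skip) Skip)%C.
Definition branch_count_cmd : cmd :=
  (If gact (tc ::= V r_lo;; compare_cmd;; sg1 ::= V sg;; tc ::= V r_hi;; compare_cmd;; tally_cmd)
     Skip)%C.
Definition count_positive_cmd : cmd :=
  (setup_cmd;; branch_count_cmd;; copy_cmd;; branch_count_cmd)%C.
Definition count_zero_cmd : cmd :=
  (If (a0r - N 1)
     (sign_cmd (N 0 - r_lo) sg1;; sign_cmd (N 0 - r_hi) sg;; tally_cmd) Skip)%C.
(** Replaces [x] by [- x], to count negative roots as positive ones; the endpoints are negated and
    exchanged, together with their flags. *)
Definition reflect_cmd : cmd :=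
  (rPx ::= N 0 - N 1;; rPn ::= r_a;; pow_cmd;; c1r ::= c1r * rPo;;
   rPx ::= N 0 - N 1;; rPn ::= r_b;; pow_cmd;; c2r ::= c2r * rPo;;
   tx ::= V r_lo;; r_lo ::= N 0 - r_hi;; r_hi ::= N 0 - tx;;
   tx ::= V r_fl;; r_fl ::= V r_fr;; r_fr ::= V tx)%C.
Definition count_cmd : cmd :=
  (norm_cmd;; r_cnt ::= N 0;; count_zero_cmd;; count_positive_cmd;;
   reflect_cmd;; count_positive_cmd)%C.

Section Count.
Variable R : realType.
Implicit Types (s : mstate R) (x y z : R).

Lemma wp_sign e k s r : edef s e -> eval s e = r ->
  wp (sign_cmd e k) s (fun n s' => (n <= 2 * ecost e + 10)%N /\ s' k = Num.sg r).
Proof.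
move=> de er.
apply: wp_if => // g; rewrite er in g.
  apply: wp_if => // g1; rewrite /= er sub0r ?oppr_ge0 ?oppr_lt0 in g1.
    have -> : r = 0 by apply/eqP; rewrite eq_le g g1.
    apply: wp_asg => //; rewrite /= /upd eqxx sgr0; split=> //; clear; lia.
  apply: wp_asg => //; rewrite /= /upd eqxx gtr0_sg //; split=> //; clear; lia.
apply: wp_asg => //; rewrite /= /upd eqxx ltr0_sg // sub0r; split=> //; clear; lia.
Qed.

Lemma sgr_sub_inv z c : 0 < z -> 0 < c -> Num.sg (z^-1 - c) = - Num.sg (z - c^-1).
Proof.
move=> z0 c0; have zN : z != 0 by rewrite gt_eqF. have cN : c != 0 by rewrite gt_eqF.
have -> : z^-1 - c = (c / z) * (c^-1 - z) by field; rewrite cN zN.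
by rewrite sgrM gtr0_sg ?divr_gt0 // mul1r -opprB sgrN.
Qed.

(** The comparison of a root with an endpoint is exact although the root is never computed: one
    evaluation of [h] and [h'] decides it, so no root separation bound enters the count. *)
Variables (L : nat) (M : R).

Lemma wp_compare s x c : slot L M s 20 (Some x) -> s tc = c ->
  wp compare_cmd s (fun n s' => (n <= L.+1 * 400)%N /\ s' sg = Num.sg (x - c)).
Proof.
move=> [_ [A [B [C [m [l [z [hf0 bz [mL lL mlL] MlM hinv]]]]]]]] hc.
have hf : has_rec A B C m l s by [].
have z0 : 0 < z by case: bz => _ [].
have x0 : 0 < x by case: hinv => [] [_ ->]; rewrite ?invr_gt0.
apply: wp_if => // g; rewrite /= hc sub0r ?oppr_ge0 ?oppr_lt0 in g.
  apply: (@wp_asg_eq _ _ _ 1); [by []|by []|split; first by clear; rewrite /=; lia].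
  by rewrite /upd /= gtr0_sg // subr_gt0; exact: le_lt_trans x0.
pose inv := 0 <= s ginv.
pose y := if inv then c^-1 else c.
have y0 : 0 < y by rewrite /y; case: ifP; rewrite ?invr_gt0.
have hx : Num.sg (x - c) = if inv then - Num.sg (z - y) else Num.sg (z - y).
  rewrite /y /inv; case: hinv => [] [-> ->]; rewrite ?oppr_ge0 ?ler10 ?ler01 //.
  exact: sgr_sub_inv.
apply/wp_seq; apply: (@wp_conseq _ _ _ (fun n s' => (n <= 20)%N /\ s' tx = y)).
  apply: wp_if => //=; rewrite /y /inv => hi_.
    by apply: (@wp_asg_eq _ _ _ c^-1); rewrite /= ?hc ?gt_eqF ?div1r ?hi_.
  by apply: (@wp_asg_eq _ _ _ c) => //; rewrite leNgt hi_.
move=> n1 s1 f1 [n1l hx1].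
have hf1 : has_rec A B C m l s1 by case: hf; rewrite /has_rec !f1.
apply/wp_seq; apply: wp_conseq (wp_load hf1) _ => n2 s2 f2 [n2l hf2].
apply/wp_seq/(@wp_asg_eq _ _ _ y) => //; first by rewrite /= f2.
apply: (@wp_eval_seq _ A B C m l L mL lL _ y) => //; first by rewrite gt_eqF.
move=> n3 s3 f3 n3l hh hD.
have hi3 : s3 ginv = s ginv by rewrite f3 // /upd /= f2 // f1.
have [d1 d2 d3 d4] := branch_cmp bz y0.
apply/wp_seq; apply: (@wp_conseq _ _ _ (fun n s' => (n <= 40)%N /\ s' sg = Num.sg (z - y))).
  apply: wp_if => // g0; rewrite /= hD in g0.
    apply: wp_conseq (@wp_sign (N 0 - rh)%E sg s3 (- hfun A B C m l y) _ _) _ => //.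
      by rewrite /= hh sub0r.
    move=> n s' _ [nl ->]; split; first by move: nl; clear; rewrite /=; lia.
    rewrite sgrN; case: (ltrgt0P (hfun A B C m l y)) => h0.
    - by rewrite gtr0_sg // ltr0_sg // subr_lt0 d4.
    - by rewrite [in LHS]ltr0_sg // opprK gtr0_sg // subr_gt0 d2.
    - by rewrite h0 (d3 g0 h0) subrr sgr0 oppr0.
  apply: (@wp_asg_eq _ _ _ 1) => //; split=> //.
  by rewrite /upd /= gtr0_sg // subr_gt0 d1.
move=> n4 s4 f4 [n4l hs4].
have hi4 : s4 ginv = s ginv by rewrite f4.
apply: wp_if => // gi; rewrite /= hi4 in gi.
  apply: (@wp_asg_eq _ _ _ (- Num.sg (z - y))) => //; first by rewrite /= hs4 sub0r.
  split; first by move: n1l n2l n3l n4l; clear; rewrite /=; lia.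
  by rewrite /upd /= hx /inv gi.
apply: wp_skip; split; first by move: n1l n2l n3l n4l; clear; rewrite /=; lia.
by rewrite hs4 hx /inv leNgt gi.
Qed.

Lemma sgr_nat_test (r : R) (f : bool) : (0 <= Num.sg r + (f : nat)%:R - 1) = if f then 0 <= r else 0 < r.
Proof.
case: (ltrgt0P r) => [r0|r0|->].
- by rewrite gtr0_sg // addrAC subrr add0r ler0n; case: f.
- by rewrite ltr0_sg //; case: f => /=; apply/negbTE; rewrite -ltNge; lra.
- by rewrite sgr0 add0r; case: f; rewrite /= ?subrr ?lexx // sub0r oppr_ge0 ler10.
Qed.

Lemma wp_tally s x (a b : R) (bl br : bool) (n : nat) :
  s sg1 = Num.sg (x - a) -> s sg = Num.sg (x - b) -> s r_fl = (bl : nat)%:R ->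
  s r_fr = (br : nat)%:R -> s r_cnt = n%:R ->
  wp tally_cmd s (fun t s' => (t <= 40)%N /\ s' r_cnt = (n + in_interval bl br a b x)%:R).
Proof.
move=> h1 h2 h3 h4 h5.
have la : (if bl then a <= x else a < x) = (0 <= Num.sg (x - a) + (bl : nat)%:R - 1).
  by rewrite sgr_nat_test subr_ge0 subr_gt0.
have lb : (if br then x <= b else x < b) = (0 <= (br : nat)%:R - Num.sg (x - b) - 1).
  by rewrite [_ - Num.sg _]addrC -sgrN opprB sgr_nat_test subr_ge0 subr_gt0.
rewrite /in_interval la lb.
apply: wp_if => // g0; rewrite /= h1 h3 in g0.
  rewrite g0; apply: wp_if => // g1; rewrite /= h2 h4 in g1.
    rewrite g1; apply: (@wp_asg_eq _ _ _ (n + 1)%:R) => //.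
    by rewrite /= h5 natrD.
  by apply: wp_skip; rewrite [0 <= _]leNgt g1 h5 /= !addn0.
by apply: wp_skip; rewrite [0 <= Num.sg _ + _ - _]leNgt g0 h5 /= !addn0.
Qed.

Definition has_interval (a b : R) (bl br : bool) s :=
  [/\ s r_lo = a, s r_hi = b, s r_fl = (bl : nat)%:R & s r_fr = (br : nat)%:R].

Lemma wp_branch_count s o (a b : R) bl br (n : nat) : slot L M s 20 o ->
  has_interval a b bl br s -> s r_cnt = n%:R ->
  wp branch_count_cmd s (fun t s' => (t <= L.+1 * 900)%N /\
    s' r_cnt = (n + if o is Some x then in_interval bl br a b x : nat else 0%N)%:R).
Proof.
case: o => [x|] sl [ha hb hl hr] hn; last first.
  apply: wp_if => // g0; first by move: g0; rewrite /= sl oppr_ge0 ler10.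
  by apply: wp_skip; rewrite !addn0; split; [clear; rewrite /=; lia|].
apply: wp_if => // g0; last by move: g0; rewrite /= (sl.1) ltr10.
apply/wp_seq/(@wp_asg_eq _ _ _ a) => //.
have sl1 : slot L M (upd s tc a) 20 (Some x) by [].
apply/wp_seq; apply: wp_conseq (wp_compare sl1 _) _ => //.
move=> n1 s1 f1 [n1l hs1].
apply/wp_seq/(@wp_asg_eq _ _ _ (Num.sg (x - a))) => //.
apply/wp_seq/(@wp_asg_eq _ _ _ b) => //; first by rewrite /= /upd /= f1.
have sl2 : slot L M (upd (upd s1 sg1 (Num.sg (x - a))) tc b) 20 (Some x).
  by move: sl; rewrite /slot /upd /= !f1.
apply/wp_seq; apply: wp_conseq (wp_compare sl2 _) _ => //.
move=> n2 s2 f2 [n2l hs2].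
apply: wp_conseq.
  apply: (@wp_tally _ x a b bl br n) => //; rewrite f2 // /upd /= ?f1 //.
move=> n3 s3 f3 [n3l hs3]; split=> //.
by move: n1l n2l n3l; clear; rewrite /=; lia.
Qed.

End Count.

Section CountRoots.
Variable R : realType.
Implicit Types (s : mstate R) (x y z : R).

Lemma slot_copy L (M : R) s s' k o : (forall i, (i < 7)%N -> s' (k + i)%N = s (k + i)%N) ->
  slot L M s k o -> slot L M s' k o.
Proof.
move=> h; have h0 := h 0%N isT; rewrite !addn0 in h0.
by case: o => [x|]; rewrite /slot /= ?h0 !h.
Qed.

Lemma wp_count_positive s (c0 c1 c2 : R) (a b L : nat) (u v : R) bl br (n : nat) :
  normal_form c0 c1 c2 a b L -> has_normal c0 c1 c2 a b s ->
  has_interval u v bl br s -> s r_cnt = n%:R ->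
  wp count_positive_cmd s (fun t s' => (t <= L.+1 * 3000)%N /\ exists rs,
    [/\ uniq rs, (forall x, 0 < x -> (x \in rs) = (g3 c0 c1 c2 a b x == 0)),
      all (fun x => 0 < x) rs
    & s' r_cnt = (n + count (in_interval bl br u v) rs)%:R]).
Proof.
move=> nf hn hI hc.
apply/wp_seq; apply: wp_conseq (wp_setup nf hn) _ => n1 s1 f1.
move=> [n1l [rs [hM [o1 [o2 [sl1 sl2 rsE ursE rsg]]]]]].
have hI1 : has_interval u v bl br s1 by case: hI => *; rewrite /has_interval !f1.
have hc1 : s1 r_cnt = n%:R by rewrite f1.
apply/wp_seq; apply: wp_conseq (wp_branch_count sl1 hI1 hc1) _ => n2 s2 f2 [n2l hc2].
have hI2 : has_interval u v bl br s2 by case: hI1 => *; rewrite /has_interval !f2.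
have sl2' : slot L (2 * b%:R) s2 30 o2.
  apply: slot_copy sl2 => i i7; apply: f2.
  by case: i i7 => [|[|[|[|[|[|[|i]]]]]]].
apply/wp_seq; apply: wp_conseq (wp_copy sl2') _ => n3 s3 f3 [n3l sl3].
have hI3 : has_interval u v bl br s3 by case: hI2 => *; rewrite /has_interval !f3.
have hc3 : s3 r_cnt = s2 r_cnt by rewrite f3.
rewrite hc2 in hc3.
apply: wp_conseq (wp_branch_count sl3 hI3 hc3) _ => n4 s4 f4 [n4l hc4].
split; first by move: n1l n2l n3l n4l; clear; lia.
exists rs; split=> //.
  have pos k o s' x : slot L (2 * b%:R) s' k o -> o = Some x -> 0 < x.
    case: o => // y [_ [A [B [C [m [l [z [_ [_ [z0 _ _]] _ _ hx]]]]]]]] [<-].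
    by case: hx => [] [_ ->]; rewrite ?invr_gt0.
  rewrite rsE; case: (o1) sl1 => [x|] sl1; case: (o2) sl2 => [y|] sl2 //=;
    rewrite ?andbT ?(pos _ _ _ _ sl1 erefl) ?(pos _ _ _ _ sl2 erefl) //.
rewrite hc4 rsE -addnA; congr (_ + _)%:R.
by case: (o1) => [x|]; case: (o2) => [y|] //=; rewrite ?addn0 ?add0n.
Qed.

Lemma wp_count_zero s (k n : nat) (u v : R) bl br : s a0r = k%:R ->
  has_interval u v bl br s -> s r_cnt = n%:R ->
  wp count_zero_cmd s (fun t s' => (t <= 200)%N /\
    s' r_cnt = (n + ((0 < k)%N && in_interval bl br u v 0))%:R).
Proof.
move=> hk [ha hb hl hr] hc.
apply: wp_if => // g0; rewrite /= hk ?subr_ge0 ?subr_lt0 in g0.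
  have k0 : (0 < k)%N by move: g0; rewrite ler1n.
  apply/wp_seq; apply: wp_conseq (@wp_sign _ (N 0 - r_lo)%E sg1 s (0 - u) _ _) _ => //.
    by rewrite /= ha.
  move=> n1 s1 f1 [n1l h1].
  apply/wp_seq; apply: wp_conseq (@wp_sign _ (N 0 - r_hi)%E sg s1 (0 - v) _ _) _ => //.
    by rewrite /= f1 // hb.
  move=> n2 s2 f2 [n2l h2].
  apply: wp_conseq.
    by apply: (@wp_tally _ _ 0 u v bl br n) => //; rewrite f2 // f1.
  move=> n3 s3 f3 [n3l ->]; rewrite k0; split=> //.
  by move: n1l n2l n3l; clear; rewrite /=; lia.
by apply: wp_skip; move: g0; rewrite ltr_nat ltnS leqn0 => /eqP ->; rewrite !addn0.
Qed.

Lemma wp_reflect s (c0 c1 c2 : R) (a b L : nat) (u v : R) bl br :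
  normal_form c0 c1 c2 a b L -> has_normal c0 c1 c2 a b s -> has_interval u v bl br s ->
  wp reflect_cmd s (fun t s' => (t <= L.+1 * 400)%N /\
    [/\ has_normal c0 (c1 * (-1) ^+ a) (c2 * (-1) ^+ b) a b s',
        normal_form c0 (c1 * (-1) ^+ a) (c2 * (-1) ^+ b) a b L
      & has_interval (- v) (- u) br bl s']).
Proof.
move=> nf [h0 h1 h2 ha hb] [hu hv hl hr].
have [c0N b0 ab c1N bL] := nf.
have aL : (a < 2 ^ L)%N by exact: leq_ltn_trans bL.
apply/wp_seq/(@wp_asg_eq _ _ _ (-1)); [by []|by rewrite /= sub0r|].
apply/wp_seq/(@wp_asg_eq _ _ _ a%:R) => //.
apply: (@wp_pow_seq _ _ _ _ (-1) a L) => // n1 s1 f1 n1l ho1.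
apply/wp_seq/(@wp_asg_eq _ _ _ (c1 * (-1) ^+ a)) => //.
  by rewrite /= ho1 f1 // /upd /= h1.
apply/wp_seq/(@wp_asg_eq _ _ _ (-1)); [by []|by rewrite /= sub0r|].
apply/wp_seq/(@wp_asg_eq _ _ _ b%:R) => //; first by rewrite /= /upd /= f1.
apply: (@wp_pow_seq _ _ _ _ (-1) b L) => // n2 s2 f2 n2l ho2.
have F k : k \notin mods pow_cmd -> [&& k != c1r, k != rPx & k != rPn] -> s2 k = s k.
  move=> k4 /and3P[k1 k2 k3].
  rewrite f2 // /upd (negbTE k1) (negbTE k2) (negbTE k3) f1 //.
  by rewrite /upd (negbTE k2) (negbTE k3).
apply/wp_seq/(@wp_asg_eq _ _ _ (c2 * (-1) ^+ b)) => //.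
  by rewrite /= ho2 F // h2.
apply/wp_seq/(@wp_asg_eq _ _ _ u) => //; first by rewrite /= /upd /= F.
apply/wp_seq/(@wp_asg_eq _ _ _ (- v)) => //; first by rewrite /= /upd /= F // hv sub0r.
apply/wp_seq/(@wp_asg_eq _ _ _ (- u)) => //; first by rewrite /= /upd /= sub0r.
apply/wp_seq/(@wp_asg_eq _ _ _ (bl : nat)%:R) => //; first by rewrite /= /upd /= F.
apply/wp_seq/(@wp_asg_eq _ _ _ (br : nat)%:R) => //; first by rewrite /= /upd /= F.
apply: (@wp_asg_eq _ _ _ (bl : nat)%:R) => //.
split; first by move: n1l n2l; clear; rewrite /=; lia.
have sN n : (-1) ^+ n != 0 :> R by rewrite expf_neq0 // oppr_eq0 oner_eq0.
split.
- have e1 : s2 c1r = c1 * (-1) ^+ a by rewrite f2.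
  by rewrite /has_normal /upd /= e1 (F c0r) // (F r_a) // (F r_b) // h0 ha hb; split.
- split=> //; first by rewrite mulf_eq0 negb_or => /andP[/b0].
  by rewrite !mulf_eq0 !negb_or !sN !andbT.
- by rewrite /has_interval /upd /=.
Qed.

Lemma in_interval_opp bl br (u v x : R) :
  in_interval br bl (- v) (- u) (- x) = in_interval bl br u v x.
Proof. by rewrite /in_interval !lerN2 !ltrN2 andbC. Qed.

Lemma g3_opp (c0 c1 c2 : R) (a b : nat) x :
  g3 c0 (c1 * (-1) ^+ a) (c2 * (-1) ^+ b) a b x = g3 c0 c1 c2 a b (- x).
Proof. by rewrite /g3 ![(- x) ^+ _]exprNn !mulrA. Qed.

Lemma g3_at0 (c0 c1 c2 : R) (a b L : nat) : normal_form c0 c1 c2 a b L ->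
  g3 c0 c1 c2 a b 0 != 0.
Proof.
move=> [c0N b0 ab c1N _]; suff -> : g3 c0 c1 c2 a b 0 = c0 by [].
rewrite /g3 !expr0n.
have -> : c1 * (a == 0%N)%:R = 0.
  case: (eqVneq c1 0) => [->|/c1N[_ /andP[a0 _]]]; first by rewrite mul0r.
  by rewrite gtn_eqF // mulr0.
have -> : c2 * (b == 0%N)%:R = 0.
  case: (eqVneq c2 0) => [->|/b0 b1]; first by rewrite mul0r.
  by rewrite gtn_eqF // mulr0.
by rewrite !addr0.
Qed.

(** The roots are 0, present when a power of [x] was divided out, the positive roots, and the
    reflected negative ones. A bounded number of powers is computed and nothing is searched, so the
    cost is linear in [L]. *)
Lemma wp_count s (c0 c1 c2 : R) (a0 a1 a2 : nat) (f := trinom c0 c1 c2 a0 a1 a2) L u v bl br :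
  f != 0 -> ((size f).-1 < 2 ^ L)%N ->
  s 0%N = c0 -> s 1%N = c1 -> s 2%N = c2 -> s 3%N = a0%:R -> s 4%N = a1%:R -> s 5%N = a2%:R ->
  has_interval u v bl br s ->
  wp count_cmd s (fun t s' => (t <= L.+1 * (2 * 4000))%N /\ forall rs : seq R, uniq rs ->
    (forall x, (x \in rs) = in_interval bl br u v x && root f x) -> s' r_cnt = (size rs)%:R).
Proof.
move=> f0 fL h0 h1 h2 h3 h4 h5 hI.
apply/wp_seq; apply: wp_conseq (wp_norm f0 fL h0 h1 h2 h3 h4 h5) _.
move=> n1 s1 fr1 [n1l [k [d0 [d1 [d2 [a [b [hk hn nf fE]]]]]]]].
have hI1 : has_interval u v bl br s1 by case: hI => *; rewrite /has_interval !fr1.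
apply/wp_seq/(@wp_asg_eq _ _ _ 0%N%:R) => //.
apply/wp_seq; apply: wp_conseq (@wp_count_zero _ k 0 u v bl br _ _ _) _ => //.
move=> n2 s2 fr2 [n2l hc2].
have hn2 : has_normal d0 d1 d2 a b s2 by case: hn => *; rewrite /has_normal !fr2.
have hI2 : has_interval u v bl br s2 by case: hI1 => *; rewrite /has_interval !fr2.
apply/wp_seq; apply: wp_conseq (wp_count_positive nf hn2 hI2 hc2) _.
move=> n3 s3 fr3 [n3l [rpos [urp rpE rp0 hc3]]].
have hn3 : has_normal d0 d1 d2 a b s3 by case: hn2 => *; rewrite /has_normal !fr3.
have hI3 : has_interval u v bl br s3 by case: hI2 => *; rewrite /has_interval !fr3.
apply/wp_seq; apply: wp_conseq (wp_reflect nf hn3 hI3) _.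
move=> n4 s4 fr4 [n4l [hn4 nf4 hI4]].
have hc4 : s4 r_cnt = s3 r_cnt by rewrite fr4.
rewrite hc3 in hc4.
apply: wp_conseq (wp_count_positive nf4 hn4 hI4 hc4) _.
move=> n5 s5 fr5 [n5l [rneg [urn rnE rn0 hc5]]].
split; first by move: n1l n2l n3l n4l n5l; clear; rewrite /=; lia.
move=> rs urs rsE; rewrite hc5; congr _%:R.
pose I := in_interval bl br u v.
pose zs := if (0 < k)%N then [:: 0 : R] else [::].
pose ts := zs ++ rpos ++ map -%R rneg.
have d0N : d0 != 0 by case: nf.
have g0N := g3_at0 nf.
have rt x : root f x = ((0 < k)%N && (x == 0)) || (g3 d0 d1 d2 a b x == 0).
  by rewrite /root fE mulf_eq0 expf_eq0.
have rpx x : (x \in rpos) = (0 < x) && (g3 d0 d1 d2 a b x == 0).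
  case: (ltP 0 x) => x0; first by rewrite rpE.
  by apply/negbTE/negP => /(allP rp0); rewrite ltNge x0.
have rnx x : (x \in map -%R rneg) = (x < 0) && (g3 d0 d1 d2 a b x == 0).
  rewrite -[x in LHS]opprK mem_map; last exact: oppr_inj.
  case: (ltP x 0) => x0.
    by rewrite rnE ?oppr_gt0 // g3_opp opprK.
  by apply/negbTE/negP => /(allP rn0); rewrite oppr_gt0 ltNge x0.
have zsx x : (x \in zs) = (0 < k)%N && (x == 0).
  by rewrite /zs; case: (0 < k)%N; rewrite ?inE.
have tsx x : (x \in ts) = root f x.
  rewrite !mem_cat zsx rpx rnx rt; case: (ltrgt0P x) => [||->] //=; rewrite ?orbF //.
  by rewrite (negbTE g0N) orbF.
have uts : uniq ts.
  rewrite /ts !cat_uniq urp (map_inj_uniq (@oppr_inj _)) urn andbT.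
  have -> : uniq zs by rewrite /zs; case: ifP.
  rewrite /= ; apply/andP; split; apply/hasPn => x.
    by rewrite mem_cat rpx rnx zsx => /orP[] /andP[x0 _]; rewrite ?(gt_eqF x0) ?(lt_eqF x0) andbF.
  by rewrite rnx rpx => /andP[x0 _]; rewrite ltNge (ltW x0).
have pts : perm_eq rs (filter I ts).
  by apply: uniq_perm; rewrite ?filter_uniq // => x; rewrite mem_filter tsx rsE.
rewrite (perm_size pts) size_filter /ts !count_cat count_map add0n -addnA.
congr (_ + (_ + _))%N; first by rewrite /zs /I; case: (0 < k)%N => //=; rewrite addn0.
by apply: eq_count => x /=; rewrite /I -(in_interval_opp bl br u v (- x)) opprK.
Qed.

End CountRoots.

(** * Cost and main theorem *)

Notation r_rb := 6%N (only parsing).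
Notation r_eps := 7%N (only parsing).

(** Taking half of the smaller of [eps] and [Rb] for [low] ensures both [low < eps] and
    [U / low >= 2], even for large [eps]. *)
Definition range_cmd : cmd :=
  (rU ::= V r_rb;; If (r_eps - r_rb) (rL ::= r_rb / N 2) (rL ::= r_eps / N 2);;
   rH ::= rU / rL)%C.
Definition approx_all_cmd : cmd :=
  (norm_cmd;; rcnt ::= N 0;; If (a0r - N 1) (tx ::= N 0;; append_cmd) Skip;;
   range_cmd;; setup_cmd;; branch_approx_cmd;; copy_cmd;; branch_approx_cmd)%C.

Section Main.
Variable R : realType.
Implicit Types (s : mstate R) (x y z : R).

Lemma wp_range s (Rb eps : R) : 0 < Rb -> 0 < eps -> s r_rb = Rb -> s r_eps = eps ->
  wp range_cmd s (fun t s' => (t <= 40)%N /\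
    [/\ s' rL = Num.min eps Rb / 2, s' rU = Rb & s' rH = Rb / (Num.min eps Rb / 2)]).
Proof.
move=> Rb0 eps0 h6 h7.
have m0 : 0 < Num.min eps Rb by rewrite lt_min eps0.
apply/wp_seq/(@wp_asg_eq _ _ _ Rb) => //.
apply/wp_seq; apply: (@wp_conseq _ _ _ (fun t s' => (t <= 20)%N /\
   s' rL = Num.min eps Rb / 2)).
  apply: wp_if => // g; rewrite /= /upd /= h6 h7 ?subr_ge0 ?subr_lt0 in g.
    apply: (@wp_asg_eq _ _ _ (Num.min eps Rb / 2)) => //.
      by split=> //; rewrite /= pnatr_eq0.
    by rewrite /= /upd /= h6 (min_idPr g).
  apply: (@wp_asg_eq _ _ _ (Num.min eps Rb / 2)) => //.
    by split=> //; rewrite /= pnatr_eq0.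
  by rewrite /= /upd /= h7 (min_idPl (ltW g)).
move=> t1 s1 f1 [t1l hL].
have hU : s1 rU = Rb by rewrite f1.
apply: (@wp_asg_eq _ _ _ (Rb / (Num.min eps Rb / 2))).
- by split=> //; rewrite /= hL gt_eqF // divr_gt0.
- by rewrite /= hU hL.
split; first by move: t1l; clear; rewrite /=; lia.
by split.
Qed.

Lemma wp_approx_all s (c0 c1 c2 : R) (a0 a1 a2 : nat) (f := trinom c0 c1 c2 a0 a1 a2)
    L kap (Rb eps : R) :
  0 < Rb -> 0 < eps -> f != 0 -> ((size f).-1 < 2 ^ L)%N ->
  Rb / (Num.min eps Rb / 2) <= 2%:R ^+ (2 ^ kap) ->
  s 0%N = c0 -> s 1%N = c1 -> s 2%N = c2 -> s 3%N = a0%:R -> s 4%N = a1%:R -> s 5%N = a2%:R ->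
  s r_rb = Rb -> s r_eps = eps ->
  wp approx_all_cmd s (fun t s' => (t <= L.+1 * (L + kap).+1 * (9 * 4100))%N /\
    exists2 zs, (size zs <= 3)%N & outputs s' zs /\
      eps_approx_roots f (fun x => (0 <= x) && (x <= Rb)) eps zs).
Proof.
move=> Rb0 eps0 f0 fL Hk h0 h1 h2 h3 h4 h5 h6 h7.
set low := Num.min eps Rb / 2 in Hk.
have m0 : 0 < Num.min eps Rb by rewrite lt_min eps0.
have me : Num.min eps Rb <= eps by rewrite ge_min lexx.
have mR : Num.min eps Rb <= Rb by rewrite ge_min lexx orbT.
have low0 : 0 < low by rewrite divr_gt0.
have lowU : 2 * low <= Rb by rewrite /low; lra.
have lowe : low < eps by rewrite /low; lra.
have W1 : (L.+1 <= L.+1 * (L + kap).+1)%N by rewrite leq_pmulr.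
apply/wp_seq; apply: wp_conseq (wp_norm f0 fL h0 h1 h2 h3 h4 h5) _.
move=> n1 s1 f1 [n1l [k [d0 [d1 [d2 [a [b [hk hn nf fE]]]]]]]].
have h61 : s1 r_rb = Rb by rewrite f1.
have h71 : s1 r_eps = eps by rewrite f1.
rewrite -/f in fE; clearbody f.
apply/wp_seq/(@wp_asg_eq _ _ _ 0) => //.
pose zr : seq R := if (0 < k)%N then [:: 0] else [::].
set s1' := upd s1 rcnt 0.
have out0 : outputs_for Rb eps s1' [::] by exists [::].
apply/wp_seq; apply: (@wp_conseq _ _ _ (fun t s' => (t <= 60)%N /\ outputs_for Rb eps s' zr)).
  apply: wp_if => // g; rewrite /= /s1' /upd /= hk ?subr_ge0 ?subr_lt0 in g.
    apply/wp_seq/(@wp_asg_eq _ _ _ 0) => //.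
    have ap : approximates Rb eps 0 (upd s1' tx 0 tx).
      by right; rewrite /upd /= subrr normr0 ltW.
    have out1 : outputs_for Rb eps (upd s1' tx 0) [::] by exists [::].
    apply: wp_conseq (wp_append (isT : size [::] <= 2)%N out1 ap) _.
    move=> t s' _ [tl H]; split; first by move: tl; clear; rewrite /=; lia.
    by move: H g; rewrite ltW // /zr ler1n => H ->.
  by apply: wp_skip; move: g; rewrite ltr_nat ltnS leqn0 => /eqP k0; rewrite /zr k0.
move=> n2 s2 f2 [n2l out2].
have h62 : s2 r_rb = Rb by rewrite f2.
have h72 : s2 r_eps = eps by rewrite f2.
have hn2 : has_normal d0 d1 d2 a b s2 by case: hn => *; rewrite /has_normal !f2.
apply/wp_seq; apply: wp_conseq (wp_range Rb0 eps0 h62 h72) _.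
rewrite -/low => n3 s3 f3 [n3l [hL3 hU3 hH3]].
have hn3 : has_normal d0 d1 d2 a b s3 by case: hn2 => *; rewrite /has_normal !f3.
have zr1 : (size zr <= 1)%N by rewrite /zr; case: ifP.
have out3 : outputs_for Rb eps s3 zr.
  apply: outputs_for_frame out2; last exact: leq_trans zr1 _.
  by move=> i; rewrite !inE => /or4P[] /eqP->; rewrite f3.
apply/wp_seq; apply: wp_conseq (wp_setup nf hn3) _ => n4 s4 f4.
move=> [n4l [rs [hM [o1 [o2 [sl1 sl2 rsE urs rsg]]]]]].
have out4 : outputs_for Rb eps s4 zr.
  apply: outputs_for_frame out3; last exact: leq_trans zr1 _.
  by move=> i; rewrite !inE => /or4P[] /eqP->; rewrite f4.
have ML : 2 * b%:R <= 2%:R ^+ L.+1 :> R.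
  rewrite exprS; apply: ler_wpM2l => //; rewrite -natrX ler_nat ltnW //.
  by case: nf.
have hr4 : has_range (2 * b%:R) low Rb s4 by rewrite /has_range (f4 rL) // (f4 rU) // (f4 rH) //; split.
have sz1 o (r : seq R) : (size (opt_filter (fun x => (x <= Rb)%R) r o) <= (size r).+1)%N.
  by case: o => [x|] //=; case: ifP; rewrite ?size_rcons.
have zr2 : (size zr <= 2)%N by apply: leq_trans zr1 _.
apply/wp_seq; apply: wp_conseq.
  exact: (wp_branch_approx low0 lowU lowe Hk ML zr2 out4 hr4 sl1).
move=> n5 s5 f5 [n5l out5].
set r5 := opt_filter _ _ _ in out5.
have r52 : (size r5 <= 2)%N by apply: leq_trans (sz1 _ _) _.
have sl5 : slot L (2 * b%:R) s5 30 o2.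
  apply: slot_copy sl2 => i i7; apply: f5.
  by case: i i7 => [|[|[|[|[|[|[|i]]]]]]].
apply/wp_seq; apply: wp_conseq (wp_copy sl5) _ => n6 s6 f6 [n6l sl6].
have out6 : outputs_for Rb eps s6 r5.
  apply: outputs_for_frame out5; last exact: leq_trans r52 _.
  by move=> i; rewrite !inE => /or4P[] /eqP->; rewrite f6.
have hr6 : has_range (2 * b%:R) low Rb s6.
  by case: hr4 => *; rewrite /has_range !f6 // !f5.
apply: wp_conseq.
  exact: (wp_branch_approx low0 lowU lowe Hk ML r52 out6 hr6 sl6).
move=> n7 s7 f7 [n7l [zs [ozs szs zsI zsx]]].
set r7 := opt_filter _ _ _ in szs zsx.
have r73 : (size r7 <= 3)%N by apply: leq_trans (sz1 _ _) _.
split.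
  by move: n1l n2l n3l n4l n5l n6l n7l W1; clear; rewrite /=; lia.
exists zs; first by rewrite szs.
split=> //.
have r7E : r7 = zr ++ filter (fun x => x <= Rb) rs.
  rewrite /r7 /r5 rsE /opt_filter; case: (o1) => [x|]; case: (o2) => [y|] //=; rewrite ?cats0 //;
  do ?[case: ifP => _]; rewrite ?cats0 ?cats1 -?cats1 -?catA ?cats0 //.
have rs0 x : x \in rs -> 0 < x.
  have pos k' o s' y : slot L (2 * b%:R) s' k' o -> o = Some y -> 0 < y.
    case: o => // w [_ [A [B [C [m [l [z [_ [_ [z0 _ _]] _ _ hx]]]]]]]] [<-].
    by case: hx => [] [_ ->]; rewrite ?invr_gt0.
  rewrite rsE mem_pmap map_id !inE => /orP[] /eqP e; [exact: pos sl1 _|exact: pos sl2 _].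
have mem7 x : (x \in r7) = (0 <= x <= Rb) && root f x.
  rewrite r7E mem_cat mem_filter /root fE mulf_eq0 expf_eq0.
  have -> : (x \in zr) = (0 < k)%N && (x == 0) by rewrite /zr; case: (0 < k)%N; rewrite ?inE.
  case: (ltrgt0P x) => [x0|x0|->] /=.
  - by rewrite andbF rsg.
  - by rewrite andbF /=; apply/negbTE/negP => /andP[_ /rs0]; rewrite ltNge ltW.
  have -> : (0 \in rs) = false by apply/negbTE/negP => /rs0; rewrite ltxx.
  by rewrite andbF orbF (ltW Rb0) (negbTE (g3_at0 nf)) orbF.
have u7 : uniq r7.
  rewrite r7E cat_uniq filter_uniq // andbT; apply/andP; split; first by rewrite /zr; case: ifP.
  apply/hasPn => x; rewrite mem_filter => /andP[_ /rs0 x0]; rewrite /zr; case: ifP => _ //.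
  by rewrite inE gt_eqF.
split.
- by move=> z /zsI.
- move=> s' us' s'E; rewrite szs; apply: perm_size; apply: uniq_perm => // x.
  by rewrite mem7 s'E.
- by move=> x xI xr; apply: zsx; rewrite mem7 xI.
Qed.

(** * Bit lengths against natural logarithms *)

Lemma ln2_ge : 1 / 2 <= ln (2 : R).
Proof.
have h : -1 < - 2^-1 :> R by lra.
have := le_ln1Dx h; have -> : 1 + - 2^-1 = 2^-1 :> R by field.
by rewrite lnV ?posrE //; lra.
Qed.

Lemma ln2_le : ln (2 : R) <= 1.
Proof. by have := @le_ln1Dx R 1; apply; lra. Qed.

Lemma trunc_log_le_ln n : (0 < n)%N -> (trunc_log 2 n)%:R <= 2 * ln (n%:R : R).
Proof.
move=> n0; set t := trunc_log 2 n.
have /andP[tn _] := trunc_log_bounds (isT : 1 < 2)%N n0.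
have : ln (2%:R ^+ t : R) <= ln n%:R.
  by rewrite ler_ln ?posrE ?exprn_gt0 ?ltr0n // -natrX ler_nat.
rewrite lnXn // -[ln 2 *+ t]mulr_natl => H; have t0 : 0 <= t%:R :> R by [].
have := ler_wpM2l t0 ln2_ge; lra.
Qed.

Lemma ln_degree_ge (D : nat) : 1 / 2 <= ln (D.+3%:R : R).
Proof.
apply: le_trans ln2_ge _; rewrite ler_ln ?posrE ?ltr0n //.
by rewrite -[2]/(2%:R) ler_nat.
Qed.

Lemma degree_log (D : nat) : exists2 L, (D < 2 ^ L)%N & L.+1%:R <= 6 * ln (D.+3%:R : R).
Proof.
(* The shift by 3 keeps the logarithm at least [1 / 2], which absorbs additive constants:
   [L + 1 <= 2 ln + 2 <= 6 ln]. *)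
exists (trunc_log 2 D.+3).+1.
  by apply: leq_trans (trunc_log_ltn D.+3 (isT : 1 < 2)%N); rewrite ltnS leqW // leqW.
have -> : (trunc_log 2 D.+3).+2%:R = (trunc_log 2 D.+3)%:R + 2 :> R by rewrite -addn2 natrD.
have := trunc_log_le_ln (ltn0Sn D.+2); have := ln_degree_ge D; lra.
Qed.

Lemma range_log (D : nat) (Rb eps : R) (y := 3 + Num.max 0 (ln (Rb / eps))) : 0 < Rb -> 0 < eps ->
  exists2 kap, Rb / (Num.min eps Rb / 2) <= 2%:R ^+ (2 ^ kap)
    & kap%:R <= 4 * ln (D.+3%:R : R) + 2 * ln y.
Proof.
move=> Rb0 eps0.
have m0 : 0 < Num.min eps Rb by rewrite lt_min eps0.
have y3 : 3 <= y by rewrite /y lerDl le_max lexx.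
have y0 : 0 < y by lra.
(* It suffices that [2 ^ kap * ln 2 >= y], as [y] bounds the logarithm of [H], its factor 2
   included; the 2 compensates for [ln 2 >= 1 / 2]. *)
pose n := (Num.truncn (2 * y)).+1.
have yn : 2 * y < n%:R by rewrite /n truncnS_gt.
have ny : n%:R <= 3 * y.
  have /andP[h _] : (Num.truncn (2 * y))%:R <= 2 * y < n%:R by apply: truncn_itv; lra.
  by rewrite /n -natr1; lra.
exists (trunc_log 2 n).+1.
  have k2 : (n < 2 ^ (trunc_log 2 n).+1)%N by exact: trunc_log_ltn.
  have H0 : 0 < Rb / (Num.min eps Rb / 2) by rewrite divr_gt0 // divr_gt0.
  rewrite -ler_ln ?posrE ?exprn_gt0 // lnXn // -[ln 2 *+ _]mulr_natl.
  apply: le_trans (_ : n%:R * (1 / 2) <= _); last first.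
    apply: ler_pM => //; [by lra|by rewrite ler_nat ltnW|exact: ln2_ge].
  apply: le_trans (_ : y <= _); last by lra.
  have -> : Rb / (Num.min eps Rb / 2) = 2 * (Rb / Num.min eps Rb) by field; rewrite gt_eqF.
  rewrite lnM ?posrE ?divr_gt0 //; have := ln2_le.
  suff : ln (Rb / Num.min eps Rb) <= Num.max 0 (ln (Rb / eps)) by rewrite /y; lra.
  case: (leP eps Rb) => [eR|Re].
    by rewrite le_max lexx orbT.
  by rewrite divff ?gt_eqF // ln1 le_max lexx.
have := trunc_log_le_ln (ltn0Sn _ : 0 < n)%N => h.
have : ln (n%:R : R) <= ln (3 * y).
  by rewrite ler_ln // posrE; [rewrite ltr0n|lra].
rewrite lnM ?posrE //.
have : ln (3 : R) <= ln (D.+3%:R).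
  by rewrite ler_ln ?posrE ?ltr0n // -[3]/(3%:R) ler_nat.
have -> : (trunc_log 2 n).+1%:R = (trunc_log 2 n)%:R + 1 :> R by rewrite -addn1 natrD.
have := ln_degree_ge D; lra.
Qed.

End Main.

(** With [d = ln (D + 3)], the two factors are at most [6 d] and [10 d + 2 ln y <= 10 (d + ln y)]:
    this is the 60. Raising 9 * 4100 to 10 * 4000 absorbs the final halt. *)
Lemma cost_approx_bound (R : realType) (D L kap n : nat) (Rb eps : R) :
  L.+1%:R <= 6 * ln (D.+3%:R : R) ->
  kap%:R <= 4 * ln (D.+3%:R : R) + 2 * ln (3 + Num.max 0 (ln (Rb / eps))) ->
  (n <= L.+1 * (L + kap).+1 * (9 * 4100))%N ->
  n.+1%:R <= (60 * (10 * 4000))%N%:R * cost_approx D Rb eps.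
Proof.
move=> hL hk hn; rewrite /cost_approx.
set y := 3 + _ in hk *; set d := ln _ in hL hk *.
have y3 : 3 <= y by rewrite /y lerDl le_max lexx.
rewrite lnM ?posrE //; last by lra.
rewrite -/d; have d0 : 1 / 2 <= d by exact: ln_degree_ge.
have ly : 0 <= ln y by apply: ln_ge0; lra.
have {}hn : n.+1%:R <= L.+1%:R * (L + kap).+1%:R * (10 * 4000)%N%:R :> R.
  rewrite -!natrM ler_nat; move: hn.
  have : (0 < L.+1 * (L + kap).+1)%N by [].
  move: (L.+1 * (L + kap).+1)%N; clear; lia.
apply: le_trans hn _; rewrite [(60 * _)%N%:R]natrM; set K := (10 * 4000)%N%:R.
have -> : 60%:R * K * (d * (d + ln y)) = 6 * d * (10 * (d + ln y)) * K by ring.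
apply: ler_wpM2r; first exact: ler0n.
have e : (L + kap).+1%:R = L.+1%:R + kap%:R :> R by rewrite -natrD addSn.
by apply: ler_pM => //; rewrite e; lra.
Qed.

Lemma cost_count_bound (R : realType) (D L n : nat) : L.+1%:R <= 6 * ln (D.+3%:R : R) ->
  (n <= L.+1 * (2 * 4000))%N -> n.+1%:R <= (12 * (3 * 4000))%N%:R * cost_count R D.
Proof.
move=> hL hn; rewrite /cost_count; have d0 := ln_degree_ge R D.
set d := ln _ in hL d0 *.
have {}hn : n.+1%:R <= L.+1%:R * (3 * 4000)%N%:R :> R.
  by rewrite -natrM ler_nat; move: hn; clear; lia.
apply: le_trans hn _; rewrite [(12 * _)%N%:R]natrM; set K := (3 * 4000)%N%:R.
have -> : 12%:R * K * d ^+ 2 = 12 * d ^+ 2 * K by ring.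
apply: ler_wpM2r; first exact: ler0n.
apply: le_trans hL _; rewrite expr2.
have : d * (1 / 2) <= d * d by apply: ler_wpM2l => //; lra.
lra.
Qed.

Theorem theorem1p1 :
  (* (1) eps-approximating the roots in [0, R] *)
  (exists (p : program) (C : nat),
    forall (R : realType) (c0 c1 c2 : R) (a0 a1 a2 : nat) (Rb eps : R),
      0 < Rb -> 0 < eps -> trinom c0 c1 c2 a0 a1 a2 != 0 ->
      let f := trinom c0 c1 c2 a0 a1 a2 in
      let D := (size f).-1 in
      exists (n : nat) (st : mstate R),
        [/\ runs_within p [:: c0; c1; c2; a0%:R; a1%:R; a2%:R; Rb; eps] n st,
            n%:R <= C%:R * cost_approx D Rb eps
          & exists zs, outputs st zs /\
              eps_approx_roots f (fun x => (0 <= x) && (x <= Rb)) eps zs])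
  /\
  (* (2) exact count of roots in any bounded interval *)
  (exists (p : program) (C : nat),
    forall (R : realType) (c0 c1 c2 : R) (a0 a1 a2 : nat) (a b : R) (bl br : bool),
      trinom c0 c1 c2 a0 a1 a2 != 0 ->
      let f := trinom c0 c1 c2 a0 a1 a2 in
      let D := (size f).-1 in
      exists (n : nat) (st : mstate R),
        [/\ runs_within p [:: c0; c1; c2; a0%:R; a1%:R; a2%:R; a; b;
                                (bl : nat)%:R; (br : nat)%:R] n st,
            n%:R <= C%:R * cost_count R D
          & forall s : seq R, uniq s ->
              (forall x, (x \in s) = in_interval bl br a b x && root f x) ->
              st 10%N = (size s)%:R]).
Proof.
split.
  exists (ccode approx_all_cmd 0), (60 * (10 * 4000))%N.
  move=> R c0 c1 c2 a0 a1 a2 Rb eps Rb0 eps0 f0 f D.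
  have [L DL hL] := degree_log R D.
  have [kap Hk hk] := range_log D Rb0 eps0.
  have [n [st [b [nl [zs zs3 [ozs ap]]]]]] :=
    @wp_approx_all R (init_state [:: c0; c1; c2; a0%:R; a1%:R; a2%:R; Rb; eps])
      c0 c1 c2 a0 a1 a2 L kap Rb eps Rb0 eps0 f0 DL Hk
      erefl erefl erefl erefl erefl erefl erefl erefl.
  (* That a closed program uses only registers below [tmp] is decided by computation. *)
  have [|s rs ag] := runs_compiled _ b; first by vm_compute.
  exists n.+1, s; split=> //; first exact: cost_approx_bound hL hk nl.
  exists zs; split=> //; apply: outputs_frame zs3 _ ozs => k.
  by rewrite !inE => /or4P[] /eqP->; rewrite ag.
exists (ccode count_cmd 0), (12 * (3 * 4000))%N.
move=> R c0 c1 c2 a0 a1 a2 a b bl br f0 f D.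
have [L DL hL] := degree_log R D.
set s0 := init_state [:: c0; c1; c2; a0%:R; a1%:R; a2%:R; a; b; (bl : nat)%:R; (br : nat)%:R].
have hI : has_interval a b bl br s0 by split.
have [n [st [bst [nl cnt]]]] :=
  @wp_count R s0 c0 c1 c2 a0 a1 a2 L a b bl br f0 DL erefl erefl erefl erefl erefl erefl hI.
have [|s rs ag] := runs_compiled _ bst; first by vm_compute.
exists n.+1, s; split=> //; first exact: cost_count_bound hL nl.
by move=> s' us s'E; rewrite ag //; exact: cnt us s'E.
Qed.
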